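(* Fix $h\ge0$, $D\in\mathbb R$. There exists $\beta'>0$ such that for every $\beta\in(0,\beta')$, $$\nu(T^2)=A_0^2+O(N^{-3/2}),\qquad \nu(S^2)=B_0^2+O(N^{-3/2}),\qquad \nu(ST)=C_0^2+O(N^{-3/2}),$$ with implied constants independent of $N$.
   Context: Fix an integer $\mathcal S\ge1$ and $N\ge2$; $\Sigma_N=\{0,\pm1,\dots,\pm\mathcal S\}^N$. For $\beta>0$, $h\ge0$, $D\in\mathbb R$ and i.i.d. standard Gaussians $(g_{i,j})_{i<j}$, $H_N(\sigma)=\frac{\beta}{\sqrt N}\sum_{i<j}g_{i,j}\sigma_i\sigma_j+D\sum_i\sigma_i^2+h\sum_i\sigma_i$, Gibbs measure $G(\sigma)\propto e^{H_N(\sigma)}$ on $\Sigma_N$; $\langle\cdot\rangle$ is the Gibbs average, $\nu(f)=\mathbb E\langle f\rangle$. $p,q$: for $\eta\sim N(0,1)$, $\langle\phi\rangle_\eta=\sum_s\phi(s)w_\eta(s)/\sum_sw_\eta(s)$, $w_\eta(s)=\exp(\beta\sqrt q\eta s+hs+(D+\frac{\beta^2}{2}(p-q))s^2)$, $s\in\{0,\pm1,\dots,\pm\mathcal S\}$; $(p,q)$ solves $q=\mathbb E\langle s\rangle_\eta^2$, $p=\mathbb E\langle s^2\rangle_\eta$ (unique at high temperature). $T=\frac1N\sum_i\langle\sigma_i\rangle^2-q$, $S=\frac1N\sum_i\langle\sigma_i^2\rangle-p$. Constants: $m_j=\langle s^j\rangle_\eta$, expectations over $\eta$: $A=\mathbb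 E[(m_2-m_1^2)^2]$, $\mathcal D=\mathbb E[m_4-m_2^2]$, $F=\mathbb E[m_2^2-m_1^2m_2]$, $G=\mathbb E[m_1^2(m_2-m_1^2)]$, $\mathcal E=\mathbb E[m_1(m_3-m_1m_2)]$, $I_3=\mathbb E[m_1^4]-q^2$, $I_5=\mathbb E[m_1^2m_2]-pq$, $K_4=\mathbb E[m_2^2]-p^2$; $M_1=1-\beta^2(F-3G)$, $M_2=1-\frac{\beta^2}{2}\mathcal D$, $M_3=1-\beta^2(F-G)$, $M=M_1M_2+\beta^4\mathcal E^2$; $A_2^2=\frac{A}{N(1-\beta^2A)}$, $A_1^2=\frac{GM_2+\frac{\beta^2}{2}\mathcal E^2}{NMM_3}$, $B_1^2=\frac{\mathcal DM_1-2\beta^2\mathcal E^2}{NM}$, $C_1^2=\frac{\mathcal E}{NM}$; $A_0^2=\frac{\beta^2}{M}(\beta^2\mathcal EK_4+M_2I_5)C_1^2+\frac{2\beta^2}{M}(\beta^2\mathcal E(\mathcal E-I_5)+M_2(2G-I_3))A_1^2+\frac{\beta^2}{M}(\beta^2\mathcal EI_5+M_2I_3)A_2^2+\frac{1}{MN}(\beta^2\mathcal EI_5+M_2I_3)$, $B_0^2=\frac{\beta^2}{2M}(M_1K_4-\beta^2\mathcal EI_5)B_1^2+\frac{\beta^2}{M}(M_1(\mathcal E-I_5)-\beta^2\mathcal E(2G-I_3))C_1^2+\frac{1}{MN}(M_1K_4-\beta^2\mathcal EI_5)$, $C_0^2=\frac{\beta^2}{2M}(M_2I_5+\beta^2\mathcal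 EK_4)B_1^2+\frac{\beta^2}{M}(M_2(2G-I_3)+\beta^2\mathcal E(\mathcal E-I_5))C_1^2+\frac{1}{MN}(M_2I_5+\beta^2\mathcal EK_4)$. *)

(* Defs.v *)
From HB Require Import structures.
From mathcomp Require Import all_boot all_order all_algebra.
From mathcomp Require Import all_classical all_reals all_analysis.
Set Implicit Arguments. Unset Strict Implicit. Unset Printing Implicit Defensive.
Import Order.TTheory GRing.Theory Num.Theory.
Import numFieldNormedType.Exports.
Local Open Scope ring_scope.

Definition spin {R : realType} (S : nat) (k : 'I_(S.*2.+1)) : R := k%:R - S%:R.

Definition gaussE {R : realType} (f : R -> R) : R :=
  Rintegral (normal_prob (0 : R) 1) setT f.

(* Expectation of F(y) where y_0, ..., y_(M-1) are i.i.d. N(0,1)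
   (coordinates >= M are set to 0 and unused); iterated integral. *)
Fixpoint gaussEn {R : realType} (M : nat) (F : (nat -> R) -> R) : R :=
  match M with
  | 0 => F (fun _ => 0)
  | M'.+1 => gaussE (fun x => gaussEn M' (fun y => F (fun k => if k == M' then x else y k)))
  end.

Definition config (S N : nat) := {ffun 'I_N -> 'I_(S.*2.+1)}.

(* Hamiltonian; the disorder g_{i,j} (i<j) is the coordinate y (i*N + j). *)
Definition hamil {R : realType} (S N : nat) (beta h D : R) (y : nat -> R)
    (sigma : config S N) : R :=
  beta / Num.sqrt (N%:R) *
    (\sum_(i < N) \sum_(j < N | (i < j)%N) y (i * N + j)%N * spin (sigma i) * spin (sigma j))
  + D * (\sum_(i < N) spin (sigma i) ^+ 2) + h * (\sum_(i < N) spin (sigma i)).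

Definition gibbs {R : realType} (S N : nat) (beta h D : R) (y : nat -> R)
    (f : config S N -> R) : R :=
  (\sum_(sigma : config S N) f sigma * expR (hamil beta h D y sigma))
  / (\sum_(sigma : config S N) expR (hamil beta h D y sigma)).

Definition Tq {R : realType} (S N : nat) (beta h D q : R) (y : nat -> R) : R :=
  N%:R^-1 * (\sum_(i < N) (gibbs beta h D y (fun sigma : config S N => spin (sigma i))) ^+ 2) - q.
Definition Sp {R : realType} (S N : nat) (beta h D p : R) (y : nat -> R) : R :=
  N%:R^-1 * (\sum_(i < N) gibbs beta h D y (fun sigma : config S N => spin (sigma i) ^+ 2)) - p.

(* nu(X) = E <X> for X depending on the disorder only: expectation over the
   N*N Gaussians (those with i < j are the g_{i,j}; the others are unused). *)
Definition nu {R : realType} (N : nat) (X : (nat -> R) -> R) : R := gaussEn (N * N) X.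

Definition wsite {R : realType} (beta h D p q eta s : R) : R :=
  expR (beta * Num.sqrt q * eta * s + h * s + (D + beta ^+ 2 / 2 * (p - q)) * s ^+ 2).
Definition site_avg {R : realType} (S : nat) (beta h D p q : R) (phi : R -> R) (eta : R) : R :=
  (\sum_(k < S.*2.+1) phi (spin k) * wsite beta h D p q eta (spin k))
  / (\sum_(k < S.*2.+1) wsite beta h D p q eta (spin k)).
Definition mj {R : realType} (S : nat) (beta h D p q : R) (j : nat) (eta : R) : R :=
  site_avg S beta h D p q (fun s => s ^+ j) eta.

Definition fixed_point {R : realType} (S : nat) (beta h D p q : R) : Prop :=
  q = gaussE (fun eta => mj S beta h D p q 1 eta ^+ 2) /\
  p = gaussE (fun eta => mj S beta h D p q 2 eta).


Definition cA {R : realType} S (beta h D p q : R) :=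
  gaussE (fun e => (mj S beta h D p q 2 e - mj S beta h D p q 1 e ^+ 2) ^+ 2).
Definition cD {R : realType} S (beta h D p q : R) :=
  gaussE (fun e => mj S beta h D p q 4 e - mj S beta h D p q 2 e ^+ 2).
Definition cF {R : realType} S (beta h D p q : R) :=
  gaussE (fun e => mj S beta h D p q 2 e ^+ 2 - mj S beta h D p q 1 e ^+ 2 * mj S beta h D p q 2 e).
Definition cG {R : realType} S (beta h D p q : R) :=
  gaussE (fun e => mj S beta h D p q 1 e ^+ 2 * (mj S beta h D p q 2 e - mj S beta h D p q 1 e ^+ 2)).
Definition cE {R : realType} S (beta h D p q : R) :=
  gaussE (fun e => mj S beta h D p q 1 e * (mj S beta h D p q 3 e - mj S beta h D p q 1 e * mj S beta h D p q 2 e)).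
Definition cI3 {R : realType} S (beta h D p q : R) :=
  gaussE (fun e => mj S beta h D p q 1 e ^+ 4) - q ^+ 2.
Definition cI5 {R : realType} S (beta h D p q : R) :=
  gaussE (fun e => mj S beta h D p q 1 e ^+ 2 * mj S beta h D p q 2 e) - p * q.
Definition cK4 {R : realType} S (beta h D p q : R) :=
  gaussE (fun e => mj S beta h D p q 2 e ^+ 2) - p ^+ 2.

Definition cM1 {R : realType} S (beta h D p q : R) :=
  1 - beta ^+ 2 * (cF S beta h D p q - 3 * cG S beta h D p q).
Definition cM2 {R : realType} S (beta h D p q : R) :=
  1 - beta ^+ 2 / 2 * cD S beta h D p q.
Definition cM3 {R : realType} S (beta h D p q : R) :=
  1 - beta ^+ 2 * (cF S beta h D p q - cG S beta h D p q).
Definition cM {R : realType} S (beta h D p q : R) :=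
  cM1 S beta h D p q * cM2 S beta h D p q + beta ^+ 4 * cE S beta h D p q ^+ 2.

Definition A2sq {R : realType} S (beta h D p q : R) (N : nat) :=
  cA S beta h D p q / (N%:R * (1 - beta ^+ 2 * cA S beta h D p q)).
Definition A1sq {R : realType} S (beta h D p q : R) (N : nat) :=
  (cG S beta h D p q * cM2 S beta h D p q + beta ^+ 2 / 2 * cE S beta h D p q ^+ 2)
  / (N%:R * cM S beta h D p q * cM3 S beta h D p q).
Definition B1sq {R : realType} S (beta h D p q : R) (N : nat) :=
  (cD S beta h D p q * cM1 S beta h D p q - 2 * beta ^+ 2 * cE S beta h D p q ^+ 2)
  / (N%:R * cM S beta h D p q).
Definition C1sq {R : realType} S (beta h D p q : R) (N : nat) :=
  cE S beta h D p q / (N%:R * cM S beta h D p q).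

Definition A0sq {R : realType} S (beta h D p q : R) (N : nat) :=
  let E := cE S beta h D p q in let G := cG S beta h D p q in
  let I3 := cI3 S beta h D p q in let I5 := cI5 S beta h D p q in
  let K4 := cK4 S beta h D p q in let M := cM S beta h D p q in
  let M2 := cM2 S beta h D p q in
  beta ^+ 2 / M * (beta ^+ 2 * E * K4 + M2 * I5) * C1sq S beta h D p q N
  + 2 * beta ^+ 2 / M * (beta ^+ 2 * E * (E - I5) + M2 * (2 * G - I3)) * A1sq S beta h D p q N
  + beta ^+ 2 / M * (beta ^+ 2 * E * I5 + M2 * I3) * A2sq S beta h D p q N
  + (M * N%:R)^-1 * (beta ^+ 2 * E * I5 + M2 * I3).

Definition B0sq {R : realType} S (beta h D p q : R) (N : nat) :=
  let E := cE S beta h D p q in let G := cG S beta h D p q in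
  let I3 := cI3 S beta h D p q in let I5 := cI5 S beta h D p q in
  let K4 := cK4 S beta h D p q in let M := cM S beta h D p q in
  let M1 := cM1 S beta h D p q in
  beta ^+ 2 / (2 * M) * (M1 * K4 - beta ^+ 2 * E * I5) * B1sq S beta h D p q N
  + beta ^+ 2 / M * (M1 * (E - I5) - beta ^+ 2 * E * (2 * G - I3)) * C1sq S beta h D p q N
  + (M * N%:R)^-1 * (M1 * K4 - beta ^+ 2 * E * I5).

Definition C0sq {R : realType} S (beta h D p q : R) (N : nat) :=
  let E := cE S beta h D p q in let G := cG S beta h D p q in
  let I3 := cI3 S beta h D p q in let I5 := cI5 S beta h D p q in
  let K4 := cK4 S beta h D p q in let M := cM S beta h D p q in
  let M2 := cM2 S beta h D p q in
  beta ^+ 2 / (2 * M) * (M2 * I5 + beta ^+ 2 * E * K4) * B1sq S beta h D p q N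
  + beta ^+ 2 / M * (M2 * (2 * G - I3) + beta ^+ 2 * E * (E - I5)) * C1sq S beta h D p q N
  + (M * N%:R)^-1 * (M2 * I5 + beta ^+ 2 * E * K4).

(* Main.v *)
(* Cavity method. The couplings of a site i are switched off along an angle,
   while an independent Gaussian of matching variance is switched on, so that
   site i becomes the one-spin system whose moments define p and q. Gaussian
   integration by parts shows that each derivative along this path gains a
   factor beta^2 times a deviation of an overlap from p or q. For small beta
   this bounds the second and fourth moments of the overlap deviations by
   O(1/N) and O(1/N^2). Since overlaps are averages over sites, a second-order
   expansion of one factor of a product of two overlaps then yields, up to
   O(N^(-3/2)), a closed linear system for the seven second moments of overlaps
   of four replicas. The constants A_j, B_j, C_j are its exact solution, and for
   small beta the system is a contraction, so it determines the moments up to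
   O(N^(-3/2)). *)

Require Import Defs.
From HB Require Import structures.
From mathcomp Require Import all_boot all_order all_algebra all_fingroup.
From mathcomp Require Import all_classical all_reals all_analysis.
From mathcomp Require Import measurable_realfun ring lra.
Set Implicit Arguments. Unset Strict Implicit. Unset Printing Implicit Defensive.
Import Order.TTheory GRing.Theory Num.Theory.
Import numFieldNormedType.Exports.
Local Open Scope classical_set_scope.
Local Open Scope ring_scope.

(** * Gaussian integrals *)

(** An angle parametrizes the path because [sin] and [cos] are smooth at both ends, whereas a
    square-root amplitude is not differentiable at the decoupled end. Ten replicas are carried
    throughout: the observables involve four, each derivative along the path adds two, so a
    second-order expansion reaches eight, and comparing a function of eight replicas at an
    intermediate angle with the model costs one more derivative. Errors are always expressed by
    moments under the model itself, at angle pi / 2; a Gronwall comparison brings them there with a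
    constant free of N. No concentration is known beforehand: the moments of the deviations are
    bounded by a constant times beta^2 times themselves, plus a term of the right order in N, and
    small beta absorbs the first part. Since spins, p and q are bounded in terms of S, all
    thresholds on beta depend on S only, and every solution (p, q) of the fixed-point equations is
    covered. *)

Section OneDimensionalGaussian.
Context {R : realType}.
Implicit Types (f g : R -> R) (C m x : R).

Notation leb := (@lebesgue_measure R).
Notation phi := (normal_pdf (0 : R) 1).
Notation gam := (normal_prob (0 : R) 1).

(** Both functions have the same integral over every measurable set. Since [gaussE] integrates
    against a measure, this is what gives access to calculus on the Lebesgue side. *)
Lemma normal_pdf_ae_density :
  ae_eq leb setT (Radon_Nikodym_SigmaFinite.f gam leb) (EFin \o phi).
Proof.
apply: integral_ae_eq => //.
- exact: (Radon_Nikodym_SigmaFinite.f_integrable (normal_prob_dominates _ _)).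
- by apply/measurable_EFinP; exact: measurable_normal_pdf.
- move=> E _ mE.
  by rewrite -(Radon_Nikodym_SigmaFinite.f_integral (normal_prob_dominates _ _)).
Qed.

Lemma ge0_integral_normal_prob (f : R -> \bar R) : (forall x, (0 <= f x)%E) ->
  measurable_fun setT f ->
  (\int[gam]_x f x = \int[leb]_x (f x * (phi x)%:E))%E.
Proof.
move=> f0 mf.
rewrite -(Radon_Nikodym_SigmaFinite.change_of_variables (normal_prob_dominates _ _))//.
apply: ae_eq_integral => //.
- apply: emeasurable_funM => //; apply: (measurable_int leb).
  exact: (Radon_Nikodym_SigmaFinite.f_integrable (normal_prob_dominates _ _)).
- apply: emeasurable_funM => //; apply/measurable_EFinP; exact: measurable_normal_pdf.
- by apply: ae_eqe_mul2l; exact: normal_pdf_ae_density.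
Qed.

(** Completing the square: an exponential tilt of the standard density is a multiple of a shifted
    density, so exponential growth is integrable. *)
Lemma gauss_shift (m x : R) :
  expR (m * x) * phi x = expR (m ^+ 2 / 2) * normal_pdf m 1 x.
Proof.
rewrite !normal_pdfE ?oner_eq0// /normal_fun mulrCA [RHS]mulrCA -!expRD.
by congr (_ * expR _); rewrite !expr1n; field.
Qed.

Lemma integrable_expR_normal (m : R) :
  leb.-integrable setT (fun x => (expR (m * `|x|) * phi x)%:E).
Proof.
have iS : leb.-integrable setT (fun x : R => ((expR (m ^+ 2 / 2))%:E * (normal_pdf m 1 x)%:E
   + (expR (m ^+ 2 / 2))%:E * (normal_pdf (- m) 1 x)%:E)%E).
  by apply: integrableD => //; apply: integrableZl => //; exact: integrable_normal_pdf.
apply: (le_integrable measurableT _ _ iS).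
- apply/measurable_EFinP; apply: measurable_funM; last exact: measurable_normal_pdf.
  by apply: measurableT_comp => //; apply: measurable_funM => //; exact: measurableT_comp.
- move=> x _; rewrite -!EFinM -EFinD lee_fin.
  have -> : expR (m ^+ 2 / 2) * normal_pdf (- m) 1 x = expR (- m * x) * phi x.
    by rewrite (gauss_shift (- m) x) sqrrN.
  rewrite -(gauss_shift m x).
  have p0 := normal_pdf_ge0 (0:R) 1 x.
  rewrite [leLHS]ger0_norm ?mulr_ge0 ?expR_ge0//.
  rewrite [leRHS]ger0_norm ?addr_ge0 ?mulr_ge0 ?expR_ge0//.
  rewrite -mulrDl ler_wpM2r//.
  by case: (ler0P x) => _; rewrite ?mulrN ?mulNr ?lerDl ?lerDr expR_ge0.
Qed.

Definition expbd (f : R -> R) (C m : R) := forall x, `|f x| <= C * expR (m * `|x|).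

Lemma expbd_integrable_leb f C m : measurable_fun setT f -> expbd f C m ->
  leb.-integrable setT (fun x => (f x * phi x)%:E).
Proof.
move=> mf bf.
have iS : leb.-integrable setT (fun x : R => (C%:E * (expR (m * `|x|) * phi x)%:E)%E).
  by apply: integrableZl => //; exact: integrable_expR_normal.
apply: (le_integrable measurableT _ _ iS).
- apply/measurable_EFinP; apply: measurable_funM => //; exact: measurable_normal_pdf.
- move=> x _; rewrite -EFinM lee_fin mulrA !normrM ler_wpM2r//.
  by rewrite (le_trans (bf x))// -normrM ler_norm.
Qed.

Lemma expbd_integrable f C m : measurable_fun setT f -> expbd f C m ->
  gam.-integrable setT (EFin \o f).
Proof.
move=> mf bf; apply/integrableP; split; first exact/measurable_EFinP.
rewrite ge0_integral_normal_prob//; last first.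
  by apply: measurableT_comp => //; exact/measurable_EFinP.
have /integrableP[_] := expbd_integrable_leb mf bf.
apply: le_lt_trans; rewrite le_eqVlt; apply/orP; left; apply/eqP.
apply: eq_integral => x _ /=.
by rewrite -EFinM normrM [in RHS](ger0_norm (normal_pdf_ge0 _ _ _)).
Qed.

Lemma gaussE_lebesgue f C m : measurable_fun setT f -> expbd f C m ->
  gaussE f = \int[leb]_x (f x * phi x).
Proof.
move=> mf bf; rewrite /gaussE /Rintegral; congr fine.
have iN := expbd_integrable mf bf.
rewrite -(Radon_Nikodym_change_of_variables (normal_prob_dominates _ _))//.
apply: ae_eq_integral => //.
- apply: emeasurable_funM => //; first exact/measurable_EFinP.
  apply: (measurable_int leb); apply: Radon_Nikodym_integrable.
  exact: normal_prob_dominates.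
- by have /integrableP[] := expbd_integrable_leb mf bf.
- have := ae_eq_Radon_Nikodym_SigmaFinite (normal_prob_dominates (0 : R) 1) measurableT.
  move=> /ae_eq_sym h.
  apply: filterS (ae_eq_trans h normal_pdf_ae_density) => x /= hx _.
  by rewrite hx// -EFinM.
Qed.

Lemma is_derive_normal_pdf x : is_derive x 1 phi (- x * phi x).
Proof.
have -> : phi = (fun y => normal_peak 1 * expR (- (2^-1) * y ^+ 2)).
  apply/funext => y; rewrite normal_pdfE ?oner_eq0// /normal_fun subr0 expr1n.
  by congr (_ * expR _); field.
by apply: is_derive_eq; rewrite /GRing.scale /=; field.
Qed.

Lemma expbd_mulid f C m : expbd f C m -> expbd (fun x => x * f x) C (m + 1).
Proof.
move=> bf x; rewrite normrM mulrDl mul1r expRD mulrA mulrC ler_pM//.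
by have := expR_ge1Dx `|x|; apply: le_trans; rewrite lerDr.
Qed.

(** Serves to kill the boundary terms of the integration by parts, for which a decay in 1 / |x|
    suffices. The constant comes from (m + 1 - |x|)^2 >= 0. *)
Lemma expbd_pdf_le f C m x : expbd f C m ->
  `|f x * phi x| <= `|C| * normal_peak 1 * expR ((m + 1) ^+ 2 / 2) / (1 + `|x|).
Proof.
move=> bf; rewrite normrM.
have le1 : `|f x| <= `|C| * expR (m * `|x|).
  by rewrite (le_trans (bf x))// ler_wpM2r ?expR_ge0// ler_norm.
rewrite (ger0_norm (normal_pdf_ge0 _ _ _)) normal_pdfE ?oner_eq0// /normal_fun subr0 expr1n.
have -> : - x ^+ 2 / 2 = - (`|x| ^+ 2 / 2) by rewrite real_normK ?num_real// mulNr.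
apply: (@le_trans _ _ (`|C| * expR (m * `|x|) * (normal_peak 1 * expR (- (`|x| ^+ 2 / 2))))).
  by rewrite ler_wpM2r// mulr_ge0 ?normal_peak_ge0 ?expR_ge0.
have -> : `|C| * expR (m * `|x|) * (normal_peak 1 * expR (- (`|x| ^+ 2 / 2))) =
   `|C| * normal_peak 1 * expR (m * `|x| - `|x| ^+ 2 / 2) by rewrite expRD; ring.
rewrite -[leRHS]mulrA ler_wpM2l ?mulr_ge0 ?normal_peak_ge0//.
apply: (@le_trans _ _ (expR ((m + 1) ^+ 2 / 2) * expR (- `|x|))).
  rewrite -expRD ler_expR; have := sqr_ge0 (m + 1 - `|x|); nra.
rewrite ler_wpM2l ?expR_ge0// expRN lef_pV2 ?posrE ?expR_gt0 ?expR_ge1Dx//.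
Qed.

(** Since the density satisfies phi' = - x phi, the difference of the two integrands is the
    derivative of f phi. Its integrals over [-(n + 1), n + 1] are boundary terms tending to 0, and
    by domination they converge to the integral over the line. *)
Lemma gaussE_ibp f f' C m : (forall x, is_derive x 1 f (f' x)) -> continuous f' ->
  expbd f C m -> expbd f' C m -> gaussE (fun x => x * f x) = gaussE f'.
Proof.
move=> df cf' bf bf'.
have cf : continuous f.
  by move=> x; apply/differentiable_continuous/derivable1_diffP; have [] := df x.
have mf := continuous_measurable_fun cf; have mf' := continuous_measurable_fun cf'.
have mxf : measurable_fun setT (fun x => x * f x) by exact: measurable_funM.
have cphi : continuous phi by apply: continuous_normal_pdf; rewrite oner_eq0.
rewrite (gaussE_lebesgue mf' bf') (gaussE_lebesgue mxf (expbd_mulid bf)).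
pose G x := f x * phi x.
pose g x := f' x * phi x - x * f x * phi x.
have dG x : is_derive x 1 G (g x).
  have := is_derive_normal_pdf x => dphi.
  by apply: is_derive_eq; rewrite /g /GRing.scale /=; ring.
have cg : continuous g.
  move=> x; apply: cvgB; first by apply: cvgM; [exact: cf'|exact: cphi].
  by apply: cvgM; [apply: cvgM; [exact: cvg_id|exact: cf]|exact: cphi].
have mg := continuous_measurable_fun cg.
have ig' : leb.-integrable setT (EFin \o (fun x => f' x * phi x)).
  exact: expbd_integrable_leb bf'.
have igx : leb.-integrable setT (EFin \o (fun x => x * f x * phi x)).
  exact: expbd_integrable_leb (expbd_mulid bf).
have ig : leb.-integrable setT (EFin \o g).
  by have := integrableB measurableT ig' igx; exact.
apply/esym/eqP; rewrite -subr_eq0 -RintegralB//.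
pose gn n : R -> \bar R := (EFin \o g) \_ `[- n.+1%:R, n.+1%:R]%classic.
have gnE n : (\int[leb]_x gn n x = (G n.+1%:R - G (- n.+1%:R))%:E)%E.
  rewrite -integral_mkcond.
  have cG : continuous G.
    by move=> x; apply/differentiable_continuous/derivable1_diffP; have [] := dG x.
  rewrite (@continuous_FTC2 _ g G)//.
  - by rewrite -subr_gt0 opprK -natrD ltr0n.
  - exact: continuous_subspaceT.
  - split=> [x _||]; first by have [] := dG x.
    + exact/cvg_at_right_filter/cG.
    + exact/cvg_at_left_filter/cG.
  - by move=> x _; rewrite derive1E; have [] := dG x.
have cvg0 : (\int[leb]_x gn n x @[n --> \oo] --> 0)%E.
  under eq_fun do rewrite gnE.
  apply: cvg_EFin; first exact: nearW.
  apply/cvgrPdist_le => e e0; near=> n.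
  rewrite /= sub0r normrN.
  set K := `|C| * normal_peak 1 * expR ((m + 1) ^+ 2 / 2).
  have K0 : 0 <= K by rewrite !mulr_ge0 ?normal_peak_ge0 ?expR_ge0.
  apply: (@le_trans _ _ (K / n.+1%:R + K / n.+1%:R)).
    have aux (y : R) : `|y| = n.+1%:R -> `|G y| <= K / n.+1%:R.
      move=> yn; rewrite (le_trans (expbd_pdf_le _ bf))// yn -/K.
      by rewrite ler_wpM2l// lef_pV2 ?posrE ?ltr_wpDl ?lerDr.
    by rewrite (le_trans (ler_normB _ _))// lerD//; apply: aux; rewrite ?normrN ger0_norm.
  rewrite -mulrDl ler_pdivrMr// -ler_pdivrMl// mulrC.
  have : (K + K) / e <= n%:R by near: n; exact: nbhs_infty_ger.
  by move=> /le_trans; apply; rewrite ler_nat.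
have [_ _ cvgI] : [/\ leb.-integrable setT (EFin \o g),
    (\int[leb]_x `|gn n x - (EFin \o g) x| @[n --> \oo] --> 0)%E &
    (\int[leb]_x gn n x @[n --> \oo] --> \int[leb]_x (EFin \o g) x)%E].
  apply: (@dominated_convergence _ _ _ leb setT measurableT gn (EFin \o g)
     (fun x => `|(EFin \o g) x|%E)).
  - move=> n; apply/(measurable_restrictT _ _).1 => //.
    by apply: measurable_funTS; exact/measurable_EFinP.
  - exact/measurable_EFinP.
  - apply: aeW => x _; apply: cvg_near_cst; near=> n.
    rewrite /gn patchE mem_set//= in_itv/= -ler_norml.
    have : `|x| <= n%:R by near: n; exact: nbhs_infty_ger.
    by move=> /le_trans; apply; rewrite ler_nat.
  - exact: integrable_abse.
  - apply: aeW => x n _; rewrite /gn patchE; case: ifP => //= _.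
    by rewrite lee_fin normr0.
by rewrite /Rintegral (cvg_unique _ cvgI cvg0).
Unshelve. all: by end_near. Qed.

Lemma gaussE_cst C : gaussE (fun=> C) = C.
Proof.
rewrite /gaussE Rintegral_cst//; transitivity (C * fine (1%E : \bar R)); last exact: mulr1.
by congr (C * fine _); exact: (integral_normal_pdf (0 : R) 1).
Qed.

End OneDimensionalGaussian.

(** * Functions of exponential growth with an exponential Lipschitz bound *)

Section TameFunctions.
Context {R : realType}.
Implicit Types (f g : R -> R) (C m x : R) (y z : nat -> R) (F G : (nat -> R) -> R) (k M : nat).

Lemma expR_lip (a b : R) : 0 <= a -> 0 <= b -> `|expR a - expR b| <= expR (a + b) * `|a - b|.
Proof.
wlog ab : a b / b <= a => [hw a0 b0|a0 b0].
  have [/hw|/ltW /hw] := leP b a; first exact.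
  by rewrite distrC (distrC a) (addrC a); apply.
rewrite !ger0_norm ?subr_ge0 ?ler_expR//.
have h := expR_ge1Dx (b - a).
have -> : expR a - expR b = expR a * (1 - expR (b - a)).
  by rewrite mulrBr mulr1 -expRD subrKC.
apply: ler_pM; rewrite ?expR_ge0 ?subr_ge0 ?ler_expR ?lerDl//; last lra.
by rewrite -expR0 ler_expR subr_le0.
Qed.

Definition l1 M y : R := \sum_(k < M) `|y k|.
Definition upd y k x : nat -> R := fun j => if j == k then x else y j.

Lemma l1_ge0 M y : 0 <= l1 M y. Proof. exact: sumr_ge0. Qed.

Lemma l1_updS M y x : l1 M.+1 (upd y M x) = l1 M y + `|x|.
Proof.
rewrite /l1 big_ord_recr /= /upd eqxx; congr (_ + _).
by apply: eq_bigr => i _; rewrite ltn_eqF.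
Qed.

Lemma l1_dist M y z : `|l1 M y - l1 M z| <= l1 M (fun k => y k - z k).
Proof.
rewrite /l1 -sumrB (le_trans (ler_norm_sum _ _ _))// ler_sum// => i _.
exact: ler_dist_dist.
Qed.

Lemma updC y j k s x : j != k -> upd (upd y j s) k x = upd (upd y k x) j s.
Proof.
move=> jk; apply/funext => i; rewrite /upd.
by case: eqP => // ->; rewrite eq_sym (negbTE jk).
Qed.

Lemma upd_id y k x : upd y k x k = x. Proof. by rewrite /upd eqxx. Qed.

Lemma upd_neq y k x j : j != k -> upd y k x j = y j.
Proof. by rewrite /upd => /negbTE ->. Qed.

(* Exponential growth and a Lipschitz bound with exponential weight, with
   respect to the first [M] coordinates: this class is stable under sums,
   products and partial Gaussian integration. *)
Definition tame_bd M C m F :=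
  (forall y, `|F y| <= C * expR (m * l1 M y)) /\
  (forall y z, `|F y - F z| <= C * expR (m * (l1 M y + l1 M z)) * l1 M (fun k => y k - z k)).
Definition tame M F := exists C m, [/\ 0 <= C, 0 <= m & tame_bd M C m F].

Lemma tame_bdW M C C' m m' F : 0 <= C -> C <= C' -> m <= m' -> tame_bd M C m F -> tame_bd M C' m' F.
Proof.
move=> C0 CC mm [b l]; have le1 := l1_ge0 M; split=> [y|y z].
  apply: le_trans (b y) _; rewrite ler_pM ?expR_ge0// ler_expR ler_wpM2r//.
apply: le_trans (l y z) _; rewrite ler_wpM2r// ler_pM ?expR_ge0// ler_expR ler_wpM2r//.
by rewrite addr_ge0.
Qed.

Lemma tame_cst M C : tame M (fun=> C).
Proof.
exists `|C|, 0; split=> //; split=> [y|y z].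
  by rewrite mul0r expR0 mulr1.
by rewrite subrr normr0 !mulr_ge0 ?expR_ge0 ?l1_ge0.
Qed.

Lemma tame_coord M k : (k < M)%N -> tame M (fun y => y k).
Proof.
move=> kM; have le1 y : `|y k| <= l1 M y.
  rewrite /l1 (bigD1 (Ordinal kM))//= lerDl sumr_ge0//.
exists 1, 1; split=> //; split=> [y|y z].
  rewrite !mul1r (le_trans (le1 y))//.
  by apply: le_trans (expR_ge1Dx _); rewrite lerDr.
rewrite (le_trans (le1 (fun k => y k - z k)))// mul1r ler_peMl ?l1_ge0//.
by rewrite mul1r -expR0 ler_expR addr_ge0 ?l1_ge0.
Qed.

Lemma tameD M F G : tame M F -> tame M G -> tame M (fun y => F y + G y).
Proof.
move=> [C [m [C0 m0 bF]]] [C' [m' [C0' m0' bG]]].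
have [b l] : tame_bd M C (m + m') F by apply: tame_bdW bF => //; rewrite lerDl.
have [b' l'] : tame_bd M C' (m + m') G by apply: tame_bdW bG => //; rewrite lerDr.
exists (C + C'), (m + m'); split; rewrite ?addr_ge0//; split=> [y|y z].
  by rewrite mulrDl (le_trans (ler_normD _ _))// lerD.
rewrite mulrDl mulrDl opprD addrACA (le_trans (ler_normD _ _))//.
exact: lerD.
Qed.

Lemma tameM M F G : tame M F -> tame M G -> tame M (fun y => F y * G y).
Proof.
move=> [C [m [C0 m0 [b l]]]] [C' [m' [C0' m0' [b' l']]]].
exists (C * C' + C * C'), (m + m'); split; rewrite ?addr_ge0 ?mulr_ge0//; split=> [y|y z].
  rewrite normrM (@le_trans _ _ (C * C' * expR ((m + m') * l1 M y)))//.
    by rewrite mulrDl expRD mulrACA ler_pM.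
  by rewrite ler_wpM2r ?expR_ge0// lerDl mulr_ge0.
have -> : F y * G y - F z * G z = F y * (G y - G z) + G z * (F y - F z) by ring.
rewrite (le_trans (ler_normD _ _))// !normrM.
set d := l1 M (fun k => y k - z k); set a := l1 M y; set c := l1 M z.
have a0 : 0 <= a := l1_ge0 _ _. have c0 : 0 <= c := l1_ge0 _ _. have d0 : 0 <= d := l1_ge0 _ _.
rewrite mulrDl mulrDl; apply: lerD.
  apply: (@le_trans _ _ ((C * expR (m * a)) * (C' * expR (m' * (a + c)) * d))).
    by apply: ler_pM => //; exact: l'.
  rewrite [leLHS](_ : _ = C * C' * (expR (m * a) * expR (m' * (a + c))) * d); last ring.
  rewrite ler_wpM2r// ler_wpM2l ?mulr_ge0// -expRD ler_expR.
  have := mulr_ge0 m0 c0; nra.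
apply: (@le_trans _ _ ((C' * expR (m' * c)) * (C * expR (m * (a + c)) * d))).
  by apply: ler_pM => //; exact: l.
rewrite [leLHS](_ : _ = C * C' * (expR (m' * c) * expR (m * (a + c))) * d); last ring.
rewrite ler_wpM2r// ler_wpM2l ?mulr_ge0// -expRD ler_expR.
have := mulr_ge0 m0' a0; nra.
Qed.

Lemma tameZ M C F : tame M F -> tame M (fun y => C * F y).
Proof. by move=> tF; apply: tameM => //; exact: tame_cst. Qed.

Lemma tame_sum M (I : Type) (r : seq I) (P : pred I) (F : I -> (nat -> R) -> R) :
  (forall i, P i -> tame M (F i)) -> tame M (fun y => \sum_(i <- r | P i) F i y).
Proof.
move=> tF; elim: r => [|i r IH].
  under eq_fun do rewrite big_nil; exact: tame_cst.
under eq_fun do rewrite big_cons.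
by case: (P i) (tF i) => [/(_ isT) tFi|_] //; exact: tameD.
Qed.

Lemma tame_prod M (I : Type) (r : seq I) (P : pred I) (F : I -> (nat -> R) -> R) :
  (forall i, P i -> tame M (F i)) -> tame M (fun y => \prod_(i <- r | P i) F i y).
Proof.
move=> tF; elim: r => [|i r IH].
  under eq_fun do rewrite big_nil; exact: tame_cst.
under eq_fun do rewrite big_cons.
by case: (P i) (tF i) => [/(_ isT) tFi|_] //; exact: tameM.
Qed.

Lemma tame_expl1 M m : 0 <= m -> tame M (fun y => expR (m * l1 M y)).
Proof.
move=> m0; exists (1 + m), m; split; rewrite ?addr_ge0//; split=> [y|y z].
  by rewrite ger0_norm ?expR_ge0// ler_peMl ?expR_ge0// lerDl.
rewrite (le_trans (expR_lip _ _))// ?mulr_ge0 ?l1_ge0//.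
rewrite -mulrDr -mulrBr normrM (ger0_norm m0) mulrA.
apply: ler_pM; rewrite ?mulr_ge0 ?expR_ge0 ?l1_dist//.
by rewrite mulrC ler_wpM2r ?expR_ge0// lerDr.
Qed.

Definition tame1 f := exists C m, [/\ 0 <= C, 0 <= m, expbd f C m &
  forall x x', `|f x - f x'| <= C * expR (m * (`|x| + `|x'|)) * `|x - x'|].

Lemma tame1_tame f M k : (k < M)%N -> tame1 f -> tame M (fun y => f (y k)).
Proof.
move=> kM [C [m [C0 m0 b l]]]; have le1 y : `|y k| <= l1 M y.
  rewrite /l1 (bigD1 (Ordinal kM))//= lerDl sumr_ge0//.
exists C, m; split=> //; split=> [y|y z].
  by rewrite (le_trans (b _))// ler_wpM2l// ler_expR ler_wpM2l.
rewrite (le_trans (l _ _))// ler_pM ?mulr_ge0 ?expR_ge0//; last exact: (le1 (fun k => y k - z k)).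
by rewrite ler_wpM2l// ler_expR ler_wpM2l// lerD.
Qed.

Lemma tame1_continuous f : tame1 f -> continuous f.
Proof.
move=> [C [m [C0 m0 _ l]]] x; apply/cvgrPdist_lt => e e0.
pose K := C * expR (m * (`|x| + (`|x| + 1))) + 1.
have K0 : 0 < K by rewrite ltr_wpDl// mulr_ge0 ?expR_ge0.
near=> t.
have xt1 : `|x - t| < 1 by near: t; apply: cvgr_dist_lt => //; exact: cvg_id.
have xt2 : `|x - t| < e / K by near: t; apply: cvgr_dist_lt; [exact: cvg_id|exact: divr_gt0].
have tx : `|t| <= `|x| + 1.
  by rewrite -lerBlDl; apply: le_trans (ltW xt1); rewrite distrC; exact: lerB_dist.
apply: (@le_lt_trans _ _ (K * `|x - t|)); last by rewrite mulrC -ltr_pdivlMr.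
rewrite (le_trans (l _ _))// ler_wpM2r// /K.
apply: (@le_trans _ _ (C * expR (m * (`|x| + (`|x| + 1))))); last by rewrite lerDl.
by rewrite ler_wpM2l// ler_expR ler_wpM2l// lerD2l.
Unshelve. all: by end_near. Qed.

Lemma tame1_integrable f : tame1 f ->
  (normal_prob (0 : R) 1).-integrable setT (EFin \o f).
Proof.
move=> tf; have [C [m [_ _ b _]]] := tf.
by apply: expbd_integrable b; apply: continuous_measurable_fun; exact: tame1_continuous.
Qed.

Lemma gaussE_linear (a : R) f g : tame1 f -> tame1 g ->
  gaussE (fun x => a * f x + g x) = a * gaussE f + gaussE g.
Proof.
move=> /tame1_integrable i_f /tame1_integrable ig; rewrite /gaussE.
rewrite RintegralD//; first by rewrite RintegralZl.
by have := integrableZl measurableT a i_f; exact.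
Qed.

Lemma gaussE_le f g : tame1 f -> tame1 g -> (forall x, f x <= g x) -> gaussE f <= gaussE g.
Proof.
by move=> /tame1_integrable i_f /tame1_integrable ig fg; apply: le_Rintegral.
Qed.

End TameFunctions.

(** * Iterated Gaussian integrals of tame functions *)

Section IteratedGaussian.
Context {R : realType}.
Implicit Types (f g : R -> R) (C m x : R) (y z : nat -> R) (F G : (nat -> R) -> R) (k M : nat).

Lemma gaussEnS M F : gaussEn M.+1 F = gaussE (fun x => gaussEn M (fun y => F (upd y M x))).
Proof. by []. Qed.

Lemma tame_slice M F x : tame M.+1 F -> tame M (fun y => F (upd y M x)).
Proof.
move=> [C [m [C0 m0 [b l]]]].
exists (C * expR (m * (`|x| + `|x|))), m; split=> //.
  by rewrite mulr_ge0 ?expR_ge0.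
split=> [y|y z].
  rewrite (le_trans (b _))// l1_updS -mulrA -expRD ler_wpM2l// ler_expR -mulrDr ler_wpM2l//.
  by rewrite [leRHS]addrC lerD2l lerDl.
rewrite (le_trans (l _ _))// !l1_updS -!mulrA ler_wpM2l// mulrA -expRD -mulrDr.
rewrite [X in expR (m * X)](_ : _ = `|x| + `|x| + (l1 M y + l1 M z)); last ring.
rewrite ler_wpM2l ?expR_ge0//.
rewrite (_ : (fun k => upd y M x k - upd z M x k) = upd (fun k => y k - z k) M 0).
  by rewrite l1_updS normr0 addr0.
by apply/funext => i; rewrite /upd; case: eqP => //; rewrite subrr.
Qed.

Lemma l1_upd_dist M y x x' : l1 M.+1 (fun k => upd y M x k - upd y M x' k) = `|x - x'|.
Proof.
rewrite (_ : (fun k => _) = upd (fun=> 0) M (x - x')); last first.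
  by apply/funext => i; rewrite /upd; case: eqP => //; rewrite subrr.
by rewrite l1_updS /l1 big1 ?add0r// => i _; rewrite normr0.
Qed.

(** Linearity and monotonicity form one induction hypothesis: to integrate the last coordinate, the
    inner integral must be a tame function of it, and this is deduced from both properties for the
    first M coordinates. *)
Definition gaussEn_ok M := (forall (a : R) F G, tame M F -> tame M G ->
    gaussEn M (fun y => a * F y + G y) = a * gaussEn M F + gaussEn M G) /\
  (forall F G, tame M F -> tame M G -> (forall y, F y <= G y) -> gaussEn M F <= gaussEn M G).

Lemma gaussEn_cst M C : gaussEn M (fun=> C) = C.
Proof.
elim: M => //= M IH; rewrite -[RHS](gaussE_cst C).
by congr gaussE; apply/funext.
Qed.

Lemma gaussEn_ok_abs M F G : gaussEn_ok M -> tame M F -> tame M G ->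
  (forall y, `|F y| <= G y) -> `|gaussEn M F| <= gaussEn M G.
Proof.
move=> [lin le] tF tG FG; rewrite ler_norml; apply/andP; split; last first.
  by apply: le => // y; rewrite (le_trans (ler_norm _)).
have -> : - gaussEn M G = gaussEn M (fun y => (-1) * G y + 0).
  by rewrite lin ?gaussEn_cst//; [ring|exact: tame_cst].
apply: le => //; first by apply: tameD; [exact: tameZ|exact: tame_cst].
by move=> y; rewrite mulN1r addr0 lerNl (le_trans _ (FG y))// -normrN ler_norm.
Qed.

Lemma gaussEn_okB M F G : gaussEn_ok M -> tame M F -> tame M G ->
  gaussEn M (fun y => F y - G y) = gaussEn M F - gaussEn M G.
Proof.
move=> [lin _] tF tG; rewrite -[RHS]addrC -mulN1r -lin//.
by congr gaussEn; apply/funext => y; ring.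
Qed.

Lemma tameB M F G : tame M F -> tame M G -> tame M (fun y => F y - G y).
Proof.
move=> tF tG; apply: tameD => //; have := tameZ (-1) tG.
by congr tame; apply/funext => y; rewrite mulN1r.
Qed.

Lemma gaussEn_ok_tame1 M F : gaussEn_ok M -> tame M.+1 F ->
  tame1 (fun x => gaussEn M (fun y => F (upd y M x))).
Proof.
move=> ok tF; have [C [m [C0 m0 [b l]]]] := tF; have [lin le] := ok.
(* The growth bound splits into a factor in x and a factor in y; the exponent 2 m accommodates the
   Lipschitz bound, where [l1 M y] occurs twice. *)
pose K := gaussEn M (fun y => expR ((m + m) * l1 M y)).
have tE : tame M (fun y => expR ((m + m) * l1 M y)).
  by apply: tame_expl1; rewrite addr_ge0.
have K0 : 0 <= K.
  rewrite -[leLHS](gaussEn_cst M); apply: le => //; exact: tame_cst.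
have tK (c : R) : tame M (fun y => c * expR ((m + m) * l1 M y) + 0).
  by apply: tameD; [exact: tameZ|exact: tame_cst].
have EK (c : R) : gaussEn M (fun y => c * expR ((m + m) * l1 M y) + 0) = c * K.
  by rewrite lin ?gaussEn_cst ?addr0//; exact: tame_cst.
exists (C * K), m; split; rewrite ?mulr_ge0//.
  move=> x; rewrite mulrAC -EK; apply: gaussEn_ok_abs => //; first exact: tame_slice.
  move=> y; rewrite (le_trans (b _))// l1_updS addr0 -mulrA -expRD ler_wpM2l// ler_expR.
  by rewrite mulrDr addrC lerD2l ler_wpM2r ?l1_ge0// lerDl.
move=> x x'; rewrite -gaussEn_okB//; try exact: tame_slice.
rewrite [leRHS](_ : _ = (C * expR (m * (`|x| + `|x'|)) * `|x - x'|) * K); last ring.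
rewrite -EK; apply: gaussEn_ok_abs => //; first by apply: tameB; exact: tame_slice.
move=> y; rewrite (le_trans (l _ _))// l1_upd_dist !l1_updS addr0.
by rewrite [leRHS]mulrAC ler_wpM2r// -mulrA ler_wpM2l// -expRD ler_expR; nra.
Qed.

Lemma gaussEn_okP M : gaussEn_ok M.
Proof.
elim: M => [|M ok]; first by split=> //= F G _ _; exact.
have [lin le] := ok; split=> [a F G tF tG|F G tF tG FG].
  rewrite !gaussEnS -gaussE_linear; try exact: gaussEn_ok_tame1.
  by congr gaussE; apply/funext => x; rewrite lin//; exact: tame_slice.
rewrite !gaussEnS; apply: gaussE_le; try exact: gaussEn_ok_tame1.
by move=> x; apply: le => //; exact: tame_slice.
Qed.

Lemma gaussEn_tame1 M F : tame M.+1 F -> tame1 (fun x => gaussEn M (fun y => F (upd y M x))).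
Proof. exact: gaussEn_ok_tame1 (gaussEn_okP M). Qed.

Lemma gaussEnD M F G : tame M F -> tame M G ->
  gaussEn M (fun y => F y + G y) = gaussEn M F + gaussEn M G.
Proof.
move=> tF tG; rewrite -[in RHS](mul1r (gaussEn M F)) -(gaussEn_okP M).1//.
by congr gaussEn; apply/funext => y; rewrite mul1r.
Qed.

Lemma gaussEnZ M (a : R) F : tame M F -> gaussEn M (fun y => a * F y) = a * gaussEn M F.
Proof.
move=> tF; rewrite -[RHS]addr0 -[X in _ = _ + X](gaussEn_cst M) -(gaussEn_okP M).1//.
  by congr gaussEn; apply/funext => y; rewrite addr0.
exact: tame_cst.
Qed.

Lemma gaussEnB M F G : tame M F -> tame M G ->
  gaussEn M (fun y => F y - G y) = gaussEn M F - gaussEn M G.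
Proof. by move=> tF tG; rewrite gaussEn_okB//; exact: gaussEn_okP. Qed.

Lemma gaussEn_sum M (I : Type) (r : seq I) (P : pred I) (F : I -> (nat -> R) -> R) :
  (forall i, P i -> tame M (F i)) ->
  gaussEn M (fun y => \sum_(i <- r | P i) F i y) = \sum_(i <- r | P i) gaussEn M (F i).
Proof.
move=> tF; elim: r => [|i r IH].
  by under eq_fun do rewrite big_nil; rewrite big_nil gaussEn_cst.
under eq_fun do rewrite big_cons; rewrite big_cons.
case: (boolP (P i)) => // Pi.
by rewrite gaussEnD ?IH//; [exact: tF|exact: tame_sum].
Qed.

Lemma gaussEn_le M F G : tame M F -> tame M G -> (forall y, F y <= G y) ->
  gaussEn M F <= gaussEn M G.
Proof. by move=> tF tG; exact: (gaussEn_okP M).2. Qed.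

Lemma gaussEn_abs M F G : tame M F -> tame M G -> (forall y, `|F y| <= G y) ->
  `|gaussEn M F| <= gaussEn M G.
Proof. by apply: gaussEn_ok_abs; exact: gaussEn_okP. Qed.

(** Required at every value x of coordinate k, so that slices are differentiable on the whole line,
    as the mean value theorem and the one-dimensional integration by parts demand. *)
Definition is_partial k F G := forall y x, is_derive x 1 (fun t => F (upd y k t)) (G (upd y k x)).

(** A Taylor remainder of order h^2 can be integrated over the other coordinates, which makes this
    the convenient criterion for differentiating under the integral. *)
Lemma is_derive_quadratic (f : R -> R) (x d K : R) :
  (forall h, `|h| <= 1 -> `|f (x + h) - f x - h * d| <= K * h ^+ 2) -> is_derive x 1 f d.
Proof.
move=> H; have K0 : 0 <= K.
  have := H 1; rewrite normr1 lexx expr1n mulr1 => /(_ isT); exact: le_trans.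
have cv : h^-1 *: ((f \o shift x) (h *: (1:R)) - f x) @[h --> 0^'] --> d.
  apply/cvgrPdist_le => e e0; near=> h.
  have h0 : h != 0 by near: h; exact: nbhs_dnbhs_neq.
  have h1 : `|h| <= 1.
    near: h; apply: nbhs_dnbhs; apply/nbhs_ballP; exists 1 => //= t.
    by rewrite /ball /= sub0r normrN => /ltW.
  have he : `|h| <= e / (K + 1).
    near: h; apply: nbhs_dnbhs; apply/nbhs_ballP; exists (e / (K + 1)) => /=.
      by rewrite divr_gt0// ltr_wpDl.
    by move=> t; rewrite /ball /= sub0r normrN => /ltW.
  rewrite /= /GRing.scale /= mulr1 (addrC h).
  have -> : d - h^-1 * (f (x + h) - f x) = - h^-1 * (f (x + h) - f x - h * d) by field.
  rewrite normrM normrN normfV ler_pdivrMl ?normr_gt0//.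
  rewrite (le_trans (H _ h1))// -(real_normK (num_real h)) expr2.
  rewrite [leLHS]mulrC -mulrA ler_wpM2l//.
  apply: (@le_trans _ _ ((K + 1) * `|h|)); first by rewrite mulrC ler_wpM2r// lerDl.
  by rewrite mulrC -ler_pdivlMr// ltr_wpDl.
split; first by apply/cvg_ex; exists d.
by rewrite /derive; exact: cvg_lim.
Unshelve. all: by end_near. Qed.

(** The increment of a slice is h times a value of G at an intermediate point, and the Lipschitz
    bound of G leaves a remainder of order h^2 whose constant is integrable in y. *)
Lemma is_derive_gaussEn M F G x : tame M.+1 F -> tame M.+1 G -> is_partial M F G ->
  is_derive x 1 (fun t => gaussEn M (fun y => F (upd y M t))) (gaussEn M (fun y => G (upd y M x))).
Proof.
move=> tF tG dF; have [C [m [C0 m0 [_ l]]]] := tG.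
have tsF t := tame_slice t tF; have tsG t := tame_slice t tG.
pose B := C * expR (m * (`|x| + 1 + `|x|)).
have B0 : 0 <= B by rewrite mulr_ge0 ?expR_ge0.
apply: (@is_derive_quadratic _ _ _ (B * gaussEn M (fun y => expR ((m + m) * l1 M y)))) => h h1.
rewrite -gaussEnZ// -gaussEnB// -gaussEnB//; [|exact: tameB|exact: tameZ].
have tE : tame M (fun y => expR ((m + m) * l1 M y)) by apply: tame_expl1; rewrite addr_ge0.
rewrite mulrAC -gaussEnZ//; apply: gaussEn_abs => //; [|exact: tameZ|].
  by apply: tameB; [exact: tameB|exact: tameZ].
move=> y; have [c cI ->] : exists2 c, `|c - x| <= `|h| &
    F (upd y M (x + h)) - F (upd y M x) = h * G (upd y M c).
  have cF : continuous (fun t => F (upd y M t)).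
    by move=> t; apply/differentiable_continuous/derivable1_diffP; have [] := dF y t.
  have dF' (t : R) : is_derive t 1 (fun t => F (upd y M t)) (G (upd y M t)) by exact: dF.
  have [h0|h0] := leP 0 h.
    have xh : x <= x + h by rewrite lerDl.
    have [c] := MVT_segment xh (fun t _ => dF' t) (continuous_subspaceT cF).
    rewrite in_itv/= => /andP[c1 c2] ->; exists c; last by rewrite addrAC subrr add0r mulrC.
    by rewrite ger0_norm ?subr_ge0// ger0_norm// lerBlDl.
  have xh : x + h <= x by rewrite gerDl ltW.
  have [c] := MVT_segment xh (fun t _ => dF' t) (continuous_subspaceT cF).
  rewrite in_itv/= => /andP[c1 c2] E; exists c.
    by rewrite ler0_norm ?subr_le0// ltr0_norm//; lra.
  by rewrite -opprB E opprD addrA subrr sub0r mulrN opprK mulrC.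
rewrite -mulrBr normrM.
apply: (@le_trans _ _ (`|h| * (B * expR ((m + m) * l1 M y) * `|h|))); last first.
  by rewrite -(real_normK (num_real h)) le_eqVlt; apply/orP; left; apply/eqP; ring.
rewrite ler_wpM2l// (le_trans (l _ _))//.
rewrite l1_upd_dist.
apply: ler_pM; rewrite ?mulr_ge0 ?expR_ge0// /B -mulrA ler_wpM2l// -expRD ler_expR !l1_updS.
have : `|c| <= `|x| + 1.
  by rewrite -lerBlDl (le_trans (lerB_dist _ _))// (le_trans cI).
by move=> cx; have := ler_wpM2l m0 cx; nra.
Qed.

(** Either coordinate k is the outermost one, and the one-dimensional identity applies to the inner
    integral, differentiated by [is_derive_gaussEn]; or the identity already holds inside, for each
    value of the outermost coordinate. *)
Lemma gaussEn_ibp M k F G : (k < M)%N -> tame M F -> tame M G -> is_partial k F G ->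
  gaussEn M (fun y => y k * F y) = gaussEn M G.
Proof.
elim: M F G => // M IH F G; rewrite ltnS leq_eqVlt => /predU1P[->|kM] tF tG dF.
  rewrite !gaussEnS.
  have tf := gaussEn_tame1 tF; have tg := gaussEn_tame1 tG.
  have [C [m [C0 m0 b _]]] := tf; have [C' [m' [C0' m0' b' _]]] := tg.
  transitivity (gaussE (fun x => x * gaussEn M (fun y => F (upd y M x)))).
    congr gaussE; apply/funext => x; rewrite -gaussEnZ; last exact: tame_slice.
    by congr gaussEn; apply/funext => y; rewrite upd_id.
  apply: (@gaussE_ibp _ _ _ (C + C') (m + m')).
  - by move=> x; exact: is_derive_gaussEn.
  - exact: tame1_continuous.
  - move=> x; rewrite (le_trans (b x))// ler_pM ?expR_ge0 ?lerDl// ler_expR ler_wpM2r// lerDl//.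
  - move=> x; rewrite (le_trans (b' x))// ler_pM ?expR_ge0 ?lerDr// ler_expR ler_wpM2r// lerDr//.
rewrite !gaussEnS; congr gaussE; apply/funext => x.
transitivity (gaussEn M (fun y => y k * F (upd y M x))).
  by congr gaussEn; apply/funext => y; rewrite upd_neq// ltn_eqF.
apply: (IH (fun y => F (upd y M x)) (fun y => G (upd y M x)) kM); try exact: tame_slice.
move=> y s; have := dF (upd y M x) s.
rewrite updC; last by rewrite gtn_eqF.
by congr is_derive; apply/funext => t; rewrite updC// gtn_eqF.
Qed.

Lemma gaussEn_indep M k F f : (k < M)%N -> tame M F -> tame1 f ->
  (forall y x, F (upd y k x) = F y) ->
  gaussEn M (fun y => F y * f (y k)) = gaussEn M F * gaussE f.
Proof.
elim: M F => // M IH F; rewrite ltnS leq_eqVlt => /predU1P[->|kM] tF tf cF; rewrite !gaussEnS.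
  have -> : (fun x => gaussEn M (fun y => F (upd y M x))) = (fun=> gaussEn M F).
    by apply/funext => x; congr gaussEn; apply/funext => y.
  have tF' : tame M F.
    by have := tame_slice 0 tF; congr tame; apply/funext => y.
  rewrite gaussE_cst -[RHS]addr0 -[X in _ = _ + X]gaussE_cst -gaussE_linear//; last first.
    by exists 0, 0; split=> // x; [rewrite normr0 mul0r|move=> x'; rewrite subrr normr0 !mul0r].
  congr gaussE; apply/funext => x; rewrite addr0 mulrC -gaussEnZ//.
  by congr gaussEn; apply/funext => y; rewrite upd_id cF mulrC.
have := gaussEn_tame1 tF => tF1.
rewrite mulrC -[RHS]addr0 -[X in _ = _ + X]gaussE_cst -gaussE_linear//; last first.
  by exists 0, 0; split=> // x; [rewrite normr0 mul0r|move=> x'; rewrite subrr normr0 !mul0r].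
congr gaussE; apply/funext => x; rewrite addr0 mulrC -IH//; last 2 first.
- exact: tame_slice.
- by move=> y s; rewrite updC ?cF// ltn_eqF.
by congr gaussEn; apply/funext => y; rewrite upd_neq// ltn_eqF.
Qed.

End IteratedGaussian.

(** * Calculus of partial derivatives in the disorder *)

Section PartialDerivatives.
Context {R : realType}.
Implicit Types (F G : (nat -> R) -> R) (k : nat).

Lemma is_partial_eq k F G G' : is_partial k F G -> G =1 G' -> is_partial k F G'.
Proof. by move=> dF /funext <-. Qed.

Lemma is_partial_indep k F : (forall y x, F (upd y k x) = F y) -> is_partial k F (fun=> 0).
Proof.
move=> iF y x; have -> : (fun t => F (upd y k t)) = cst (F y) by apply/funext => t.
exact: is_derive_cst.
Qed.

Lemma is_partial_cst k (c : R) : is_partial k (fun=> c) (fun=> 0).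
Proof. exact: is_partial_indep. Qed.

Lemma is_partial_fun k (f f' : R -> R) : (forall x : R, is_derive x 1 f (f' x)) ->
  is_partial k (fun y => f (y k)) (fun y => f' (y k)).
Proof. by move=> df y x; rewrite upd_id; under eq_fun do rewrite upd_id; exact: df. Qed.

Lemma is_partialD k F F' G G' : is_partial k F F' -> is_partial k G G' ->
  is_partial k (fun y => F y + G y) (fun y => F' y + G' y).
Proof. by move=> dF dG y x; have := dF y x; have := dG y x => ? ?; exact: is_deriveD. Qed.

Lemma is_partialM k F F' G G' : is_partial k F F' -> is_partial k G G' ->
  is_partial k (fun y => F y * G y) (fun y => F' y * G y + F y * G' y).
Proof.
move=> dF dG y x; have := dF y x; have := dG y x => ? ?.
by apply: is_derive_eq; rewrite /GRing.scale /=; ring.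
Qed.

Lemma is_partialZ k (c : R) F F' : is_partial k F F' ->
  is_partial k (fun y => c * F y) (fun y => c * F' y).
Proof.
move=> dF; apply: (is_partial_eq (is_partialM (is_partial_cst k c) dF)) => y.
by rewrite mul0r add0r.
Qed.

Lemma is_partial_sum k (I : Type) (r : seq I) (P : pred I) (F F' : I -> (nat -> R) -> R) :
  (forall i, P i -> is_partial k (F i) (F' i)) ->
  is_partial k (fun y => \sum_(i <- r | P i) F i y) (fun y => \sum_(i <- r | P i) F' i y).
Proof.
move=> dF; elim: r => [|i r IH].
  rewrite (_ : (fun y => _) = fun=> 0); last by apply/funext => y; rewrite big_nil.
  by apply: (is_partial_eq (is_partial_cst k 0)) => y; rewrite big_nil.
have [Pi|/negbTE Pi] := boolP (P i).
  rewrite (_ : (fun y => _) = fun y => F i y + \sum_(j <- r | P j) F j y); last first.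
    by apply/funext => y; rewrite big_cons Pi.
  by apply: (is_partial_eq (is_partialD (dF i Pi) IH)) => y; rewrite big_cons Pi.
rewrite (_ : (fun y => _) = fun y => \sum_(j <- r | P j) F j y); last first.
  by apply/funext => y; rewrite big_cons Pi.
by apply: (is_partial_eq IH) => y; rewrite big_cons Pi.
Qed.

Lemma is_partial_expR k F F' : is_partial k F F' ->
  is_partial k (fun y => expR (F y)) (fun y => expR (F y) * F' y).
Proof.
move=> dF y x; have := dF y x => d1.
have := @is_derive1_comp _ expR (fun t => F (upd y k t)) x _ _ (is_derive_expR _) d1.
by apply.
Qed.

Lemma is_partialV k F F' : (forall y, F y != 0) -> is_partial k F F' ->
  is_partial k (fun y => (F y)^-1) (fun y => - (F y) ^- 2 * F' y).
Proof.
by move=> F0 dF y x; have := dF y x => ?; exact: is_deriveV.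
Qed.

(** In terms of logarithmic derivatives, the form in which Gibbs weights are differentiated: the
    product itself comes back as a factor. *)
Lemma is_partial_prod k (I : Type) (r : seq I) (F D : I -> (nat -> R) -> R) :
  (forall i, is_partial k (F i) (fun y => F i y * D i y)) ->
  is_partial k (fun y => \prod_(i <- r) F i y)
    (fun y => (\prod_(i <- r) F i y) * \sum_(i <- r) D i y).
Proof.
move=> dF; elim: r => [|i r IH].
  rewrite (_ : (fun y => _) = fun=> 1); last by apply/funext => y; rewrite big_nil.
  by apply: (is_partial_eq (is_partial_cst k 1)) => y; rewrite !big_nil mulr0.
rewrite (_ : (fun y => _) = fun y => F i y * \prod_(j <- r) F j y); last first.
  by apply/funext => y; rewrite big_cons.
by apply: (is_partial_eq (is_partialM (dF i) IH)) => y; rewrite !big_cons; ring.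
Qed.

End PartialDerivatives.

(** * Gibbs averages and Gaussian interpolation *)

Section FiniteFunctions.
Variables (I T : finType).
Implicit Types (s : {ffun I -> T}) (i : I) (t : T).

Definition fupd s i t : {ffun I -> T} := [ffun j => if j == i then t else s j].

Lemma fupd_id s i t : fupd s i t i = t. Proof. by rewrite ffunE eqxx. Qed.

Lemma fupd_neq s i t j : j != i -> fupd s i t j = s j.
Proof. by rewrite ffunE => /negbTE ->. Qed.

Lemma fupdK s i t : fupd (fupd s i t) i (s i) = s.
Proof. by apply/ffunP => j; rewrite !ffunE; case: eqP => // ->. Qed.

(** Exchanging the coordinate [s i] with [t] is an involution. Against product weights it isolates
    one coordinate from the others. *)
Lemma sum_swap (V : nmodType) i (F : {ffun I -> T} -> T -> V) :
  \sum_s \sum_t F s t = \sum_s \sum_t F (fupd s i t) (s i).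
Proof.
rewrite !pair_bigA /= (reindex (fun p : {ffun I -> T} * T => (fupd p.1 i p.2, p.1 i)))//=.
exists (fun p : {ffun I -> T} * T => (fupd p.1 i p.2, p.1 i)) => -[s t] _ /=.
  by rewrite fupdK fupd_id.
by rewrite fupdK fupd_id.
Qed.

End FiniteFunctions.

Section Gibbs.
Context {R : realType} (Om : finType) (o0 : Om) (L : nat).
Implicit Types (E : Om -> R) (g : Om -> R) (s : {ffun 'I_L -> Om}) (f : {ffun 'I_L -> Om} -> R).

Definition wgt E o : R := expR (E o) / \sum_t expR (E t).
Definition savg E g : R := \sum_o g o * wgt E o.
Definition avg E f : R := \sum_s f s * \prod_l wgt E (s l).

Lemma partition_gt0 E : 0 < \sum_t expR (E t).
Proof. by rewrite (bigD1 o0)//= ltr_pwDl ?expR_gt0 ?sumr_ge0// => i _; exact: expR_ge0. Qed.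

Lemma wgt_ge0 E o : 0 <= wgt E o.
Proof. by rewrite divr_ge0 ?expR_ge0// ltW// partition_gt0. Qed.

Lemma sum_wgt E : \sum_o wgt E o = 1.
Proof. by rewrite -mulr_suml divff// gt_eqF// partition_gt0. Qed.

Lemma wgt_le1 E o : wgt E o <= 1.
Proof. by rewrite -(sum_wgt E) (bigD1 o)//= lerDl sumr_ge0// => i _; exact: wgt_ge0. Qed.

Lemma sum_prod_wgt E : \sum_(s : {ffun 'I_L -> Om}) \prod_l wgt E (s l) = 1.
Proof. by rewrite -(bigA_distr_bigA (fun _ => wgt E)) big1// => i _; exact: sum_wgt. Qed.

Lemma avg_cst E (c : R) : avg E (fun=> c) = c.
Proof. by rewrite /avg -mulr_sumr sum_prod_wgt mulr1. Qed.

Lemma prod_wgt_ge0 E s : 0 <= \prod_l wgt E (s l).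
Proof. by apply: prodr_ge0 => l _; exact: wgt_ge0. Qed.

Lemma avgD E f f' : avg E (fun s => f s + f' s) = avg E f + avg E f'.
Proof. by rewrite -big_split; apply: eq_bigr => s _; rewrite mulrDl. Qed.

Lemma avgZ E (c : R) f : avg E (fun s => c * f s) = c * avg E f.
Proof. by rewrite /avg mulr_sumr; apply: eq_bigr => s _; rewrite mulrA. Qed.

Lemma avg_sum E (I : Type) (r : seq I) (P : pred I) (f : I -> {ffun 'I_L -> Om} -> R) :
  avg E (fun s => \sum_(i <- r | P i) f i s) = \sum_(i <- r | P i) avg E (f i).
Proof.
rewrite /avg exchange_big /=; apply: eq_bigr => s _.
by rewrite mulr_suml.
Qed.

Lemma avg_le E f f' : (forall s, f s <= f' s) -> avg E f <= avg E f'.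
Proof. by move=> h; apply: ler_sum => s _; rewrite ler_wpM2r// prod_wgt_ge0. Qed.

Lemma avg_abs E f : `|avg E f| <= avg E (fun s => `|f s|).
Proof.
rewrite (le_trans (ler_norm_sum _ _ _))// ler_sum// => s _.
by rewrite normrM [X in _ * X]ger0_norm// prod_wgt_ge0.
Qed.

Lemma avg_perm E (p : {perm 'I_L}) f : avg E (fun s => f [ffun l => s (p l)]) = avg E f.
Proof.
rewrite [RHS]/avg (reindex (fun s => [ffun l => s (p l)] : {ffun 'I_L -> Om}))/=; last first.
  exists (fun s => [ffun l => s ((p^-1)%g l)]) => s _; apply/ffunP => l; rewrite !ffunE.
    by rewrite permKV.
  by rewrite permK.
apply: eq_bigr => s _; congr (_ * _); rewrite (reindex_inj (@perm_inj _ p)) /=.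
by apply: eq_bigr => l _; rewrite ffunE.
Qed.

(** Multiply by 1, the total weight of a fresh copy of replica l, and exchange the two copies. *)
Lemma avg_indep E (l : 'I_L) f g : (forall s t, f (fupd s l t) = f s) ->
  avg E (fun s => f s * g (s l)) = avg E f * savg E g.
Proof.
move=> fl; rewrite -[LHS]mulr1 -(sum_wgt E) /avg /savg !big_distrlr /=.
rewrite (sum_swap l); apply: eq_bigr => s _; apply: eq_bigr => t _.
rewrite fl fupd_id (bigD1 l)//= fupd_id [in RHS](bigD1 l)//=.
rewrite (eq_bigr (fun i => wgt E (s i))); last by move=> i il; rewrite fupd_neq.
ring.
Qed.

Definition depends_on n f := forall s (l : 'I_L) t, (n <= l)%N -> f (fupd s l t) = f s.

(* Coefficients of the replicas in the derivative of a Gibbs average of a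
   function of the first [n] replicas. *)
Definition rcoef n (l : nat) : R := if (l < n)%N then 1 else if l == n then - n%:R else 0.

(** For replicas l >= n the centred term averages to 0 by independence. In the n others the
    subtracted mean is realized by one fresh replica, of index n, which therefore collects the
    coefficient - n. *)
Lemma avg_centered E n f g : (n < L)%N -> depends_on n f ->
  avg E (fun s => f s * \sum_(l < L) (g (s l) - savg E g)) =
  avg E (fun s => f s * \sum_(l < L) rcoef n l * g (s l)).
Proof.
move=> nL df.
under eq_fun do rewrite mulr_sumr; rewrite avg_sum.
under [in RHS]eq_fun do rewrite mulr_sumr; rewrite avg_sum.
have H (l : 'I_L) : avg E (fun s => f s * (g (s l) - savg E g)) =
   avg E (fun s => f s * g (s l)) - savg E g * avg E f.
  rewrite -mulNr -avgZ -avgD; congr avg; apply/funext => s; ring.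
have H' (l : 'I_L) : (n <= l)%N -> avg E (fun s => f s * g (s l)) = savg E g * avg E f.
  by move=> nl; rewrite mulrC; apply: avg_indep => s t; exact: df.
under eq_bigr do rewrite H.
rewrite (bigID (fun l : 'I_L => (l < n)%N)) /= [X in _ + X]big1 ?addr0; last first.
  by move=> l; rewrite -leqNgt => /H' ->; rewrite subrr.
rewrite [RHS](bigID (fun l : 'I_L => (l < n)%N)) /=.
rewrite sumrB; congr (_ + _).
  apply: eq_bigr => l ln; congr avg; apply/funext => s; by rewrite /rcoef ln mul1r.
rewrite [RHS](bigD1 (Ordinal nL)) /=; last by rewrite ltnn.
rewrite [X in _ = _ + X]big1 ?addr0; last first.
  move=> l /andP[ln ln']; rewrite /rcoef (negbTE ln).
  have -> : (l == n :> nat) = false by apply/negbTE; move: ln'; apply: contra => /eqP e; exact/eqP/val_inj.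
  by under eq_fun do rewrite mul0r mulr0; exact: avg_cst.
have -> : (fun s => f s * (rcoef n (Ordinal nL) * g (s (Ordinal nL)))) =
   (fun s => - n%:R * (f s * g (s (Ordinal nL)))).
  by apply/funext => s; rewrite /rcoef /= ltnn eqxx; ring.
rewrite avgZ H'//= -sumrN sumr_const.
have -> : #|[pred i : 'I_L | (i < n)%N]| = n.
  rewrite -sum1_card (big_ord_narrow (ltnW nL)) /= sum1_card card_ord//.
by rewrite mulNrn mulNr mulr_natl.
Qed.

(** If all energies move by at most d, numerator and partition function change by factors between
    e^-d and e^d, hence a weight by at most e^(2 d); weights are at most 1 and 1 - e^(-2 d) <= 2
    d. *)
Lemma wgt_lip E E' o : `|wgt E o - wgt E' o| <= 2 * \sum_t `|E t - E' t|.
Proof.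
wlog h : E E' / wgt E' o <= wgt E o.
  move=> hw; have [/hw//|/ltW /hw] := leP (wgt E' o) (wgt E o).
  by rewrite distrC; under [X in _ <= _ * X]eq_bigr do rewrite distrC.
set d := \sum_t _; rewrite ger0_norm ?subr_ge0//.
have dt t : `|E t - E' t| <= d by rewrite /d (bigD1 t)//= lerDl sumr_ge0.
have d0 : 0 <= d by exact: sumr_ge0.
have e1 : expR (- d) * expR (E o) <= expR (E' o).
  by rewrite -expRD ler_expR; have := dt o; rewrite ler_norml; lra.
have e2 : \sum_t expR (E' t) <= expR d * \sum_t expR (E t).
  rewrite mulr_sumr ler_sum// => t _; rewrite -expRD ler_expR.
  by have := dt t; rewrite ler_norml; lra.
have Z0 := partition_gt0 E; have Z0' := partition_gt0 E'.
have e3 : expR (- (2 * d)) * wgt E o <= wgt E' o.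
  rewrite /wgt ler_pdivlMr// mulrA mulrAC ler_pdivrMr//.
  rewrite (_ : - (2 * d) = - d + - d) ?expRD; last ring.
  rewrite [leLHS](_ : _ = (expR (- d) * expR (E o)) * (expR (- d) * \sum_t expR (E' t))); last ring.
  apply: ler_pM => //; rewrite ?mulr_ge0 ?expR_ge0 ?(ltW Z0')//.
  by rewrite expRN mulrC ler_pdivrMr ?expR_gt0// mulrC.
have e4 := expR_ge1Dx (- (2 * d)).
have w0 := wgt_ge0 E o; have w1 := wgt_le1 E o; nra.
Qed.

End Gibbs.

Section GibbsDerivative.
Context {R : realType} (Om : finType) (o0 : Om) (L : nat).
Implicit Types (E : (nat -> R) -> Om -> R) (f : {ffun 'I_L -> Om} -> R).

Lemma tame_wgt M E o : (forall t, tame M (E^~ t)) -> tame M (fun y => wgt (E y) o).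
Proof.
move=> tE.
have [C [m [C0 m0 H]]] : exists C m, [/\ 0 <= C, 0 <= m & forall y z : nat -> R,
    \sum_t `|E y t - E z t| <=
    C * expR (m * (l1 M y + l1 M z)) * l1 M (fun k => y k - z k)].
  elim: (index_enum Om) => [|t r [C [m [C0 m0 H]]]].
    by exists 0, 0; split=> // y z; rewrite big_nil !mul0r.
  have [C' [m' [C0' m0' bF]]] := tE t.
  have [_ l] : tame_bd M C' (m + m') (E^~ t) by apply: tame_bdW bF => //; rewrite lerDr.
  exists (C + C'), (m + m'); split=> [||y z]; rewrite ?addr_ge0//.
  rewrite big_cons addrC mulrDl mulrDl lerD//.
  apply: le_trans (H y z) _; rewrite ler_wpM2r ?l1_ge0// ler_wpM2l// ler_expR.
  by rewrite ler_wpM2r ?addr_ge0 ?l1_ge0// lerDl.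
exists (1 + 2 * C), m; split=> //; first by rewrite addr_ge0 ?mulr_ge0.
have e1 a : 0 <= a -> 1 <= expR (m * a) by move=> a0; rewrite -expR0 ler_expR mulr_ge0.
split=> [y|y z].
  rewrite ger0_norm ?wgt_ge0// (le_trans (wgt_le1 o0 _ _))//.
  rewrite -[leLHS]mulr1 ler_pM// ?e1 ?l1_ge0//.
  by rewrite lerDl mulr_ge0.
rewrite (le_trans (wgt_lip o0 _ _ _))//.
apply: (@le_trans _ _ (2 * (C * expR (m * (l1 M y + l1 M z)) * l1 M (fun k => y k - z k)))).
  by rewrite ler_wpM2l.
rewrite !mulrA ler_wpM2r ?l1_ge0// ler_wpM2r ?expR_ge0// lerDr//.
Qed.

Lemma tame_savg M E (g : (nat -> R) -> Om -> R) : (forall t, tame M (E^~ t)) ->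
  (forall t, tame M (g^~ t)) -> tame M (fun y => savg (E y) (g y)).
Proof.
by move=> tE tg; apply: tame_sum => o _; apply: tameM => //; exact: tame_wgt.
Qed.

Lemma tame_avg M E (F : (nat -> R) -> {ffun 'I_L -> Om} -> R) : (forall t, tame M (E^~ t)) ->
  (forall s, tame M (F^~ s)) -> tame M (fun y => avg (E y) (F y)).
Proof.
move=> tE tF; apply: tame_sum => s _; apply: tameM => //.
by apply: tame_prod => l _; exact: tame_wgt.
Qed.

Lemma is_partial_wgt k E E' o : (forall t, is_partial k (E^~ t) (E'^~ t)) ->
  is_partial k (fun y => wgt (E y) o)
    (fun y => wgt (E y) o * (E' y o - savg (E y) (E' y))).
Proof.
move=> dE; have Z0 y : \sum_t expR (E y t) != 0 by rewrite gt_eqF ?(partition_gt0 o0).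
have dZ := is_partial_sum (index_enum Om) (P := xpredT) (fun t _ => is_partial_expR (dE t)).
apply: (is_partial_eq (is_partialM (is_partial_expR (dE o)) (is_partialV Z0 dZ))) => y /=.
rewrite /savg /wgt.
have -> : \sum_t E' y t * (expR (E y t) / \sum_u expR (E y u)) =
   (\sum_t expR (E y t) * E' y t) / \sum_u expR (E y u).
  by rewrite mulr_suml; apply: eq_bigr => t _; rewrite mulrA (mulrC (E' y t)).
by have := Z0 y; set Z := \sum_t _ => Zn; field.
Qed.

Lemma is_partial_avg k E E' n f : (n < L)%N -> depends_on n f ->
  (forall t, is_partial k (E^~ t) (E'^~ t)) ->
  is_partial k (fun y => avg (E y) f)
    (fun y => avg (E y) (fun s => f s * \sum_(l < L) rcoef n l * E' y (s l))).
Proof.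
move=> nL df dE.
have dP s := is_partial_prod (index_enum 'I_L) (fun l => is_partial_wgt (s l) dE).
have := is_partial_sum (index_enum {ffun 'I_L -> Om}) (P := xpredT)
   (fun s _ => is_partialZ (f s) (dP s)).
move=> h; apply: (is_partial_eq h) => y; rewrite -avg_centered//.
by apply: eq_bigr => s _; ring.
Qed.

End GibbsDerivative.

(** * Derivative of a disorder-averaged Gibbs average along a Gaussian path *)

Section GaussianInterpolation.
Context {R : realType} (Om : finType) (o0 : Om) (L M : nat).
Variables (A A' : nat -> R -> R) (B B' : R -> R) (c : nat -> Om -> R) (rho gam : Om -> R).
Hypotheses (dA : forall k (x : R), is_derive x 1 (A k) (A' k x))
  (dB : forall x : R, is_derive x 1 B (B' x))
  (tA : forall k, tame1 (A k)) (tA' : forall k, tame1 (A' k)) (tB : tame1 B) (tB' : tame1 B').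
Implicit Types (f : {ffun 'I_L -> Om} -> R).

(** The path parameter is stored as coordinate M, next to the Gaussians 0, ..., M - 1 that are
    integrated, so a derivative along the path is one more partial derivative and passes under
    [gaussEn] by the same lemma. [A k] is the amplitude of the k-th Gaussian and [B] drives a
    deterministic term. *)
Definition energy (y : nat -> R) (o : Om) : R :=
  \sum_(k < M) A k (y M) * y k * c k o + B (y M) * rho o + gam o.
Definition energy' (y : nat -> R) (o : Om) : R :=
  \sum_(k < M) A' k (y M) * y k * c k o + B' (y M) * rho o.
Definition gavg (x : R) f : R := gaussEn M (fun y => avg (energy (upd y M x)) f).

Lemma tame_energy o : tame M.+1 (energy^~ o).
Proof.
apply: tameD; last exact: tame_cst.
apply: tameD; last by apply: tameM; [exact: (tame1_tame (ltnSn M) tB)|exact: tame_cst].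
apply: tame_sum => k _; apply: tameM; last exact: tame_cst.
by apply: tameM; [exact: (tame1_tame (ltnSn M) (tA k))|apply: tame_coord; rewrite ltnS ltnW].
Qed.

Lemma tame_energy' o : tame M.+1 (energy'^~ o).
Proof.
apply: tameD; last by apply: tameM; [exact: (tame1_tame (ltnSn M) tB')|exact: tame_cst].
apply: tame_sum => k _; apply: tameM; last exact: tame_cst.
by apply: tameM; [exact: (tame1_tame (ltnSn M) (tA' k))|apply: tame_coord; rewrite ltnS ltnW].
Qed.

Lemma is_partial_energy_param o : is_partial M (energy^~ o) (energy'^~ o).
Proof.
rewrite /energy /energy'.
have d1 (k : 'I_M) : is_partial M (fun y => A k (y M) * y k * c k o)
    (fun y => A' k (y M) * y k * c k o).
  have i1 : is_partial M (fun y : nat -> R => y k) (fun=> 0 : R).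
    by apply: is_partial_indep => y x; rewrite upd_neq// ltn_eqF.
  have := is_partialM (is_partialM (is_partial_fun M (dA k)) i1) (is_partial_cst M (c k o)).
  by move=> h; apply: (is_partial_eq h) => y; ring.
have d2 := is_partial_sum (index_enum 'I_M) (P := xpredT) (fun k _ => d1 k).
have d3 := is_partialM (is_partial_fun M dB) (is_partial_cst M (rho o)).
have := is_partialD (is_partialD d2 d3) (is_partial_cst M (gam o)).
by move=> h; apply: (is_partial_eq h) => y; ring.
Qed.

Lemma is_partial_energy_slice (x : R) k o : (k < M)%N ->
  is_partial k (fun y => energy (upd y M x) o) (fun=> A k x * c k o).
Proof.
move=> kM.
rewrite (_ : (fun y => _) = fun y : nat -> R => \sum_(j < M) A j x * y j * c j o + (B x * rho o + gam o)); last first.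
  apply/funext => y; rewrite /energy upd_id addrA; do 2!congr (_ + _).
  by apply: eq_bigr => j _; rewrite upd_neq// ltn_eqF.
have d1 (j : 'I_M) : is_partial k (fun y => A j x * y j * c j o)
    (fun=> if j == Ordinal kM then A j x * c j o else 0).
  case: eqP => [->|/eqP jk] /=.
    have did (z : R) : is_derive z 1 id (1 : R) by exact: is_derive_id.
    have := is_partialM (is_partialZ (A k x) (is_partial_fun k did)) (is_partial_cst k (c k o)).
    by move=> h; apply: (is_partial_eq h) => y; ring.
  apply: is_partial_indep => y z; rewrite upd_neq//.
have d2 := is_partial_sum (index_enum 'I_M) (P := xpredT) (fun j _ => d1 j).
apply: (is_partial_eq (is_partialD d2 (is_partial_cst k (B x * rho o + gam o)))) => y.
by rewrite addr0 -big_mkcond /= big_pred1_eq.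
Qed.

Lemma tame_gavg (x : R) (F : (nat -> R) -> {ffun 'I_L -> Om} -> R) : (forall s, tame M (F^~ s)) ->
  tame M (fun y => avg (energy (upd y M x)) (F y)).
Proof.
move=> tF; apply: tame_avg => // t.
exact: (@tame_slice _ _ (energy^~ t)) (tame_energy t).
Qed.

Lemma tame_gavg_cst (x : R) f : tame M (fun y => avg (energy (upd y M x)) f).
Proof. by apply: tame_gavg => s; exact: tame_cst. Qed.

Lemma gavg_cst x (C : R) : gavg x (fun=> C) = C.
Proof. by rewrite /gavg; under eq_fun do rewrite (avg_cst o0); rewrite gaussEn_cst. Qed.

Lemma gavgD x f f' : gavg x (fun s => f s + f' s) = gavg x f + gavg x f'.
Proof.
by rewrite -gaussEnD; try exact: tame_gavg_cst; congr gaussEn; apply/funext => y; rewrite avgD.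
Qed.

Lemma gavgZ x C f : gavg x (fun s => C * f s) = C * gavg x f.
Proof.
by rewrite -gaussEnZ; try exact: tame_gavg_cst; congr gaussEn; apply/funext => y; rewrite avgZ.
Qed.

Lemma gavg_sum x (I : Type) (r : seq I) (P : pred I) (f : I -> {ffun 'I_L -> Om} -> R) :
  gavg x (fun s => \sum_(i <- r | P i) f i s) = \sum_(i <- r | P i) gavg x (f i).
Proof.
rewrite -gaussEn_sum => [|i _]; try exact: tame_gavg_cst.
by congr gaussEn; apply/funext => y; rewrite avg_sum.
Qed.

Lemma gavg_le x f f' : (forall s, f s <= f' s) -> gavg x f <= gavg x f'.
Proof.
by move=> h; apply: gaussEn_le => [||y]; try exact: tame_gavg_cst; exact: avg_le.
Qed.

Lemma gavg_abs x f : `|gavg x f| <= gavg x (fun s => `|f s|).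
Proof. by apply: gaussEn_abs => [||y]; try exact: tame_gavg_cst; exact: avg_abs. Qed.

Lemma gavg_perm x (p : {perm 'I_L}) f : gavg x (fun s => f [ffun l => s (p l)]) = gavg x f.
Proof. by congr gaussEn; apply/funext => y; exact: avg_perm. Qed.

Lemma depends_on_rcoef n f (g : Om -> R) : depends_on n f ->
  depends_on n.+1 (fun s => f s * \sum_(l < L) rcoef n l * g (s l)).
Proof.
move=> df s l t nl; rewrite df ?(ltnW nl)//; congr (_ * _); apply: eq_bigr => j _.
have [->|jl] := eqVneq j l; last by rewrite fupd_neq.
by rewrite /rcoef ltnNge (ltnW nl) /= gtn_eqF// !mul0r.
Qed.

(** The derivative in the parameter brings in replica n with coefficients [rcoef n]; the integration
    by parts in each Gaussian brings in replica n + 1 with [rcoef n.+1]. The amplitudes enter only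
    through A' A, half the derivative of the variance of the k-th coupling. *)
Theorem is_derive_gavg n f (x : R) (e : nat -> R) (kap : R) : (n.+1 < L)%N -> depends_on n f ->
  (forall k, (k < M)%N -> A' k x * A k x = kap * e k) ->
  is_derive x 1 (fun t => gavg t f)
    (kap * gavg x (fun s => f s * \sum_(l < L) \sum_(l' < L) rcoef n l * rcoef n.+1 l' *
       \sum_(k < M) e k * c k (s l) * c k (s l')) +
     B' x * gavg x (fun s => f s * \sum_(l < L) rcoef n l * rho (s l))).
Proof.
move=> nL df Ae.
pose G y := avg (energy y) (fun s => f s * \sum_(l < L) rcoef n l * energy' y (s l)).
have tG : tame M.+1 G.
  apply: tame_avg => // [t|s]; first exact: tame_energy.
  by apply: tameZ; apply: tame_sum => l _; apply: tameZ; exact: tame_energy'.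
have tF : tame M.+1 (fun y => avg (energy y) f).
  by apply: tame_avg => // [t|s]; [exact: tame_energy|exact: tame_cst].
have dF := is_partial_avg o0 (ltnW nL) df is_partial_energy_param.
have dE := is_derive_gaussEn x tF tG dF.
apply: (@is_derive_eq _ _ _ _ _ _ _ _ dE); pose g k s := f s * \sum_(l < L) rcoef n l * c k (s l).
transitivity (\sum_(k < M) A' k x * gaussEn M (fun y => y k * avg (energy (upd y M x)) (g k)) +
   B' x * gavg x (fun s => f s * \sum_(l < L) rcoef n l * rho (s l))).
  have tg k : (k < M)%N -> tame M (fun y => y k * avg (energy (upd y M x)) (g k)).
    by move=> kM; apply: tameM; [exact: tame_coord|exact: tame_gavg_cst].
  rewrite -gaussEnZ; last exact: tame_gavg_cst.
  have E1 (k : 'I_M) : A' k x * gaussEn M (fun y => y k * avg (energy (upd y M x)) (g k)) =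
      gaussEn M (fun y => A' k x * (y k * avg (energy (upd y M x)) (g k))).
    by rewrite gaussEnZ//; exact: tg.
  rewrite (eq_bigr _ (fun k _ => E1 k)).
  rewrite -gaussEn_sum => [|k _]; last by apply: tameZ; exact: tg.
  rewrite -gaussEnD; last 2 first.
  - by apply: tame_sum => k _; apply: tameZ; exact: tg.
  - by apply: tameZ; exact: tame_gavg_cst.
  congr gaussEn; apply/funext => y; rewrite /G -avgZ.
  under eq_bigr => k _ do rewrite -!avgZ.
  rewrite -avg_sum -avgD; congr avg; apply/funext => s.
  rewrite /g /energy' upd_id.
  have -> : \sum_(k < M) A' k x * (y k * (f s * \sum_(l < L) rcoef n l * c k (s l))) =
      f s * \sum_(l < L) \sum_(k < M) A' k x * y k * (rcoef n l * c k (s l)).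
    rewrite [in RHS]exchange_big mulr_sumr; apply: eq_bigr => k _.
    by rewrite -mulr_sumr; ring.
  have -> : B' x * (f s * \sum_(l < L) rcoef n l * rho (s l)) =
      f s * \sum_(l < L) B' x * (rcoef n l * rho (s l)) by rewrite -mulr_sumr; ring.
  rewrite -mulrDr -big_split; congr (_ * _); apply: eq_bigr => l _.
  rewrite mulrDr mulr_sumr; congr (_ + _); last by ring.
  by apply: eq_bigr => k _; rewrite upd_neq ?ltn_eqF//; ring.
congr (_ + _); rewrite -gavgZ.
have dg k : depends_on n.+1 (g k) by exact: depends_on_rcoef.
have ibp (k : 'I_M) : gaussEn M (fun y => y k * avg (energy (upd y M x)) (g k)) =
    gavg x (fun s => g k s * \sum_(l < L) rcoef n.+1 l * (A k x * c k (s l))).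
  apply: gaussEn_ibp => //; try exact: tame_gavg_cst.
  have := @is_partial_avg _ _ o0 L k (fun y => energy (upd y M x)) (fun y o => A k x * c k o) n.+1 (g k) nL (dg k).
  by apply=> t; exact: is_partial_energy_slice.
under eq_bigr => k _ do rewrite ibp -gavgZ.
rewrite -gavg_sum; congr gavg; apply/funext => s.
have E2 (k : 'I_M) : A' k x * (g k s * \sum_(l < L) rcoef n.+1 l * (A k x * c k (s l))) =
    f s * \sum_(l < L) \sum_(l' < L) rcoef n l * rcoef n.+1 l' *
      (kap * (e k * c k (s l) * c k (s l'))).
  rewrite /g -mulrA mulrCA; congr (f s * _).
  rewrite mulr_suml mulr_sumr; apply: eq_bigr => l _.
  rewrite mulr_sumr mulr_sumr; apply: eq_bigr => l' _.
  rewrite [LHS](_ : _ = (A' k x * A k x) * (rcoef n l * rcoef n.+1 l' * c k (s l) * c k (s l'))); last ring.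
  by rewrite (Ae k (ltn_ord k)); ring.
rewrite (eq_bigr _ (fun k _ => E2 k)) -mulr_sumr (mulrCA kap); congr (f s * _).
rewrite exchange_big mulr_sumr; apply: eq_bigr => l _.
rewrite exchange_big mulr_sumr; apply: eq_bigr => l' _.
by rewrite -mulr_sumr -mulr_sumr; ring.
Qed.

End GaussianInterpolation.

(** * The cavity at one site *)

Section SiteFactorization.
Variables (I J T : finType).
Implicit Types (o : {ffun J -> T}) (s : {ffun I -> {ffun J -> T}}) (e : {ffun I -> T}) (i : J).

Definition setsite i s e : {ffun I -> {ffun J -> T}} := [ffun l => fupd (s l) i (e l)].
Definition site i s : {ffun I -> T} := [ffun l => s l i].

(** The involution of [sum_swap], carried out at site i in all replicas at once. *)
Lemma sum_swap_site (V : nmodType) i (F : {ffun I -> {ffun J -> T}} -> {ffun I -> T} -> V) :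
  \sum_s \sum_e F s e = \sum_s \sum_e F (setsite i s e) (site i s).
Proof.
have K s e : (setsite i (setsite i s e) (site i s) = s) * (site i (setsite i s e) = e).
  split; apply/ffunP => l; last by rewrite !ffunE eqxx.
  by apply/ffunP => j; rewrite !ffunE; case: eqP => // ->.
rewrite !pair_bigA /= (reindex (fun p => (setsite i p.1 p.2, site i p.1)))//=.
exists (fun p => (setsite i p.1 p.2, site i p.1)) => -[s e] _ /=; rewrite !K//.
Qed.

End SiteFactorization.

Section SiteFactorizationGibbs.
Context {R : realType} (J T : finType) (t0 : T) (L : nat).
Implicit Types (U : {ffun J -> T} -> R) (V : T -> R) (i : J).

(** Both sides equal the partition function of the other sites times those of V and V' at site i.
    The cross-multiplied form avoids a separate type for configurations off site i. *)
Lemma partition_site i U V V' : (forall o t, U (fupd o i t) = U o) ->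
  (\sum_o expR (U o + V (o i))) * (\sum_t expR (V' t)) =
  (\sum_o expR (U o + V' (o i))) * (\sum_t expR (V t)).
Proof.
move=> iU; rewrite !big_distrlr /= (sum_swap i); apply: eq_bigr => o _; apply: eq_bigr => t _.
by rewrite -!expRD iU fupd_id; congr expR; ring.
Qed.

(** A copy of site i with the reference energy V' is adjoined and exchanged with the original one;
    [partition_site] matches the normalizations. *)
Lemma avg_site i U V V' (f : {ffun 'I_L -> {ffun J -> T}} -> R) (g : {ffun 'I_L -> T} -> R) :
  (forall o t, U (fupd o i t) = U o) -> (forall s e, f (setsite i s e) = f s) ->
  avg (fun o => U o + V (o i)) (fun s => f s * g (site i s)) =
  avg (fun o => U o + V' (o i)) f * avg V g.
Proof.
move=> iU i_f; rewrite -[LHS]mulr1 -(sum_prod_wgt t0 L V') /avg !big_distrlr /=.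
rewrite (sum_swap_site i); apply: eq_bigr => s _; apply: eq_bigr => e _.
rewrite i_f (_ : site i (setsite i s e) = e); last first.
  by apply/ffunP => l; rewrite !ffunE eqxx.
rewrite -mulrA [RHS]mulrACA; congr (_ * _); rewrite -big_split -big_split /=.
apply: eq_bigr => l _.
have -> : setsite i s e l = fupd (s l) i (e l) by rewrite ffunE.
have -> : site i s l = s l i by rewrite ffunE.
rewrite /wgt iU fupd_id.
have Z1 := partition_gt0 t0 V; have Z2 := partition_gt0 t0 V'.
have o0 : {ffun J -> T} := [ffun=> t0].
have Z3 := partition_gt0 o0 (fun o => U o + V (o i)).
have Z4 := partition_gt0 o0 (fun o => U o + V' (o i)).
have := partition_site V V' iU.
move: Z1 Z2 Z3 Z4; set z1 := \sum_t _; set z2 := \sum_t _; set z3 := \sum_o _; set z4 := \sum_o _.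
move=> Z1 Z2 Z3 Z4 E; rewrite mulrACA [RHS]mulrACA -!expRD -!invfM.
rewrite (_ : z3 * z2 = z4 * z1)//; congr (expR _ * _); ring.
Qed.

Lemma avg_prod (V : T -> R) (g : 'I_L -> T -> R) :
  avg V (fun e => \prod_l g l (e l)) = \prod_l savg V (g l).
Proof.
rewrite /avg /savg bigA_distr_bigA /=; apply: eq_bigr => e _; by rewrite -big_split.
Qed.

End SiteFactorizationGibbs.

Lemma sum_mulord (V : nmodType) (N K : nat) (F : nat -> V) :
  \sum_(k < N * K) F k = \sum_(a < N) \sum_(b < K) F (a * K + b)%N.
Proof.
elim: N => [|N IH]; first by rewrite mul0n !big_ord0.
rewrite big_ord_recr /= -IH mulSnr big_split_ord /=.
by congr (_ + _).
Qed.

Section TrigTame.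
Context {R : realType}.

Lemma tame1_bounded (f f' : R -> R) (C : R) : 0 <= C -> (forall x : R, is_derive x 1 f (f' x)) ->
  (forall x, `|f x| <= C) -> (forall x, `|f' x| <= C) -> tame1 f.
Proof.
move=> C0 df bf bf'; exists C, 0; split=> //.
  by move=> x; rewrite mul0r expR0 mulr1.
move=> x x'; rewrite mul0r expR0 mulr1.
have cf : continuous f.
  by move=> t; apply/differentiable_continuous/derivable1_diffP; have [] := df t.
wlog xx : x x' / x' <= x.
  move=> hw; have [/hw//|/ltW /hw] := leP x' x.
  by rewrite distrC (distrC x).
have [c _ ->] := MVT_segment xx (fun t _ => df t) (continuous_subspaceT cf).
by rewrite normrM ler_wpM2r.
Qed.

Lemma norm_sin_le1 (x : R) : `|sin x| <= 1.
Proof. by rewrite ler_norml sin_geN1 sin_le1. Qed.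
Lemma norm_cos_le1 (x : R) : `|cos x| <= 1.
Proof. by rewrite ler_norml cos_geN1 cos_le1. Qed.

Lemma tame1_sin : tame1 (@sin R).
Proof.
exact: (@tame1_bounded _ (@cos R) 1 ler01 (fun x => is_derive_sin x) norm_sin_le1 norm_cos_le1).
Qed.

Lemma tame1_cos : tame1 (@cos R).
Proof.
apply: (@tame1_bounded _ (fun x => - sin x) 1 ler01 (fun x => is_derive_cos x) norm_cos_le1).
by move=> x; rewrite normrN norm_sin_le1.
Qed.

Lemma tame1_tame_id (f : R -> R) : tame1 f <-> tame 1 (fun y => f (y 0%N)).
Proof.
split=> [|[C [m [C0 m0 [b l]]]]]; first exact: tame1_tame.
exists C, m; split=> // [x|x x'].
  by have := b (fun=> x); rewrite /l1 big_ord1.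
by have := l (fun=> x) (fun=> x'); rewrite /l1 !big_ord1.
Qed.

Lemma tame1M (f g : R -> R) : tame1 f -> tame1 g -> tame1 (fun x => f x * g x).
Proof. by move=> /tame1_tame_id tf /tame1_tame_id tg; apply/tame1_tame_id; exact: tameM. Qed.

Lemma tame1_cst (c : R) : tame1 (fun=> c).
Proof. by apply/tame1_tame_id; exact: tame_cst. Qed.

End TrigTame.

(** * The path from the decoupled site to the model *)

Section CavityInterpolation.
Context {R : realType}.
Variables (S N L : nat) (beta h D p q : R) (i : 'I_N).
Hypotheses (N0 : (0 < N)%N) (q0 : 0 <= q).
Local Notation cfg := (config S N).
Local Notation M := (N * N)%N.
Implicit Types (f : {ffun 'I_L -> cfg} -> R) (sg : cfg) (x : R).

Definition cfg0 : cfg := [ffun=> ord0].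
Definition nspin sg (a : nat) : R := oapp (fun j => spin (sg j)) 0 (insub a).

Lemma nspinE sg (j : 'I_N) : nspin sg j = spin (sg j).
Proof. by rewrite /nspin valK. Qed.

Definition touches (a b : nat) := (a < b)%N && ((a == i) || (b == i)).
Definition isdiag (a b : nat) := (a == i) && (b == i).

(* Coordinate k of the disorder is the pair (k %/ N, k %% N). At angle x the
   couplings of site i are scaled by sin x, and the diagonal Gaussian y_(i,i),
   absent from the Hamiltonian, is scaled by cos x and plays the role of the
   variable eta: the model is recovered at pi / 2, and site i is decoupled at 0. *)
Definition camp (k : nat) (x : R) : R :=
  if touches (k %/ N) (k %% N) then sin x else if isdiag (k %/ N) (k %% N) then cos x else 1.
Definition camp' (k : nat) (x : R) : R :=
  if touches (k %/ N) (k %% N) then cos x else if isdiag (k %/ N) (k %% N) then - sin x else 0.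
(** Direction in which the variance of coordinate k moves with the angle: sin^2 for the couplings of
    site i, cos^2 for the diagonal Gaussian, constant otherwise. Thus [camp' k x * camp k x] is sin
    x cos x times [csign k]. *)
Definition csign (k : nat) : R :=
  if touches (k %/ N) (k %% N) then 1 else if isdiag (k %/ N) (k %% N) then -1 else 0.
Definition ccoef (k : nat) sg : R :=
  if (k %/ N < k %% N)%N then beta / Num.sqrt N%:R * nspin sg (k %/ N) * nspin sg (k %% N)
  else if isdiag (k %/ N) (k %% N) then beta * Num.sqrt q * spin (sg i) else 0.
(** At angle 0 it yields the term beta^2 / 2 (p - q) s^2 of [wsite]. Along the path its derivative
    replaces by p the q that the diagonal Gaussian subtracts from self-overlaps. *)
Definition cB x : R := beta ^+ 2 / 2 * (p - q) * (cos x * cos x).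
Definition cB' x : R := - (beta ^+ 2 * (p - q)) * (sin x * cos x).
Definition crho sg : R := spin (sg i) ^+ 2.
Definition cgam sg : R := D * (\sum_(j < N) spin (sg j) ^+ 2) + h * (\sum_(j < N) spin (sg j)).

Definition cenergy := energy M camp cB ccoef crho cgam.
Definition cavg x f : R := gavg (L := L) M camp cB ccoef crho cgam x f.

Lemma is_derive_camp k x : is_derive x 1 (camp k) (camp' k x).
Proof.
rewrite /camp /camp'; case: (touches _ _); first exact: is_derive_sin.
by case: (isdiag _ _); [exact: is_derive_cos|exact: is_derive_cst].
Qed.

Lemma is_derive_cB x : is_derive x 1 cB (cB' x).
Proof.
by rewrite /cB /cB'; apply: is_derive_eq; rewrite /GRing.scale /=; field.
Qed.

Lemma tame1_sinN : tame1 (fun x : R => - sin x).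
Proof.
by have := tame1M (tame1_cst (-1)) (@tame1_sin R); congr tame1; apply/funext => x; rewrite mulN1r.
Qed.

Lemma tame1_camp k : tame1 (camp k).
Proof.
rewrite /camp; case: (touches _ _); first exact: tame1_sin.
by case: (isdiag _ _); [exact: tame1_cos|exact: tame1_cst].
Qed.

Lemma tame1_camp' k : tame1 (camp' k).
Proof.
rewrite /camp'; case: (touches _ _); first exact: tame1_cos.
by case: (isdiag _ _); [exact: tame1_sinN|exact: tame1_cst].
Qed.

Lemma tame1_cB : tame1 cB.
Proof. by apply: tame1M; [exact: tame1_cst|apply: tame1M; exact: tame1_cos]. Qed.

Lemma tame1_cB' : tame1 cB'.
Proof. by apply: tame1M; [exact: tame1_cst|apply: tame1M; [exact: tame1_sin|exact: tame1_cos]]. Qed.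

Lemma cavgD x f f' : cavg x (fun s => f s + f' s) = cavg x f + cavg x f'.
Proof. exact: (gavgD cfg0 _ _ _ _ tame1_camp tame1_cB). Qed.

Lemma cavgZ x (c : R) f : cavg x (fun s => c * f s) = c * cavg x f.
Proof. exact: (gavgZ cfg0 _ _ _ _ tame1_camp tame1_cB). Qed.

Lemma cavg_sum x (I : Type) (r : seq I) (P : pred I) (f : I -> {ffun 'I_L -> cfg} -> R) :
  cavg x (fun s => \sum_(j <- r | P j) f j s) = \sum_(j <- r | P j) cavg x (f j).
Proof. exact: (gavg_sum cfg0 _ _ _ _ tame1_camp tame1_cB). Qed.

Lemma cavg_le x f f' : (forall s, f s <= f' s) -> cavg x f <= cavg x f'.
Proof. exact: (gavg_le cfg0 _ _ _ _ tame1_camp tame1_cB). Qed.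

Lemma cavg_abs x f : `|cavg x f| <= cavg x (fun s => `|f s|).
Proof. exact: (gavg_abs cfg0 _ _ _ _ tame1_camp tame1_cB). Qed.

Lemma cavg_perm x (pi : {perm 'I_L}) f : cavg x (fun s => f [ffun l => s (pi l)]) = cavg x f.
Proof. exact: gavg_perm. Qed.

Lemma cavg_cst x (c : R) : cavg x (fun=> c) = c.
Proof. exact: (gavg_cst cfg0). Qed.

Lemma divn_pair (a b : 'I_N) : ((a * N + b) %/ N = a)%N.
Proof. by rewrite divnMDl// divn_small ?addn0. Qed.

Lemma modn_pair (a b : 'I_N) : ((a * N + b) %% N = b)%N.
Proof. by rewrite modnMDl modn_small. Qed.

Lemma cenergyE (y : nat -> R) x sg : cenergy (upd y M x) sg =
  beta / Num.sqrt (N%:R) *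
    (\sum_(a < N) \sum_(b < N | (a < b)%N)
       (if (a == i) || (b == i) then sin x else 1) * y (a * N + b)%N * spin (sg a) * spin (sg b))
  + cos x * y (i * N + i)%N * (beta * Num.sqrt q * spin (sg i))
  + cB x * crho sg + cgam sg.
Proof.
rewrite /cenergy /energy upd_id; congr (_ + _ + _).
rewrite (eq_bigr (fun k : 'I_M => camp k x * y k * ccoef k sg)); last first.
  by move=> k _; rewrite upd_neq// ltn_eqF.
rewrite (@sum_mulord _ _ _ (fun k => camp k x * y k * ccoef k sg)).
rewrite [X in _ = _ + X](_ : _ = \sum_(a < N) \sum_(b < N) if isdiag a b then
    cos x * y (a * N + b)%N * (beta * Num.sqrt q * spin (sg i)) else 0); last first.
  rewrite (bigD1 i)//= [X in _ + X]big1 ?addr0; last first.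
    move=> a ai; rewrite big1// => b _.
    by rewrite /isdiag !val_eqE (negbTE ai).
  rewrite (bigD1 i)//= [X in _ + X]big1 ?addr0; first by rewrite /isdiag eqxx.
  by move=> b bi; rewrite /isdiag !val_eqE (negbTE bi) andbF.
rewrite mulr_sumr -big_split; apply: eq_bigr => a _ /=.
rewrite mulr_sumr [X in _ = X + _]big_mkcond -big_split /=; apply: eq_bigr => b _.
rewrite /camp /ccoef /touches divn_pair modn_pair /isdiag.
have [ab|ab] := boolP (a < b)%N => /=; last first.
  by case: ifP => _; rewrite ?mulr0 ?addr0 ?add0r.
have -> : (a == i :> nat) && (b == i :> nat) = false.
  by apply/negbTE/negP => /andP[/eqP ai /eqP bi]; rewrite ai bi ltnn in ab.
by rewrite addr0 !nspinE !val_eqE; case: ifP => _; ring.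
Qed.

Lemma cenergy_end (y : nat -> R) sg : cenergy (upd y M (pi / 2)) sg = hamil beta h D y sg.
Proof.
rewrite cenergyE sin_pihalf cos_pihalf /cB cos_pihalf /hamil !mul0r addr0 mulr0 mul0r addr0 -addrA.
congr (_ * _ + _); apply: eq_bigr => a _; apply: eq_bigr => b _.
by rewrite if_same mul1r.
Qed.

Lemma cavg_end f : cavg (pi / 2) f = gaussEn M (fun y => avg (hamil beta h D y) f).
Proof.
congr gaussEn; apply/funext => y; congr avg; apply/funext => sg; exact: cenergy_end.
Qed.

(** Site i is left out but the division is still by N: the full overlap differs by a single term of
    order 1/N, and this one does not see the spins of site i. *)
Definition overlap (a b : cfg) : R := N%:R^-1 * \sum_(j < N | j != i) spin (a j) * spin (b j).
Definition cdev (s : {ffun 'I_L -> cfg}) (l l' : 'I_L) : R :=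
  overlap (s l) (s l') - (if l == l' then p else q).
Definition cW n (s : {ffun 'I_L -> cfg}) : R := \sum_(l < L) \sum_(l' < L)
  rcoef n l * rcoef n.+1 l' * (spin (s l i) * spin (s l' i) * cdev s l l').

(** The couplings of i with larger and with smaller sites together run over all sites but i and
    produce the overlap; the diagonal Gaussian, with coefficient beta sqrt q, subtracts q. *)
Lemma sum_csign (sg tau : cfg) : \sum_(k < M) csign k * ccoef k sg * ccoef k tau =
  beta ^+ 2 * (spin (sg i) * spin (tau i) * (overlap sg tau - q)).
Proof.
rewrite (@sum_mulord _ _ _ (fun k => csign k * ccoef k sg * ccoef k tau)).
pose T (a b : 'I_N) : R := beta ^+ 2 / N%:R * (spin (sg a) * spin (tau a) * (spin (sg b) * spin (tau b))).
transitivity (\sum_(a < N) \sum_(b < N)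
  ((if (a == i) && (a < b)%N then T i b else 0) + (if (b == i) && (a < b)%N then T i a else 0)
   + (if isdiag a b then - (beta ^+ 2 * q * (spin (sg i) * spin (tau i))) else 0))).
  apply: eq_bigr => a _; apply: eq_bigr => b _.
  rewrite /csign /ccoef divn_pair modn_pair /touches /isdiag !val_eqE.
  have sN : Num.sqrt (N%:R : R) * Num.sqrt N%:R = N%:R by rewrite -expr2 sqr_sqrtr.
  have sN0 : Num.sqrt (N%:R : R) != 0 by rewrite gt_eqF// sqrtr_gt0 ltr0n.
  have [ab|ab] := boolP (a < b)%N => /=; last first.
    rewrite !andbF /= !add0r; case: ifP => _; last by rewrite !mul0r.
    have := sqr_sqrtr q0; rewrite expr2 => sq.
    by rewrite -[in RHS]sq; ring.
  rewrite !andbT !nspinE.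
  have hT : (beta / Num.sqrt N%:R * spin (sg a) * spin (sg b)) *
      (beta / Num.sqrt N%:R * spin (tau a) * spin (tau b)) = T a b.
    by rewrite /T; move: sN sN0; set r := Num.sqrt _ => <- r0; field.
  have [ai|ai] := eqVneq a i; have [bi|bi] := eqVneq b i => /=.
  - by rewrite ai bi ltnn in ab.
  - by rewrite !addr0 mul1r -ai hT.
  - by rewrite add0r addr0 mul1r -bi hT /T; ring.
  - by rewrite !mul0r !addr0.
rewrite (eq_bigr (fun a => (\sum_(b < N) (if (a == i) && (a < b)%N then T i b else 0))
  + (\sum_(b < N) (if (b == i) && (a < b)%N then T i a else 0))
  + \sum_(b < N) (if isdiag a b then - (beta ^+ 2 * q * (spin (sg i) * spin (tau i))) else 0))); last first.
  by move=> a _; rewrite !big_split.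
rewrite !big_split /=.
have -> : \sum_(a < N) \sum_(b < N) (if (a == i) && (a < b)%N then T i b else 0) =
    \sum_(b < N | (i < b)%N) T i b.
  rewrite (bigD1 i)//= [X in _ + X]big1 ?addr0.
    by rewrite eqxx /= -big_mkcond.
  by move=> a /negbTE ->; rewrite big1.
have -> : \sum_(a < N) \sum_(b < N) (if (b == i) && (a < b)%N then T i a else 0) =
    \sum_(a < N | (a < i)%N) T i a.
  rewrite exchange_big /= (bigD1 i)//= [X in _ + X]big1 ?addr0.
    by rewrite eqxx /= -big_mkcond.
  by move=> a /negbTE ->; rewrite big1.
have -> (c : R) : \sum_(a < N) \sum_(b < N) (if isdiag a b then c else 0) = c.
  rewrite (bigD1 i)//= [X in _ + X]big1 ?addr0; last first.
    move=> a ai; rewrite big1// => b _.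
    by rewrite /isdiag !val_eqE (negbTE ai).
  rewrite (bigD1 i)//= [X in _ + X]big1 ?addr0; first by rewrite /isdiag eqxx.
  by move=> b bi; rewrite /isdiag !val_eqE (negbTE bi) andbF.
transitivity (beta ^+ 2 * (spin (sg i) * spin (tau i) * overlap sg tau) -
  beta ^+ 2 * q * (spin (sg i) * spin (tau i))); last by ring.
congr (_ - _).
rewrite /overlap /T.
transitivity (\sum_(b < N | b != i) beta ^+ 2 / N%:R * (spin (sg i) * spin (tau i) * (spin (sg b) * spin (tau b)))).
  rewrite [RHS](bigID (fun b : 'I_N => (i < b)%N)) /=; congr (_ + _); apply: eq_bigl => b.
    by have [ib|] := ltnP i b; rewrite ?andbF// andbT; apply/esym; rewrite -(inj_eq val_inj) gtn_eqF.
  by rewrite -leqNgt ltn_neqAle val_eqE.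
rewrite -mulr_sumr -mulr_sumr; ring.
Qed.

(** Hence the diagonal terms of the double sum over replicas carry the same coefficients as the
    deterministic term, and the two merge into self-overlaps centred at p. *)
Lemma rcoef_diag n (l : nat) : rcoef n l * rcoef n.+1 l = rcoef n l :> R.
Proof.
rewrite /rcoef; have [ln|] := ltnP l n; first by rewrite ltnS ltnW// mulr1.
rewrite leq_eqVlt => /predU1P[<-|nl]; first by rewrite eqxx ltnSn mulr1.
by rewrite gtn_eqF// mul0r.
Qed.

Theorem is_derive_cavg n f x : (n.+1 < L)%N -> depends_on n f ->
  is_derive x 1 (fun t => cavg t f)
    (beta ^+ 2 * (sin x * cos x) * cavg x (fun s => f s * cW n s)).
Proof.
move=> nL df.
have Ae k : (k < M)%N -> camp' k x * camp k x = (sin x * cos x) * csign k.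
  by move=> _; rewrite /camp /camp' /csign; case: ifP => _; [|case: ifP => _]; ring.
have := is_derive_gavg cfg0 ccoef crho cgam is_derive_camp is_derive_cB
  tame1_camp tame1_camp' tame1_cB tame1_cB' nL df Ae.
move=> dE; apply: (@is_derive_eq _ _ _ _ _ _ _ _ dE).
rewrite -!cavgZ -cavgD; congr cavg; apply/funext => s; rewrite /cB'.
rewrite [LHS](_ : _ = (sin x * cos x) * (f s * ((\sum_(l < L) \sum_(l' < L)
   rcoef n l * rcoef n.+1 l' * \sum_(k < M) csign k * ccoef k (s l) * ccoef k (s l')) -
   beta ^+ 2 * (p - q) * \sum_(l < L) rcoef n l * crho (s l)))); last ring.
rewrite [RHS](_ : _ = (sin x * cos x) * (f s * (beta ^+ 2 * cW n s))); last ring.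
congr (_ * (_ * _)); rewrite /cW.
rewrite mulr_sumr mulr_sumr -sumrB; apply: eq_bigr => l _.
rewrite (bigD1 l)//= [in RHS](bigD1 l)//= sum_csign rcoef_diag /cdev eqxx [RHS]mulrDr [LHS]addrAC /crho; congr (_ + _).
  by ring.
rewrite mulr_sumr; apply: eq_bigr => l' ll'; rewrite sum_csign.
by rewrite eq_sym (negbTE ll'); ring.
Qed.

End CavityInterpolation.

(** * The decoupled site and its one-spin moments *)

Section DecoupledSite.
Context {R : realType}.
Variables (S L : nat) (beta h D p q : R).
Local Notation spinval := 'I_(S.*2.+1).

Definition senergy (eta : R) (k : spinval) : R :=
  beta * Num.sqrt q * eta * spin k + h * spin k + (D + beta ^+ 2 / 2 * (p - q)) * spin k ^+ 2.

Lemma savg_mj (j : nat) eta :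
  savg (senergy eta) (fun k => spin k ^+ j) = mj S beta h D p q j eta.
Proof.
rewrite /savg /mj /site_avg mulr_suml; apply: eq_bigr => k _.
by rewrite /wgt mulrA.
Qed.

Lemma mj0 eta : mj S beta h D p q 0 eta = 1.
Proof.
rewrite -savg_mj /savg; under eq_bigr do rewrite expr0 mul1r; exact: (sum_wgt ord0).
Qed.

Lemma tame1_avg_senergy (g : {ffun 'I_L -> spinval} -> R) : tame1 (fun eta => avg (senergy eta) g).
Proof.
apply/tame1_tame_id; apply: (@tame_avg _ _ ord0 L 1 (fun y => senergy (y 0%N)) (fun=> g)) => [t|s].
  apply: tameD; last exact: tame_cst.
  apply: tameD; last exact: tame_cst.
  apply: tameM; last exact: tame_cst.
  by apply: tameZ; exact: tame_coord.
exact: tame_cst.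
Qed.

Lemma tame1_mj j : tame1 (mj S beta h D p q j).
Proof.
rewrite (_ : mj S beta h D p q j = fun eta => savg (senergy eta) (fun k => spin k ^+ j)); last first.
  by apply/funext => eta; rewrite savg_mj.
apply/tame1_tame_id; apply: (@tame_savg _ _ ord0 1 (fun y => senergy (y 0%N)) (fun _ k => spin k ^+ j)) => t.
  apply: tameD; last exact: tame_cst.
  apply: tameD; last exact: tame_cst.
  apply: tameM; last exact: tame_cst.
  by apply: tameZ; exact: tame_coord.
exact: tame_cst.
Qed.

Lemma prod_count (T : finType) (F : T -> R) (r : seq T) :
  \prod_(j <- r) F j = \prod_j F j ^+ count_mem j r.
Proof.
elim: r => [|x r IH]; first by rewrite big_nil big1// => j _; rewrite expr0.
rewrite big_cons IH [in RHS](bigD1 x)//= [in LHS](bigD1 x)//= eqxx exprD expr1 -!mulrA.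
congr (_ * (_ * _)); apply: eq_bigr => j jx.
by rewrite eq_sym (negbTE jx).
Qed.

(** Mean, at the decoupled site, of the product of the spins of the replicas listed in [r]: given
    eta the replicas are independent, and each contributes the moment whose order is its
    multiplicity in [r]. *)
Definition mom (r : seq 'I_L) : R :=
  gaussE (fun eta => \prod_(l < L) mj S beta h D p q (count_mem l r) eta).

Lemma avg_senergy_prod (r : seq 'I_L) eta :
  avg (senergy eta) (fun e : {ffun 'I_L -> spinval} => \prod_(j <- r) spin (e j)) =
  \prod_(l < L) mj S beta h D p q (count_mem l r) eta.
Proof.
under eq_fun do rewrite prod_count.
rewrite (avg_prod _ (fun (l : 'I_L) (k : spinval) => spin k ^+ count_mem l r)).
by apply: eq_bigr => l _; rewrite savg_mj.
Qed.

Variables (N : nat) (i : 'I_N).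
Hypothesis N0 : (0 < N)%N.
Local Notation cfg := (config S N).
Local Notation M := (N * N)%N.

Definition restenergy (y : nat -> R) (sg : cfg) : R :=
  beta / Num.sqrt (N%:R) *
    (\sum_(a < N) \sum_(b < N | (a < b)%N && (a != i) && (b != i))
       y (a * N + b)%N * spin (sg a) * spin (sg b))
  + \sum_(j < N | j != i) (D * spin (sg j) ^+ 2 + h * spin (sg j)).

Lemma cenergy0 (y : nat -> R) sg :
  cenergy beta h D p q i (upd y M 0) sg = restenergy y sg + senergy (y (i * N + i)%N) (sg i).
Proof.
rewrite cenergyE// sin0 cos0 /cB cos0 /crho /cgam /restenergy /senergy.
rewrite !mulr_sumr [X in _ + (X + _)](bigD1 i)//= [X in _ + (_ + X)](bigD1 i)//=.
rewrite -mulr_sumr [in RHS]big_split /= .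
set X := \sum_(j < N | j != i) _; set Y := \sum_(j < N | j != i) _.
rewrite -mulr_sumr; set Z := \sum_(a < N) _; set Z' := \sum_(a < N) _.
suff -> : Z = Z' by ring.
apply: eq_bigr => a _; rewrite big_mkcond [RHS]big_mkcond; apply: eq_bigr => b _.
by case: (a < b)%N => //=; case: (a == i); case: (b == i) => /=; rewrite ?mul0r ?mul1r.
Qed.

Lemma restenergy_site (y : nat -> R) sg t : restenergy y (fupd sg i t) = restenergy y sg.
Proof.
rewrite /restenergy; congr (_ * _ + _).
  by apply: eq_bigr => a _; apply: eq_bigr => b /andP[/andP[_ ai] bi]; rewrite !fupd_neq.
by apply: eq_bigr => j ji; rewrite !fupd_neq.
Qed.

Lemma restenergy_upd (y : nat -> R) x sg : restenergy (upd y (i * N + i) x) sg = restenergy y sg.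
Proof.
rewrite /restenergy; congr (_ * _ + _); apply: eq_bigr => a _; apply: eq_bigr => b /andP[/andP[ab ai] bi].
rewrite upd_neq//; apply: contra ai => /eqP e.
by rewrite -val_eqE /= -(divn_pair N0 a b) e divn_pair.
Qed.

Lemma tame_restenergy sg : tame M (fun y => restenergy y sg).
Proof.
apply: tameD; last exact: tame_cst.
apply: tameZ; apply: tame_sum => a _; apply: tame_sum => b _.
do 2![apply: tameM; last exact: tame_cst]; apply: tame_coord.
by rewrite (leq_trans (n := a * N + N)) ?ltn_add2l// -mulSnr leq_mul2r ltn_ord orbT.
Qed.

Definition offsite (f : {ffun 'I_L -> cfg} -> R) := forall s e, f (setsite i s e) = f s.

(** At angle 0 the energy is a function of the other sites plus one of site i driven by the diagonal
    Gaussian. [avg_site] factorizes the Gibbs average, and since the rest does not contain that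
    Gaussian, [gaussEn_indep] factorizes the disorder average. *)
Lemma cavg0_site f (g : {ffun 'I_L -> spinval} -> R) : offsite f ->
  cavg beta h D p q i 0 (fun s => f s * g (site i s)) =
  cavg beta h D p q i 0 f * gaussE (fun eta => avg (senergy eta) g).
Proof.
move=> i_f; pose F y := avg (fun o : cfg => restenergy y o + 0) f.
have E1 y : avg (cenergy beta h D p q i (upd y M 0)) (fun s => f s * g (site i s)) =
    F y * avg (senergy (y (i * N + i)%N)) g.
  rewrite -(avg_site ord0 _ (fun=> 0) _ (restenergy_site y) i_f).
  by congr avg; apply/funext => o; rewrite cenergy0.
have E2 y : avg (cenergy beta h D p q i (upd y M 0)) f = F y.
  rewrite /F; have := avg_site ord0 (senergy (y (i * N + i)%N)) (fun=> 0) (fun=> 1) (restenergy_site y) i_f.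
  rewrite (avg_cst ord0) mulr1 => <-; congr avg; last by apply/funext => s; rewrite mulr1.
  by apply/funext => o; rewrite cenergy0.
have tF : tame M F.
  apply: (tame_avg [ffun=> ord0]) => [t|s]; last exact: tame_cst.
  by apply: tameD; [exact: tame_restenergy|exact: tame_cst].
transitivity (gaussEn M (fun y => F y * avg (senergy (y (i * N + i)%N)) g)).
  by congr gaussEn; apply/funext => y; rewrite -E1.
rewrite (gaussEn_indep _ tF (tame1_avg_senergy g)).
- by congr (_ * _); congr gaussEn; apply/funext => y; rewrite -E2.
- by rewrite (leq_trans (n := i * N + N)) ?ltn_add2l// -mulSnr leq_mul2r ltn_ord orbT.
- by move=> y x; congr avg; apply/funext => o; rewrite restenergy_upd.
Qed.

Lemma cavg0_mom f (r : seq 'I_L) : offsite f ->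
  cavg beta h D p q i 0 (fun s => f s * \prod_(j <- r) spin (s j i)) =
  cavg beta h D p q i 0 f * mom r.
Proof.
move=> i_f; rewrite /mom.
under [X in gaussE X]eq_fun do rewrite -avg_senergy_prod.
rewrite -cavg0_site//; congr (cavg _ _ _ _ _ _ _ _); apply/funext => s; congr (_ * _).
by apply: eq_bigr => j _; rewrite ffunE.
Qed.

End DecoupledSite.

Section RealCalculus.
Context {R : realType}.

Lemma is_derive_continuous (f f' : R -> R) : (forall x : R, is_derive x 1 f (f' x)) -> continuous f.
Proof.
by move=> df t; apply/differentiable_continuous/derivable1_diffP; have [] := df t.
Qed.

Lemma mean_value_le (f f' : R -> R) (a b K : R) : (forall x : R, is_derive x 1 f (f' x)) ->
  a <= b -> (forall x, a <= x <= b -> `|f' x| <= K) -> `|f b - f a| <= K * (b - a).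
Proof.
move=> df ab bf.
have [c] := MVT_segment ab (fun t _ => df t) (continuous_subspaceT (is_derive_continuous df)).
rewrite in_itv /= => cab ->; rewrite normrM (ger0_norm (_ : 0 <= b - a)) ?subr_ge0//.
by rewrite ler_wpM2r ?subr_ge0// bf.
Qed.

(** The hypothesis says that f(x) e^(K x) has a nonnegative derivative. The comparison runs from a
    to the right end b because the path ends at the model. *)
Lemma gronwall_le (f f' : R -> R) (a b K : R) : (forall x : R, is_derive x 1 f (f' x)) ->
  a <= b -> (forall x, a <= x <= b -> - K * f x <= f' x) -> f a <= expR (K * (b - a)) * f b.
Proof.
move=> df ab bf.
pose g (x : R) := f x * expR (K * x).
have dg (x : R) : is_derive x 1 g (f' x * expR (K * x) + f x * (K * expR (K * x))).
  by have := df x => ?; apply: is_derive_eq; rewrite /GRing.scale /=; ring.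
have [c] := MVT_segment ab (fun t _ => dg t) (continuous_subspaceT (is_derive_continuous dg)).
rewrite in_itv /= => cab E.
have : 0 <= g b - g a.
  rewrite E mulr_ge0 ?subr_ge0// (_ : _ + _ = (f' c + K * f c) * expR (K * c)); last ring.
  by rewrite mulr_ge0 ?expR_ge0//; have := bf c cab; lra.
rewrite subr_ge0 /g => gab.
rewrite mulrBr expRB mulrAC ler_pdivlMr ?expR_gt0//.
by rewrite [leRHS]mulrC.
Qed.

End RealCalculus.

(** * Bounds along the path, uniform in N *)

Section CavityEstimates.
Context {R : realType}.
Variables (S N : nat) (beta h D p q : R).
Hypotheses (N0 : (0 < N)%N) (b0 : 0 <= beta) (b1 : beta <= 1).
Local Notation sb := (S%:R ^+ 2 : R).
Hypotheses (q0 : 0 <= q) (qS : q <= sb) (pS : `|p| <= sb).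
Local Notation cfg := (config S N).
Local Notation reps := {ffun 'I_10 -> cfg}.
Implicit Types (f g : reps -> R) (s : reps) (x : R) (i : 'I_N) (a b c d l : 'I_10).
Local Notation cav := (cavg (L := 10) beta h D p q).
Local Notation W := (@cW R S N 10 p q).
Local Notation dev := (@cdev R S N 10 p q).

Lemma norm_spin (k : 'I_(S.*2.+1)) : `|spin k : R| <= S%:R.
Proof.
rewrite /spin ler_norml lerBlDr -natrD lerNl opprB.
rewrite [S%:R - _ <= _]lerBlDr lerDl ler0n /= ler_nat.
by rewrite addnn -ltnS.
Qed.

Lemma norm_spin2 (k k' : 'I_(S.*2.+1)) : `|spin k * spin k' : R| <= sb.
Proof. by rewrite normrM expr2 ler_pM// norm_spin. Qed.

Lemma norm_fixed l l' : `|if l == l' then p else q| <= sb.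
Proof. by case: ifP => _ //; rewrite ger0_norm. Qed.

Lemma norm_overlap i (sg tau : cfg) : `|overlap i sg tau : R| <= sb.
Proof.
rewrite /overlap normrM ger0_norm ?invr_ge0// mulrC ler_pdivrMr ?ltr0n//.
rewrite (le_trans (ler_norm_sum _ _ _))//.
apply: (@le_trans _ _ (\sum_(j < N) sb)); last by rewrite sumr_const card_ord mulr_natr.
rewrite big_mkcond; apply: ler_sum => j _; case: ifP => _; first exact: norm_spin2.
by rewrite exprn_ge0.
Qed.

Lemma norm_dev i s l l' : `|dev i s l l'| <= 2 * sb.
Proof.
rewrite /cdev (le_trans (ler_normB _ _))// mulrDl mul1r lerD ?norm_overlap//.
exact: norm_fixed.
Qed.

(* Each derivative along the interpolation brings in two new replicas; starting
   from at most six, eight of them carry the error terms. *)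
Definition devsum i s : R := \sum_(l < 10 | (l < 8)%N) \sum_(l' < 10 | (l' < 8)%N) `|dev i s l l'|.

Lemma devsum_ge0 i s : 0 <= devsum i s.
Proof. by apply: sumr_ge0 => l _; exact: sumr_ge0. Qed.

Lemma dev_le_devsum i s l l' : (l < 8)%N -> (l' < 8)%N -> `|dev i s l l'| <= devsum i s.
Proof.
move=> l8 l8'; rewrite /devsum (bigD1 l)//= (bigD1 l' l8')//= -addrA lerDl.
by rewrite addr_ge0 ?sumr_ge0// => j _; rewrite sumr_ge0.
Qed.

Lemma norm_rcoef n (l : nat) : (0 < n)%N -> `|rcoef n l : R| <= n%:R.
Proof.
move=> n0; rewrite /rcoef; case: ifP => _; first by rewrite normr1 ler1n.
by case: ifP => _; rewrite ?normrN ?normr_nat// normr0.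
Qed.

Lemma rcoef0 n (l : nat) : (n < l)%N -> rcoef n l = 0 :> R.
Proof. by move=> nl; rewrite /rcoef ltnNge (ltnW nl) /= gtn_eqF. Qed.

Lemma norm_W_le i n s l l' : (0 < n)%N ->
  `|rcoef n l * rcoef n.+1 l' * (spin (s l i) * spin (s l' i) * dev i s l l')| <=
  n%:R * n.+1%:R * sb * `|dev i s l l'|.
Proof.
move=> n0; rewrite 2!normrM [X in _ * X]normrM mulrA ler_wpM2r//.
by apply: ler_pM; rewrite ?norm_spin2//; apply: ler_pM; rewrite ?norm_rcoef.
Qed.

(** The coefficients are at most n (n + 1) <= 6 * 7 = 42 and vanish beyond replica n + 1 <= 7, so
    the eight replicas of [devsum] suffice. *)
Lemma norm_W i n s : (0 < n <= 6)%N -> `|W i n s| <= 42 * sb * devsum i s.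
Proof.
move=> /andP[n0 n6]; rewrite /cW (le_trans (ler_norm_sum _ _ _))//.
rewrite /devsum mulr_sumr [leRHS]big_mkcond; apply: ler_sum => l _ /=.
case: ifP => l8; last first.
  rewrite big1 ?normr0// => l' _; rewrite rcoef0 ?mul0r//.
  by move/negbT: l8; rewrite -leqNgt => l8; rewrite (leq_ltn_trans n6)// (leq_trans _ l8).
rewrite (le_trans (ler_norm_sum _ _ _))// mulr_sumr [leRHS]big_mkcond; apply: ler_sum => l' _ /=.
case: ifP => l8'; last first.
  by rewrite (@rcoef0 n.+1) ?mulr0 ?mul0r ?normr0//; move/negbT: l8'; rewrite -leqNgt; exact: leq_ltn_trans.
rewrite (le_trans (norm_W_le _ _ _ _ n0))// ler_wpM2r// ler_wpM2r ?exprn_ge0//.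
by rewrite -natrM ler_nat (leq_mul (n1 := 6) (n2 := 7)).
Qed.

(** One hundred pairs of replicas, each with coefficients at most 8 * 9, spins contributing at most
    S^2 and a deviation at most 2 S^2. *)
Definition KW8 : R := 10 * (10 * (144 * sb ^+ 2)).

Lemma KW8_ge0 : 0 <= KW8. Proof. by rewrite !mulr_ge0// exprn_ge0. Qed.

Lemma norm_W8 i s : `|W i 8 s| <= KW8.
Proof.
rewrite /cW (le_trans (ler_norm_sum _ _ _))//.
apply: (@le_trans _ _ (\sum_(l < 10) \sum_(l' < 10) 144 * sb ^+ 2)); last first.
  have E (c : R) : \sum_(l < 10) c = 10 * c by rewrite sumr_const card_ord mulr_natl.
  by rewrite !E.
apply: ler_sum => l _; rewrite (le_trans (ler_norm_sum _ _ _))// ler_sum// => l' _.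
rewrite (le_trans (norm_W_le _ _ _ _ _))//.
rewrite [leRHS](_ : _ = 8 * 9 * sb * (2 * sb)); last by ring.
by rewrite ler_wpM2l ?norm_dev// !mulr_ge0.
Qed.

Definition KG : R := expR (KW8 * 2).

Lemma KG_ge0 : 0 <= KG. Proof. exact: expR_ge0. Qed.

Lemma sincos_le1 x : `|sin x * cos x| <= 1.
Proof. by rewrite normrM mulr_ile1 ?norm_sin_le1 ?norm_cos_le1. Qed.

Lemma bsc_le1 x : `|beta ^+ 2 * (sin x * cos x)| <= beta ^+ 2.
Proof.
by rewrite normrM ger0_norm ?exprn_ge0// ler_piMr ?exprn_ge0 ?sincos_le1.
Qed.

Lemma cav_ge0 i x g : (forall s, 0 <= g s) -> 0 <= cav i x g.
Proof.
by move=> g0; have <- : cav i x (fun _ : reps => 0) = 0 by [exact: cavg_cst]; exact: cavg_le.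
Qed.

Lemma pihalf_le2 : pi / 2 <= 2 :> R.
Proof. exact/ltW/pihalf_lt2. Qed.

(** The derivative is at most [KW8] times the average itself because spins are bounded. The price
    [KG] is the exponential of [KW8] times 2, a bound for the length pi / 2 of the path. *)
Lemma cav_gronwall i x g : 0 <= x <= pi / 2 -> (forall s, 0 <= g s) -> depends_on 8 g ->
  cav i x g <= KG * cav i (pi / 2) g.
Proof.
move=> /andP[x0 xpi] g0 dg.
have dE t := is_derive_cavg beta h D p i N0 q0 t (isT : (8.+1 < 10)%N) dg.
apply: (@le_trans _ _ (expR (KW8 * (pi / 2 - x)) * cav i (pi / 2) g)).
  apply: (gronwall_le dE xpi) => t _.
  rewrite mulNr lerNl (le_trans (ler_norm _))// normrN normrM.
  apply: (@le_trans _ _ (1 * cav i t (fun s => `|g s * W i 8 s|))).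
    apply: ler_pM => //; last exact: cavg_abs.
    by rewrite (le_trans (bsc_le1 t))// exprn_ile1.
  rewrite mul1r -cavgZ//; apply: cavg_le => // s.
  by rewrite normrM ger0_norm// mulrC ler_wpM2r ?norm_W8.
apply: ler_wpM2r; first exact: cav_ge0.
rewrite /KG ler_expR; apply: ler_wpM2l; first exact: KW8_ge0.
by rewrite lerBlDr (le_trans pihalf_le2)// lerDl.
Qed.

End CavityEstimates.

(** Any relabeling of some replicas extends to a permutation of all of them: each new entry is
    corrected by a transposition that fixes the entries already placed. *)
Lemma exists_perm_map (T : finType) (r r' : seq T) : uniq r -> uniq r' -> size r = size r' ->
  exists pi : {perm T}, map pi r = r'.
Proof.
elim: r r' => [|x r IH] [|y r'] //=; first by exists 1%g.
move=> /andP[xr ur] /andP[yr ur'] [sz]; have [pi E] := IH _ ur ur' sz.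
exists (pi * tperm (pi x) y)%g; rewrite permM tpermL; congr (_ :: _).
rewrite -E; apply/eq_in_map => z zr; rewrite permM tpermD//.
  by apply: contraNneq xr => /perm_inj ->.
by apply: contraNneq yr => ->; rewrite -E map_f.
Qed.

Section DependsOn.
Context {R : realType} (Om : finType) (L : nat).
Implicit Types (f g : {ffun 'I_L -> Om} -> R) (n : nat).

Lemma fupd_low (s : {ffun 'I_L -> Om}) (l a : 'I_L) t n : (a < n)%N -> (n <= l)%N -> fupd s l t a = s a.
Proof.
move=> an nl; rewrite fupd_neq//; apply/eqP => E.
by have := leq_trans an nl; rewrite E ltnn.
Qed.

Lemma depends_on_le n n' f : (n <= n')%N -> depends_on n f -> depends_on n' f.
Proof. by move=> nn df s l t nl; rewrite df// (leq_trans nn). Qed.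

Lemma depends_onM n f g : depends_on n f -> depends_on n g -> depends_on n (fun s => f s * g s).
Proof. by move=> df dg s l t nl; rewrite df ?dg. Qed.

Lemma depends_on_comp n f (u : R -> R) : depends_on n f -> depends_on n (fun s => u (f s)).
Proof. by move=> df s l t nl; rewrite df. Qed.

Lemma depends_on_sum n (I : Type) (r : seq I) (P : pred I) (f : I -> {ffun 'I_L -> Om} -> R) :
  (forall j, P j -> depends_on n (f j)) -> depends_on n (fun s => \sum_(j <- r | P j) f j s).
Proof. by move=> df s l t nl; apply: eq_bigr => j Pj; exact: df. Qed.

End DependsOn.

(** * Expansion around the decoupled site *)

Section CavityExpansion.
Context {R : realType}.
Variables (S N : nat) (beta h D p q : R).
Hypotheses (N0 : (0 < N)%N) (b0 : 0 <= beta) (b1 : beta <= 1).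
Local Notation sb := (S%:R ^+ 2 : R).
Hypotheses (q0 : 0 <= q) (qS : q <= sb) (pS : `|p| <= sb).
Local Notation cfg := (config S N).
Local Notation reps := {ffun 'I_10 -> cfg}.
Implicit Types (f g : reps -> R) (s : reps) (x : R) (i : 'I_N) (a b c d l : 'I_10).
Local Notation cav := (cavg (L := 10) beta h D p q).
Local Notation W := (@cW R S N 10 p q).
Local Notation dev := (@cdev R S N 10 p q).
Local Notation dsum := (@devsum R S N p q).

Lemma depends_on_dev i n a b : (a < n)%N -> (b < n)%N -> depends_on n (fun s => dev i s a b).
Proof. by move=> an bn s l t nl; rewrite /cdev !(fupd_low _ _ _ nl). Qed.

Lemma depends_on_spin i n a : (a < n)%N -> depends_on n (fun s => spin (s a i) : R).
Proof. by move=> an s l t nl; rewrite (fupd_low _ _ an nl). Qed.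

Lemma depends_on_dsum i : depends_on 8 (dsum i).
Proof.
apply: depends_on_sum => l l8; apply: depends_on_sum => l' l8'.
by apply: depends_on_comp; exact: depends_on_dev.
Qed.

Lemma depends_on_W i n : depends_on n.+2 (W i n).
Proof.
apply: depends_on_sum => l _; apply: depends_on_sum => l' _.
have [nl|ln] := ltnP n l.
  by move=> s j t nj; rewrite rcoef0 ?mul0r.
have [nl'|ln'] := ltnP n.+1 l'.
  by move=> s j t nj; rewrite (@rcoef0 _ n.+1) ?mulr0 ?mul0r.
have l2 : (l < n.+2)%N by rewrite ltnS (leq_trans ln).
apply: depends_onM; first by [].
apply: depends_onM; last exact: depends_on_dev.
by apply: depends_onM; exact: depends_on_spin.
Qed.

(** 84 is 42, from [norm_W], times the bound 2 for the length of the path. *)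
Definition K1 : R := 84 * sb * KG S.
Definition K2 : R := 84 * sb * K1.

Lemma K1_ge0 : 0 <= K1.
Proof. by rewrite /K1 mulr_ge0 ?KG_ge0// mulr_ge0 ?exprn_ge0. Qed.

Lemma K2_ge0 : 0 <= K2.
Proof. by rewrite /K2 mulr_ge0 ?K1_ge0// mulr_ge0 ?exprn_ge0. Qed.

Lemma cav_W_le i x n f : (0 < n <= 6)%N ->
  `|cav i x (fun s => f s * W i n s)| <= 42 * sb * cav i x (fun s => `|f s| * dsum i s).
Proof.
move=> n6; rewrite -cavgZ//; apply: le_trans (cavg_abs _ _ _ _ _ _ _ _) _.
apply: cavg_le => // s; rewrite normrM mulrCA ler_wpM2l//.
exact: norm_W.
Qed.

(** Mean value theorem, with the average at the intermediate angle moved to pi / 2 by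
    [cav_gronwall]. The factor beta^2 is kept explicit, being the only source of smallness. *)
Lemma first_order i n f x : (0 < n <= 6)%N -> depends_on n f -> 0 <= x <= pi / 2 ->
  `|cav i x f - cav i 0 f| <= beta ^+ 2 * (K1 * cav i (pi / 2) (fun s => `|f s| * dsum i s)).
Proof.
move=> n6 df /andP[x0 xpi].
have nL : (n.+1 < 10)%N by case/andP: n6 => _ n6; rewrite ltnS (leq_ltn_trans n6).
have n8 : (n <= 8)%N by case/andP: n6 => _ /leq_trans; apply.
have dE t := is_derive_cavg beta h D p i N0 q0 t nL df.
set Q := cav i (pi / 2) _.
have Q0 : 0 <= Q by apply: cav_ge0 => // s; rewrite mulr_ge0 ?devsum_ge0.
have B0 : 0 <= beta ^+ 2 * (42 * sb * (KG S * Q)).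
  by rewrite !mulr_ge0 ?exprn_ge0 ?KG_ge0.
apply: (@le_trans _ _ (beta ^+ 2 * (42 * sb * (KG S * Q)) * (x - 0))).
  apply: (mean_value_le dE x0) => t /andP[t0 tx].
  rewrite normrM; apply: ler_pM => //; first exact: bsc_le1.
  apply: le_trans (cav_W_le _ _ _ n6) _.
  apply: ler_wpM2l; first by rewrite mulr_ge0 ?exprn_ge0.
  apply: cav_gronwall => //.
  - by rewrite t0 (le_trans tx).
  - by move=> s; rewrite mulr_ge0 ?devsum_ge0.
  - apply: depends_onM; last exact: depends_on_dsum.
    by apply: depends_on_comp; exact: depends_on_le df.
rewrite subr0; apply: (@le_trans _ _ (beta ^+ 2 * (42 * sb * (KG S * Q)) * 2)).
  by rewrite ler_wpM2l// (le_trans xpi)// pihalf_le2.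
by rewrite /K1 le_eqVlt; apply/orP; left; apply/eqP; ring.
Qed.

Lemma is_derive_sin2 (c x : R) : is_derive x 1 (fun t => c * (sin t * sin t)) (c * (2 * (sin x * cos x))).
Proof. by apply: is_derive_eq; rewrite /GRing.scale /=; ring. Qed.

(** The natural variable is sin^2, running from 0 to 1. Subtracting the linear term from the average
    leaves [psi], whose derivative contains the increment of the average of [f * W i 4]; this
    involves six replicas and is bounded by [first_order]. *)
Lemma second_order i f : depends_on 4 f ->
  `|cav i (pi / 2) f - cav i 0 f - beta ^+ 2 / 2 * cav i 0 (fun s => f s * W i 4 s)| <=
  K2 * cav i (pi / 2) (fun s => `|f s| * dsum i s ^+ 2).
Proof.
move=> df; set w := cav i 0 (fun s => f s * W i 4 s).
have dE t := is_derive_cavg beta h D p i N0 q0 t (isT : (4.+1 < 10)%N) df.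
pose psi (t : R) := cav i t f - (beta ^+ 2 / 2 * w) * (sin t * sin t).
have dpsi (t : R) : is_derive t 1 psi (beta ^+ 2 * (sin t * cos t) * (cav i t (fun s => f s * W i 4 s) - w)).
  have d1 := dE t; have d2 := is_derive_sin2 (beta ^+ 2 / 2 * w) t.
  apply: (@is_derive_eq _ _ _ _ _ _ _ _ (is_deriveB d1 d2)).
  by field.
have -> : cav i (pi / 2) f - cav i 0 f - beta ^+ 2 / 2 * w = psi (pi / 2) - psi 0.
  by rewrite /psi sin_pihalf sin0; ring.
set Q := cav i (pi / 2) (fun s => `|f s| * _).
have Q0 : 0 <= Q by apply: cav_ge0 => // s; rewrite mulr_ge0 ?exprn_ge0 ?devsum_ge0.
have pi0 : 0 <= pi / 2 :> R by rewrite divr_ge0 ?pi_ge0.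
have B0 : 0 <= K1 * (42 * sb * Q).
  by apply: mulr_ge0; [exact: K1_ge0|rewrite mulr_ge0// mulr_ge0// exprn_ge0].
apply: (@le_trans _ _ (K1 * (42 * sb * Q) * (pi / 2 - 0))).
  apply: (mean_value_le dpsi pi0) => t tpi.
  rewrite normrM -[leRHS]mul1r; apply: ler_pM => //.
    by rewrite (le_trans (bsc_le1 b0 t))// exprn_ile1.
  have df6 : depends_on 6 (fun s => f s * W i 4 s).
    by apply: depends_onM; [exact: depends_on_le df|exact: depends_on_W].
  apply: le_trans (first_order i (isT : (0 < 6 <= 6)%N) df6 tpi) _.
  have I0 : 0 <= K1 * cav i (pi / 2) (fun s => `|f s * W i 4 s| * dsum i s).
    by rewrite mulr_ge0 ?K1_ge0// cav_ge0// => s; rewrite mulr_ge0 ?devsum_ge0.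
  apply: (@le_trans _ _ (1 * (K1 * cav i (pi / 2) (fun s => `|f s * W i 4 s| * dsum i s)))).
    by rewrite ler_wpM2r// exprn_ile1.
  rewrite mul1r; apply: ler_wpM2l; first exact: K1_ge0.
  rewrite -cavgZ//; apply: cavg_le => // s.
  rewrite normrM mulrCA -mulrA; apply: ler_wpM2l => //.
  rewrite (_ : 42 * sb * dsum i s ^+ 2 = 42 * sb * dsum i s * dsum i s); last by ring.
  by apply: ler_wpM2r; [exact: devsum_ge0|exact: norm_W].
rewrite subr0; apply: (@le_trans _ _ (K1 * (42 * sb * Q) * 2)).
  by apply: ler_wpM2l => //; exact: pihalf_le2.
by rewrite /K2 le_eqVlt; apply/orP; left; apply/eqP; ring.
Qed.

End CavityExpansion.

(** * Concentration of the overlaps *)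

Section PowerMean.
Context {R : realType}.

Lemma sqr_sum_le (I : Type) (r : seq I) (P : pred I) (F : I -> R) (k : nat) :
  (count P r <= k)%N ->
  (\sum_(j <- r | P j) F j) ^+ 2 <= k%:R * \sum_(j <- r | P j) F j ^+ 2.
Proof.
elim: r k => [|x r IH] k; first by rewrite !big_nil expr0n /= mulr0.
rewrite /= !big_cons; case: (P x) => /=; last by rewrite add0n; exact: IH.
case: k => // k; rewrite add1n ltnS => /IH.
set a := F x; set X := \sum_(j <- r | _) _; set Y := \sum_(j <- r | _) _ => XY.
have Y0 : 0 <= Y by apply: sumr_ge0 => j _; exact: sqr_ge0.
case: k XY => [|k] XY.
  (* No further term is counted, and the induction hypothesis with factor 0 forces the remaining sum
     to vanish. *)
  have X0 : X = 0 by apply/eqP; rewrite -sqrf_eq0 eq_le sqr_ge0 andbT; rewrite mul0r in XY.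
  by rewrite X0 addr0 mul1r lerDl.
have k0 : 0 < k.+1%:R :> R by rewrite ltr0n.
move: XY k0; rewrite -(natr1 k.+1); set t : R := k.+1%:R => XY k0.
have XY' : X ^+ 2 / t <= Y by rewrite ler_pdivrMr// mulrC.
have E : (a + X) ^+ 2 = (t + 1) * a ^+ 2 + (t + 1) * (X ^+ 2 / t) - (t * a - X) ^+ 2 / t.
  by field; rewrite gt_eqF.
rewrite E [leRHS]mulrDr; have : 0 <= (t * a - X) ^+ 2 / t by rewrite divr_ge0 ?sqr_ge0// ltW.
have : (t + 1) * (X ^+ 2 / t) <= (t + 1) * Y by rewrite ler_wpM2l// addr_ge0// ltW.
by move=> BD C0; rewrite -addrA lerD2l (le_trans _ BD)// gerBl.
Qed.

End PowerMean.

Section DisorderAverage.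
Context {R : realType}.
Variables (S N : nat) (beta h D : R).
Hypothesis N0 : (0 < N)%N.
Local Notation reps := {ffun 'I_10 -> config S N}.
Implicit Types (f g : reps -> R) (x : R).

Definition nuR f : R := gaussEn (N * N) (fun y => avg (hamil beta h D y) f).

Lemma cav_nuR p q (i : 'I_N) f : cavg beta h D p q i (pi / 2) f = nuR f.
Proof. exact: cavg_end. Qed.

(** At angle pi / 2 the path is the model whatever p, q and the site are; with any choice of them
    the properties of [cavg] carry over to [nuR]. *)
Let cavE := cav_nuR 0 0 (Ordinal N0).

Lemma nuRD f g : nuR (fun s => f s + g s) = nuR f + nuR g.
Proof. by rewrite -!cavE cavgD. Qed.

Lemma nuRZ x f : nuR (fun s => x * f s) = x * nuR f.
Proof. by rewrite -!cavE cavgZ. Qed.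

Lemma nuR_cst x : nuR (fun=> x) = x.
Proof. by rewrite -!cavE cavg_cst. Qed.

Lemma nuR_sum (I : Type) (r : seq I) (P : pred I) (f : I -> reps -> R) :
  nuR (fun s => \sum_(j <- r | P j) f j s) = \sum_(j <- r | P j) nuR (f j).
Proof. by rewrite -cavE cavg_sum; apply: eq_bigr => j _; rewrite cavE. Qed.

Lemma nuR_le f g : (forall s, f s <= g s) -> nuR f <= nuR g.
Proof. by rewrite -!cavE; exact: cavg_le. Qed.

Lemma nuR_abs f : `|nuR f| <= nuR (fun s => `|f s|).
Proof. by rewrite -!cavE; exact: cavg_abs. Qed.

Lemma nuR_ge0 f : (forall s, 0 <= f s) -> 0 <= nuR f.
Proof. by move=> f0; rewrite -(nuR_cst 0); exact: nuR_le. Qed.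

Lemma nuR_perm (pi : {perm 'I_10}) f : nuR (fun s => f [ffun l => s (pi l)]) = nuR f.
Proof. by rewrite -!cavE; exact: cavg_perm. Qed.

End DisorderAverage.

Section SecondMoments.
Context {R : realType}.
Variables (S N : nat) (beta h D p q : R).
Hypotheses (N0 : (0 < N)%N) (b0 : 0 <= beta) (b1 : beta <= 1).
Local Notation sb := (S%:R ^+ 2 : R).
Hypotheses (q0 : 0 <= q) (qS : q <= sb) (pS : `|p| <= sb).
Hypothesis fp : fixed_point S beta h D p q.
Local Notation cfg := (config S N).
Local Notation reps := {ffun 'I_10 -> cfg}.
Implicit Types (f g : reps -> R) (s : reps) (x : R) (i : 'I_N) (a b c d l : 'I_10).
Local Notation cav := (cavg (L := 10) beta h D p q).
Local Notation dev := (@cdev R S N 10 p q).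
Local Notation dsum := (@devsum R S N p q).
Local Notation n := (N%:R : R).
Local Notation nuR := (@nuR R S N beta h D).

Definition rpq a b : R := if a == b then p else q.
Definition xx a b s : R := n^-1 * (\sum_(j < N) spin (s a j) * spin (s b j)) - rpq a b.

Lemma n_gt0 : 0 < n. Proof. by rewrite ltr0n. Qed.

Lemma xx_dev i s a b : xx a b s = dev i s a b + n^-1 * (spin (s a i) * spin (s b i)).
Proof. by rewrite /xx /cdev /overlap /rpq (bigD1 i)//= mulrDr; ring. Qed.

Lemma xx_site s a b : xx a b s = n^-1 * \sum_(i < N) (spin (s a i) * spin (s b i) - rpq a b).
Proof.
rewrite /xx sumrB mulrBr sumr_const card_ord -[rpq a b *+ N]mulr_natl mulKf//.
by rewrite gt_eqF ?n_gt0.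
Qed.

Lemma xxC s a b : xx a b s = xx b a s.
Proof.
rewrite /xx /rpq eq_sym; congr (_ * _ - _); apply: eq_bigr => j _; exact: mulrC.
Qed.

Lemma xx_perm (pi : {perm 'I_10}) s a b : xx a b [ffun l => s (pi l)] = xx (pi a) (pi b) s.
Proof.
rewrite /xx /rpq (inj_eq perm_inj); congr (_ * _ - _).
by apply: eq_bigr => j _; rewrite !ffunE.
Qed.

(** The two fixed-point equations in replica language: the moment is E m_2 = p for one replica taken
    twice and E m_1^2 = q for two distinct ones. *)
Lemma mom2 a b : mom S beta h D p q [:: a; b] = rpq a b.
Proof.
have [hq hp] := fp; rewrite /mom /rpq; have [->|ab] := eqVneq a b.
  rewrite [RHS]hp; congr gaussE; apply/funext => eta.
  rewrite (bigD1 b)//= eqxx big1 ?mulr1// => l lb.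
  by rewrite eq_sym (negbTE lb) mj0.
rewrite [RHS]hq; congr gaussE; apply/funext => eta.
have ba : b == a = false by rewrite eq_sym (negbTE ab).
rewrite (bigD1 a)//= (bigD1 b) ?ba//= !eqxx (negbTE ab) big1 ?mulr1 ?expr2//.
by move=> l /andP[la lb]; rewrite ![_ == l]eq_sym (negbTE la) (negbTE lb) mj0.
Qed.

Lemma offsite_dev i a b : offsite i (fun s => dev i s a b).
Proof.
move=> s e; rewrite /cdev /overlap; congr (_ * _ - _); apply: eq_bigr => j ji.
by rewrite !ffunE (negbTE ji).
Qed.

(* The fixed-point equations make the decoupled site centred. *)
Lemma cav0_centered i a b f : offsite i f ->
  cav i 0 (fun s => (spin (s a i) * spin (s b i) - rpq a b) * f s) = 0.
Proof.
move=> of_; have h1 := @cavg0_mom _ S 10 beta h D p q N i N0 f [:: a; b] of_.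
rewrite (_ : (fun s => _) = (fun s => f s * (\prod_(j <- [:: a; b]) spin (s j i)) + - rpq a b * f s)).
  by rewrite cavgD cavgZ h1 mom2; ring.
by apply/funext => s; rewrite !big_cons big_nil mulr1; ring.
Qed.

Lemma norm_rpq a b : `|rpq a b| <= sb.
Proof. exact: norm_fixed. Qed.

Lemma norm_center i s a b : `|spin (s a i) * spin (s b i) - rpq a b| <= 2 * sb.
Proof.
by rewrite (le_trans (ler_normB _ _))// [leRHS]mulrDl mul1r lerD ?norm_spin2 ?norm_rpq.
Qed.

Lemma cav_first_order i a b (G : R -> R) : (a < 4)%N -> (b < 4)%N ->
  `|nuR (fun s => (spin (s a i) * spin (s b i) - rpq a b) * G (dev i s a b))| <=
  beta ^+ 2 * (K1 S * (2 * sb * nuR (fun s => `|G (dev i s a b)| * dsum i s))).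
Proof.
move=> a4 b4; set f := fun s : reps => _.
have df : depends_on 4 f.
  apply: depends_onM; last by apply: depends_on_comp; exact: depends_on_dev.
  move=> s l t nl; congr (_ - _).
  by rewrite !(fupd_low _ _ _ nl).
have z0 : cav i 0 f = 0.
  by apply: cav0_centered => s e /=; rewrite offsite_dev.
have pi0 : (0 : R) <= (pi / 2 : R) <= (pi / 2 : R) by rewrite divr_ge0 ?pi_ge0//=.
have := first_order h D N0 b0 b1 q0 qS pS i (isT : (0 < 4 <= 6)%N) df pi0.
rewrite z0 subr0 !(cav_nuR _ _ _ N0) => /le_trans; apply.
rewrite ler_wpM2l ?exprn_ge0// ler_wpM2l ?K1_ge0// -(nuRZ _ _ _ N0); apply: (nuR_le _ _ _ N0) => s.
rewrite normrM mulrA ler_wpM2r ?devsum_ge0// ler_wpM2r//; exact: norm_center.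
Qed.

End SecondMoments.

Section OverlapMoments.
Context {R : realType}.
Variables (S N : nat) (beta h D p q : R).
Hypotheses (N0 : (0 < N)%N) (b0 : 0 <= beta) (b1 : beta <= 1).
Local Notation sb := (S%:R ^+ 2 : R).
Hypotheses (q0 : 0 <= q) (qS : q <= sb) (pS : `|p| <= sb).
Hypothesis fp : fixed_point S beta h D p q.
Local Notation cfg := (config S N).
Local Notation reps := {ffun 'I_10 -> cfg}.
Implicit Types (f g : reps -> R) (s : reps) (x : R) (i : 'I_N) (a b c d l : 'I_10).
Local Notation dev := (@cdev R S N 10 p q).
Local Notation dsum := (@devsum R S N p q).
Local Notation n := (N%:R : R).
Local Notation nu_ := (@nuR R S N beta h D).
Local Notation xx_ := (@xx R S N p q).

Lemma count_lt8 : (count (fun l : 'I_10 => (l < 8)%N) (index_enum 'I_10) <= 8)%N.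
Proof. by rewrite -sum1_count big_mkcond !big_ord_recl big_ord0. Qed.

Lemma dsum_sqr_le i s :
  dsum i s ^+ 2 <= 8 * \sum_(l < 10 | (l < 8)%N) (8 * \sum_(l' < 10 | (l' < 8)%N) dev i s l l' ^+ 2).
Proof.
rewrite (le_trans (sqr_sum_le _ count_lt8))// ler_wpM2l// ler_sum// => l _.
rewrite (le_trans (sqr_sum_le _ count_lt8))// ler_wpM2l// ler_sum// => l' _.
by rewrite real_normK ?num_real.
Qed.

Lemma dsum_pow4_le i s :
  dsum i s ^+ 4 <= (8 * 8) ^+ 2 * (8 * \sum_(l < 10 | (l < 8)%N) (8 * \sum_(l' < 10 | (l' < 8)%N) dev i s l l' ^+ 4)).
Proof.
rewrite (_ : dsum i s ^+ 4 = (dsum i s ^+ 2) ^+ 2); last by rewrite -exprM.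
have D2 := dsum_sqr_le i s.
apply: (@le_trans _ _ ((8 * \sum_(l < 10 | (l < 8)%N) (8 * \sum_(l' < 10 | (l' < 8)%N) dev i s l l' ^+ 2)) ^+ 2)).
  by rewrite ler_sqr// nnegrE ?sqr_ge0// (le_trans _ D2)// sqr_ge0.
rewrite -mulr_sumr mulrA exprMn ler_wpM2l ?exprn_ge0//.
rewrite (le_trans (sqr_sum_le _ count_lt8))// ler_wpM2l// ler_sum// => l _.
rewrite (le_trans (sqr_sum_le _ count_lt8))// ler_wpM2l// ler_sum// => l' _.
by rewrite -exprM.
Qed.

Lemma sum_lt8_le (F : 'I_10 -> R) (m : R) : (forall l, F l <= m) ->
  \sum_(l < 10 | (l < 8)%N) F l <= 8 * m.
Proof.
move=> Fm; apply: le_trans (ler_sum _ (fun l _ => Fm l)) _.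
by rewrite big_mkcond !big_ord_recl big_ord0 /= !addr0 le_eqVlt; apply/orP; left; apply/eqP; ring.
Qed.

Lemma correction_le i s a b : `|n^-1 * (spin (s a i) * spin (s b i))| <= sb / n.
Proof.
by rewrite normrM ger0_norm ?invr_ge0// mulrC ler_wpM2r ?invr_ge0// norm_spin2.
Qed.

Lemma dev_sqr_le i s a b : dev i s a b ^+ 2 <= 2 * xx_ a b s ^+ 2 + 2 * (sb / n) ^+ 2.
Proof.
have := correction_le i s a b; rewrite (xx_dev p q i s a b).
set e := n^-1 * _; set d := dev i s a b; move=> eb.
have : e ^+ 2 <= (sb / n) ^+ 2.
  by rewrite -(real_normK (num_real e)) ler_sqr ?nnegrE// (le_trans _ eb).
by have := sqr_ge0 (d + 2 * e); nra.
Qed.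

Lemma dev_pow4_le i s a b : dev i s a b ^+ 4 <= 8 * xx_ a b s ^+ 4 + 8 * (sb / n) ^+ 4.
Proof.
have H := dev_sqr_le i s a b.
rewrite (_ : dev i s a b ^+ 4 = (dev i s a b ^+ 2) ^+ 2); last by rewrite -exprM.
apply: (@le_trans _ _ ((2 * xx_ a b s ^+ 2 + 2 * (sb / n) ^+ 2) ^+ 2)).
  by rewrite ler_sqr ?nnegrE ?sqr_ge0// (le_trans _ H)// sqr_ge0.
move: (xx_ a b s) (sb / n) => u v; have := sqr_ge0 (u ^+ 2 - v ^+ 2); nra.
Qed.

Lemma nu_dsum2_le i m : (forall l l', nu_ (fun s => xx_ l l' s ^+ 2) <= m) ->
  nu_ (fun s => dsum i s ^+ 2) <= 8 * (8 * (8 * (8 * (2 * m + 2 * (sb / n) ^+ 2)))).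
Proof.
move=> H; apply: le_trans (nuR_le beta h D N0 (dsum_sqr_le i)) _.
rewrite nuRZ// nuR_sum//; apply: ler_wpM2l => //; apply: sum_lt8_le => l.
rewrite nuRZ// nuR_sum//; apply: ler_wpM2l => //; apply: sum_lt8_le => l'.
apply: le_trans (nuR_le beta h D N0 (fun s => dev_sqr_le i s l l')) _.
by rewrite nuRD// nuRZ// nuR_cst// lerD2r ler_wpM2l.
Qed.

Lemma nu_dsum4_le i m : (forall l l', nu_ (fun s => xx_ l l' s ^+ 4) <= m) ->
  nu_ (fun s => dsum i s ^+ 4) <= (8 * 8) ^+ 2 * (8 * (8 * (8 * (8 * (8 * m + 8 * (sb / n) ^+ 4))))).
Proof.
move=> H; apply: le_trans (nuR_le beta h D N0 (dsum_pow4_le i)) _.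
rewrite nuRZ//; apply: ler_wpM2l; first by rewrite exprn_ge0.
rewrite nuRZ// nuR_sum//; apply: ler_wpM2l => //; apply: sum_lt8_le => l.
rewrite nuRZ// nuR_sum//; apply: ler_wpM2l => //; apply: sum_lt8_le => l'.
apply: le_trans (nuR_le beta h D N0 (fun s => dev_pow4_le i s l l')) _.
by rewrite nuRD// nuRZ// nuR_cst// lerD2r ler_wpM2l.
Qed.

Definition r0 : 'I_10 := ord0.
Definition r1 : 'I_10 := Ordinal (isT : (1 < 10)%N).

Lemma nu_xx_sym (G : R -> R) l l' : nu_ (fun s => G (xx_ l l' s)) =
  if l == l' then nu_ (fun s => G (xx_ r0 r0 s)) else nu_ (fun s => G (xx_ r0 r1 s)).
Proof.
case: eqVneq => [<-|ll'].
  rewrite -[RHS](nuR_perm beta h D N0 (tperm r0 l)).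
  by congr nuR; apply/funext => s; rewrite xx_perm tpermL.
have [pi [E1 E2]] : exists pi : {perm 'I_10}, [seq pi z | z <- [:: r0; r1]] = [:: l; l'].
  by apply: exists_perm_map => //=; rewrite inE ll'.
rewrite -[RHS](nuR_perm beta h D N0 pi) -E1 -E2.
by congr nuR; apply/funext => s; rewrite xx_perm.
Qed.

(** By replica symmetry there are only two kinds of pairs; their sum is the single number for which
    the moment estimates close. *)
Lemma nu_pow_le k l l' : (~~ odd k) -> nu_ (fun s => xx_ l l' s ^+ k) <=
  nu_ (fun s => xx_ r0 r1 s ^+ k) + nu_ (fun s => xx_ r0 r0 s ^+ k).
Proof.
move=> ek; rewrite (nu_xx_sym (fun z => z ^+ k)).
have H u v : 0 <= nu_ (fun s => xx_ u v s ^+ k).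
  by apply: nuR_ge0 => // s; rewrite exprn_even_ge0.
by case: eqP => _; rewrite ?lerDl ?lerDr.
Qed.

Lemma average_le (X : 'I_N -> R) (m : R) : (forall i, X i <= m) -> n^-1 * \sum_i X i <= m.
Proof.
move=> Xm; rewrite mulrC ler_pdivrMr ?ltr0n//.
by apply: le_trans (ler_sum _ (fun i _ => Xm i)) _; rewrite sumr_const card_ord mulr_natr.
Qed.

Lemma nu_xx_mul a b (G : reps -> R) : nu_ (fun s => xx_ a b s * G s) =
  n^-1 * \sum_i nu_ (fun s => (spin (s a i) * spin (s b i) - rpq p q a b) * G s).
Proof.
rewrite -nuR_sum// -nuRZ//; congr nuR; apply/funext => s.
by rewrite xx_site// -mulrA mulr_suml.
Qed.

(** The factor with which one cavity step bounds a moment of the overlaps by a moment of [devsum] of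
    the same order. *)
Definition kap : R := beta ^+ 2 * (K1 S * (2 * sb)).

Lemma kap_ge0 : 0 <= kap.
Proof.
apply: mulr_ge0; first exact: exprn_ge0.
apply: mulr_ge0; first exact: K1_ge0.
by rewrite mulr_ge0// exprn_ge0.
Qed.

Lemma sb0 : 0 <= sb. Proof. exact: exprn_ge0. Qed.

(** One factor is expanded over the sites. Against the part of the other factor free of site i the
    cavity step applies; the contribution of site i itself is of order 1/N. *)
Lemma nu_xx2_le a b m : (a < 4)%N -> (b < 4)%N -> (forall i, nu_ (fun s => dsum i s ^+ 2) <= m) ->
  nu_ (fun s => xx_ a b s ^+ 2) <= kap * m + 2 * sb * (sb / n).
Proof.
move=> a4 b4 Hm; under eq_fun do rewrite expr2.
rewrite nu_xx_mul; apply: average_le => i.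
rewrite (_ : (fun s => _) = (fun s => (spin (s a i) * spin (s b i) - rpq p q a b) * dev i s a b +
   (spin (s a i) * spin (s b i) - rpq p q a b) * (n^-1 * (spin (s a i) * spin (s b i))))); last first.
  by apply/funext => s; rewrite (xx_dev p q i s a b) mulrDr.
have a8 : (a < 8)%N by exact: leq_trans a4 _. have b8 : (b < 8)%N by exact: leq_trans b4 _.
rewrite nuRD//; apply: lerD.
  apply: le_trans (ler_norm _) _.
  apply: le_trans (cav_first_order N0 b0 b1 q0 qS pS fp i id a4 b4) _.
  rewrite [kap * m](_ : _ = beta ^+ 2 * (K1 S * (2 * sb * m))); last by rewrite /kap; ring.
  apply: ler_wpM2l; first exact: exprn_ge0.
  apply: ler_wpM2l; first exact: K1_ge0.
  apply: ler_wpM2l; first by rewrite mulr_ge0 ?sb0.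
  apply: le_trans (Hm i); apply: nuR_le => // s.
  by rewrite expr2 ler_wpM2r ?devsum_ge0// dev_le_devsum.
rewrite -[leRHS](nuR_cst S beta h D N0); apply: nuR_le => // s.
apply: le_trans (ler_norm _) _; rewrite normrM; apply: ler_pM => //.
  exact: (norm_center q0 qS pS).
exact: correction_le.
Qed.

(** One factor is expanded against the cube of the others. Removing site i from the cube costs 1/N
    times second moments, themselves of order 1/N, so the error is of order N^-2. *)
Lemma nu_xx4_le a b m m2 : (a < 4)%N -> (b < 4)%N -> (forall i, nu_ (fun s => dsum i s ^+ 4) <= m) ->
  nu_ (fun s => xx_ a b s ^+ 2) <= m2 ->
  nu_ (fun s => xx_ a b s ^+ 4) <= kap * m + 2 * sb * ((sb / n) * (5 * m2 + 3 * (sb / n) ^+ 2)).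
Proof.
move=> a4 b4 Hm Hm2; under eq_fun do rewrite exprS.
rewrite nu_xx_mul; apply: average_le => i.
rewrite (_ : (fun s => _) = (fun s => (spin (s a i) * spin (s b i) - rpq p q a b) * dev i s a b ^+ 3 +
   (spin (s a i) * spin (s b i) - rpq p q a b) * (xx_ a b s ^+ 3 - dev i s a b ^+ 3))); last first.
  by apply/funext => s; rewrite -mulrDr subrKC.
have a8 : (a < 8)%N by exact: leq_trans a4 _. have b8 : (b < 8)%N by exact: leq_trans b4 _.
have sn0 : 0 <= sb / n by rewrite divr_ge0 ?sb0.
rewrite nuRD//; apply: lerD.
  apply: le_trans (ler_norm _) _.
  apply: le_trans (cav_first_order N0 b0 b1 q0 qS pS fp i (fun z => z ^+ 3) a4 b4) _.
  rewrite [kap * m](_ : _ = beta ^+ 2 * (K1 S * (2 * sb * m))); last by rewrite /kap; ring.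
  apply: ler_wpM2l; first exact: exprn_ge0.
  apply: ler_wpM2l; first exact: K1_ge0.
  apply: ler_wpM2l; first by rewrite mulr_ge0 ?sb0.
  apply: le_trans (Hm i); apply: nuR_le => // s.
  rewrite [leRHS]exprSr ler_wpM2r ?devsum_ge0// normrX lerXn2r ?nnegrE ?devsum_ge0//.
  exact: dev_le_devsum.
apply: (@le_trans _ _ (nu_ (fun s => 2 * sb * ((sb / n) * (5 * xx_ a b s ^+ 2 + 3 * (sb / n) ^+ 2))))).
  apply: nuR_le => // s; apply: le_trans (ler_norm _) _; rewrite normrM; apply: ler_pM => //.
    exact: (norm_center q0 qS pS).
  have := correction_le i s a b; rewrite (xx_dev p q i s a b).
  set e := n^-1 * _; set d := dev i s a b; set v := sb / n => ev.
  have -> : (d + e) ^+ 3 - d ^+ 3 = e * ((d + e) ^+ 2 + (d + e) * d + d ^+ 2) by ring.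
  rewrite normrM; apply: ler_pM => //.
  have e2 : e ^+ 2 <= v ^+ 2.
    by rewrite -(real_normK (num_real e)) ler_sqr ?nnegrE// (le_trans _ ev).
  rewrite ger0_norm; first by have := sqr_ge0 (d + 3 * e); have := sqr_ge0 (d + e); nra.
  by have := sqr_ge0 (d + e + d); have := sqr_ge0 (d + e); have := sqr_ge0 d; nra.
rewrite !nuRZ// nuRD// nuRZ// nuR_cst//.
by rewrite ler_wpM2l ?mulr_ge0 ?sb0// ler_wpM2l// lerD2r ler_wpM2l.
Qed.

End OverlapMoments.

Section Concentration.
Context {R : realType}.
(** Cost of Cauchy-Schwarz and of the number of terms for the eight-by-eight sum [devsum], squared;
    for [c4], raised to the fourth power. *)
Definition c2 : R := 8 * (8 * (8 * 8)).
Definition c4 : R := (8 * 8) ^+ 2 * c2.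

(** Here t stands for S^2, v for 1/N, and the two equal summands are the two kinds of pairs. At most
    half of m sits on the right and is absorbed; 9 = 2 (1/2 + 4). *)
Lemma absorb_second (k t v m : R) : 0 <= k -> k * 4 <= 2^-1 -> 0 <= m -> 0 <= v -> v <= 1 ->
  m <= (k * (2 * m + 2 * (t * v) ^+ 2) + 2 * t * (t * v)) +
       (k * (2 * m + 2 * (t * v) ^+ 2) + 2 * t * (t * v)) -> m <= 9 * t ^+ 2 * v.
Proof.
move=> k0 k4 m0 v0 v1 H.
have h1 : k * 4 * m <= 2^-1 * m by rewrite ler_wpM2r.
have T0 : 0 <= t ^+ 2 * v by rewrite mulr_ge0 ?sqr_ge0.
have h2 : k * 4 * (t ^+ 2 * v) <= 2^-1 * (t ^+ 2 * v) by rewrite ler_wpM2r.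
have h3 : k * 4 * (t ^+ 2 * v * v) <= k * 4 * (t ^+ 2 * v).
  by rewrite ler_wpM2l ?mulr_ge0// ler_piMr.
lra.
Qed.

(** The same absorption, with the second-moment bound already inserted; 385 = 2 (1/2 + 180 + 12). *)
Lemma absorb_fourth (k t v m : R) : 0 <= k -> k * 16 <= 2^-1 -> 0 <= m -> 0 <= v -> v <= 1 ->
  m <= (k * (8 * m + 8 * (t * v) ^+ 4) + 2 * t * (t * v * (5 * (9 * t ^+ 2 * v) + 3 * (t * v) ^+ 2))) +
       (k * (8 * m + 8 * (t * v) ^+ 4) + 2 * t * (t * v * (5 * (9 * t ^+ 2 * v) + 3 * (t * v) ^+ 2))) ->
  m <= 385 * (t ^+ 4 * v ^+ 2).
Proof.
move=> k0 k4 m0 v0 v1 H.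
have h1 : k * 16 * m <= 2^-1 * m by rewrite ler_wpM2r.
set T := t ^+ 4 * v ^+ 2.
have T0 : 0 <= T by rewrite mulr_ge0 ?exprn_even_ge0.
have h2 : k * 16 * T <= 2^-1 * T by rewrite ler_wpM2r.
have h3 : k * 16 * (T * v ^+ 2) <= k * 16 * T.
  by rewrite ler_wpM2l ?mulr_ge0// ler_piMr// exprn_ile1.
have h4 : T * v <= T by rewrite ler_piMr.
have E : (k * (8 * m + 8 * (t * v) ^+ 4) + 2 * t * (t * v * (5 * (9 * t ^+ 2 * v) + 3 * (t * v) ^+ 2))) +
       (k * (8 * m + 8 * (t * v) ^+ 4) + 2 * t * (t * v * (5 * (9 * t ^+ 2 * v) + 3 * (t * v) ^+ 2))) =
   k * 16 * m + k * 16 * (T * v ^+ 2) + 180 * T + 12 * (T * v) by rewrite /T; ring.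
rewrite E in H; lra.
Qed.

Lemma c2_ge1 : 1 <= c2. Proof. by rewrite /c2; lra. Qed.

Lemma c2_le_c4 : c2 <= c4.
Proof.
rewrite /c4 ler_peMl ?(le_trans _ c2_ge1)// exprn_ege1//; lra.
Qed.

Variables (S N : nat) (beta h D p q : R).
Hypotheses (N0 : (0 < N)%N) (b0 : 0 <= beta) (b1 : beta <= 1).
Local Notation sb := (S%:R ^+ 2 : R).
Hypotheses (q0 : 0 <= q) (qS : q <= sb) (pS : `|p| <= sb).
Hypothesis fp : fixed_point S beta h D p q.
Hypothesis small : kap S beta * (16 * c4) <= 2^-1.
Local Notation cfg := (config S N).
Local Notation reps := {ffun 'I_10 -> cfg}.
Implicit Types (f g : reps -> R) (s : reps) (x : R) (i : 'I_N) (a b c d l : 'I_10).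
Local Notation dsum := (@devsum R S N p q).
Local Notation n := (N%:R : R).
Local Notation nu_ := (@nuR R S N beta h D).
Local Notation xx_ := (@xx R S N p q).

(** The size of one fluctuation, N^(-1/2); the target error N^(-3/2) is its cube. *)
Definition w : R := (Num.sqrt n)^-1.

Lemma w_gt0 : 0 < w. Proof. by rewrite invr_gt0 sqrtr_gt0 ltr0n. Qed.

Lemma w_sqr : n^-1 = w ^+ 2.
Proof. by rewrite /w exprVn sqr_sqrtr. Qed.

Lemma w_le1 : w <= 1.
Proof.
rewrite /w invf_le1 ?sqrtr_gt0 ?ltr0n// -[leLHS]sqrtr1 ler_sqrt ?ler0n// ler1n//.
Qed.

Let kap0 : 0 <= kap S beta := kap_ge0 S b0.

(** The common bound m of all second moments controls [devsum], which controls m in turn through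
    [nu_xx2_le]; [small] closes the loop. *)
Lemma m2_bound l l' : nu_ (fun s => xx_ l l' s ^+ 2) <= 9 * sb ^+ 2 * n^-1.
Proof.
apply: le_trans (nu_pow_le _ _ _ _ _ _ N0 l l' (isT : ~~ odd 2)) _.
set m := _ + _.
have Hm z z' : nu_ (fun s => xx_ z z' s ^+ 2) <= m by exact: nu_pow_le.
have HD i := nu_dsum2_le N0 i Hm.
have m0 : 0 <= m by apply: addr_ge0; apply: (nuR_ge0 _ _ _ N0) => s; exact: sqr_ge0.
have A a b (a4 : (a < 4)%N) (b4 : (b < 4)%N) := nu_xx2_le N0 b0 b1 q0 qS pS fp a4 b4 HD.
apply: (@absorb_second (kap S beta * c2)) => //.
- by rewrite mulr_ge0// (le_trans _ c2_ge1).
- apply: le_trans small; rewrite -mulrA ler_wpM2l// mulrC.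
  by rewrite ler_pM ?(le_trans _ c2_ge1) ?c2_le_c4//; lra.
- by rewrite invf_le1 ?ltr0n// ler1n.
- have E x : kap S beta * c2 * x = kap S beta * (8 * (8 * (8 * (8 * x)))) by rewrite /c2; ring.
  by rewrite E; apply: lerD; apply: A.
Qed.

Lemma m4_bound l l' : nu_ (fun s => xx_ l l' s ^+ 4) <= 385 * (sb ^+ 4 * n^-1 ^+ 2).
Proof.
apply: le_trans (nu_pow_le _ _ _ _ _ _ N0 l l' (isT : ~~ odd 4)) _.
set m := _ + _.
have Hm z z' : nu_ (fun s => xx_ z z' s ^+ 4) <= m by exact: nu_pow_le.
have HD i := nu_dsum4_le N0 i Hm.
have m0 : 0 <= m by apply: addr_ge0; apply: (nuR_ge0 _ _ _ N0) => s; exact: exprn_even_ge0.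
have A a b (a4 : (a < 4)%N) (b4 : (b < 4)%N) :=
  nu_xx4_le N0 b0 b1 q0 qS pS fp a4 b4 HD (m2_bound a b).
apply: (@absorb_fourth (kap S beta * c4)) => //.
- by rewrite mulr_ge0// (le_trans _ c2_le_c4)// (le_trans _ c2_ge1).
- by rewrite -mulrA (mulrC c4).
- by rewrite invf_le1 ?ltr0n// ler1n.
- have E x : kap S beta * c4 * x = kap S beta * ((8 * 8) ^+ 2 * (8 * (8 * (8 * (8 * x))))).
    by rewrite /c4 /c2; ring.
  by rewrite E; apply: lerD; apply: A.
Qed.

Definition KD2 : R := c2 * (20 * sb ^+ 2).
Definition KD4 : R := c4 * (8 * (386 * sb ^+ 4)).
Definition KD1 : R := (1 + KD2) / 2.
Definition KD3 : R := (KD2 + KD4) / 2.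

Lemma dsum2_bound i : nu_ (fun s => dsum i s ^+ 2) <= KD2 * w ^+ 2.
Proof.
apply: le_trans (nu_dsum2_le N0 i m2_bound) _.
rewrite [leLHS](_ : _ = c2 * (2 * (9 * sb ^+ 2 * n^-1) + 2 * (sb / n) ^+ 2)); last by rewrite /c2; ring.
rewrite [leRHS](_ : _ = c2 * (20 * sb ^+ 2 * w ^+ 2)); last by rewrite /KD2; ring.
apply: ler_wpM2l; first by rewrite (le_trans _ c2_ge1).
have v0 : 0 <= n^-1 by rewrite invr_ge0.
have v1 : n^-1 <= 1 by rewrite invf_le1 ?ltr0n// ler1n.
rewrite -w_sqr; move: (n^-1) v0 v1 => v v0 v1.
have T0 : 0 <= sb ^+ 2 * v by rewrite mulr_ge0 ?sqr_ge0.
have : sb ^+ 2 * v * v <= sb ^+ 2 * v by rewrite ler_piMr.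
by lra.
Qed.

Lemma dsum4_bound i : nu_ (fun s => dsum i s ^+ 4) <= KD4 * w ^+ 4.
Proof.
apply: le_trans (nu_dsum4_le N0 i m4_bound) _.
rewrite [leLHS](_ : _ = c4 * (8 * (385 * (sb ^+ 4 * n^-1 ^+ 2)) + 8 * (sb / n) ^+ 4)); last first.
  by rewrite /c4 /c2; ring.
rewrite [leRHS](_ : _ = c4 * (8 * (386 * (sb ^+ 4 * w ^+ 4)))); last by rewrite /KD4; ring.
apply: ler_wpM2l.
  by rewrite (le_trans _ c2_le_c4)// (le_trans _ c2_ge1).
have v0 : 0 <= n^-1 by rewrite invr_ge0.
have v1 : n^-1 <= 1 by rewrite invf_le1 ?ltr0n// ler1n.
rewrite (_ : w ^+ 4 = (w ^+ 2) ^+ 2); last by rewrite -exprM.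
rewrite -w_sqr; move: (n^-1) v0 v1 => v v0 v1.
have T0 : 0 <= sb ^+ 4 * v ^+ 2 by rewrite mulr_ge0 ?exprn_even_ge0.
have TY : sb ^+ 4 * v ^+ 2 * v ^+ 2 <= sb ^+ 4 * v ^+ 2 by rewrite ler_piMr// exprn_ile1.
rewrite (_ : (sb * v) ^+ 4 = sb ^+ 4 * v ^+ 2 * v ^+ 2); last by ring.
by lra.
Qed.

(** From x <= (w + x^2 / w) / 2, where the scale w makes both terms of the same order. The third
    moment is treated alike, from x^3 <= (w x^2 + x^4 / w) / 2. *)
Lemma dsum1_bound i : nu_ (dsum i) <= KD1 * w.
Proof.
have w0 := w_gt0.
apply: (@le_trans _ _ (nu_ (fun s => w / 2 + (w^-1 / 2) * dsum i s ^+ 2))).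
  apply: nuR_le => // s; have := sqr_ge0 (w - dsum i s).
  move: (dsum i s) => x hx.
  rewrite -(ler_pM2l (_ : 0 < 2 * w)); last by rewrite mulr_gt0.
  rewrite [leRHS](_ : _ = w ^+ 2 + x ^+ 2); last by field; rewrite gt_eqF.
  by lra.
rewrite nuRD// nuR_cst// nuRZ//.
apply: (@le_trans _ _ (w / 2 + w^-1 / 2 * (KD2 * w ^+ 2))).
  apply: lerD => //; apply: ler_wpM2l; last exact: dsum2_bound.
  by rewrite divr_ge0// invr_ge0 ltW.
rewrite le_eqVlt; apply/orP; left; apply/eqP; rewrite /KD1; by field; rewrite gt_eqF.
Qed.

Lemma dsum3_bound i : nu_ (fun s => dsum i s ^+ 3) <= KD3 * w ^+ 3.
Proof.
have w0 := w_gt0.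
apply: (@le_trans _ _ (nu_ (fun s => (w / 2) * dsum i s ^+ 2 + (w^-1 / 2) * dsum i s ^+ 4))).
  apply: nuR_le => // s; have := sqr_ge0 ((w - dsum i s) * dsum i s).
  move: (dsum i s) => x hx.
  rewrite -(ler_pM2l (_ : 0 < 2 * w)); last by rewrite mulr_gt0.
  rewrite [leRHS](_ : _ = w ^+ 2 * x ^+ 2 + x ^+ 4); last by field; rewrite gt_eqF.
  by lra.
rewrite nuRD// !nuRZ//.
apply: (@le_trans _ _ ((w / 2) * (KD2 * w ^+ 2) + w^-1 / 2 * (KD4 * w ^+ 4))).
  apply: lerD; apply: ler_wpM2l.
  - by rewrite divr_ge0// ltW.
  - exact: dsum2_bound.
  - by rewrite divr_ge0// invr_ge0 ltW.
  - exact: dsum4_bound.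
rewrite le_eqVlt; apply/orP; left; apply/eqP; rewrite /KD3; by field; rewrite gt_eqF.
Qed.

End Concentration.

(** * The linear system for the second moments *)

Section CavityEquations.
Context {R : realType}.
Variables (S N : nat) (beta h D p q : R).
Hypotheses (N0 : (0 < N)%N) (b0 : 0 <= beta) (b1 : beta <= 1).
Local Notation sb := (S%:R ^+ 2 : R).
Hypotheses (q0 : 0 <= q) (qS : q <= sb) (pS : `|p| <= sb).
Hypothesis fp : fixed_point S beta h D p q.
Hypothesis small : kap S beta * (16 * c4) <= 2^-1.
Local Notation cfg := (config S N).
Local Notation reps := {ffun 'I_10 -> cfg}.
Implicit Types (f g : reps -> R) (s : reps) (x : R) (i : 'I_N) (a b c d l : 'I_10).
Local Notation cav := (@cavg R S N 10 beta h D p q).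
Local Notation W := (@cW R S N 10 p q).
Local Notation dev := (@cdev R S N 10 p q).
Local Notation dsum := (@devsum R S N p q).
Local Notation n := (N%:R : R).
Local Notation nu_ := (@nuR R S N beta h D).
Local Notation xx_ := (@xx R S N p q).
Local Notation w := (@w R N).
Local Notation KD1 := (@KD1 R S).
Local Notation KD3 := (@KD3 R S).
Local Notation K1 := (@K1 R S).
Local Notation K2 := (@K2 R S).

(** By [mom2] this is the covariance of s_a s_b and s_c s_d at the decoupled site. *)
Definition cmom a b c d : R :=
  mom S beta h D p q [:: a; b; c; d] - rpq p q a b * mom S beta h D p q [:: c; d].

Let w0 : 0 < w := w_gt0 N0.
Let w1 : w <= 1 := w_le1 N0.
Let d0 i s : 0 <= dsum i s := devsum_ge0 p q i s.

Lemma cav0_cmom i a b c d f : offsite i f ->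
  cav i 0 (fun s => (spin (s a i) * spin (s b i) - rpq p q a b) * (spin (s c i) * spin (s d i)) * f s) =
  cmom a b c d * cav i 0 f.
Proof.
move=> of_.
have h4 := @cavg0_mom _ S 10 beta h D p q N i N0 f [:: a; b; c; d] of_.
have h2 := @cavg0_mom _ S 10 beta h D p q N i N0 f [:: c; d] of_.
rewrite (_ : (fun s => _) = (fun s => (f s * \prod_(j <- [:: a; b; c; d]) spin (s j i)) +
    - rpq p q a b * (f s * \prod_(j <- [:: c; d]) spin (s j i)))); last first.
  by apply/funext => s; rewrite !big_cons big_nil !mulr1; ring.
by rewrite cavgD cavgZ h4 h2 /cmom; ring.
Qed.

Definition KV : R := K1 * KD3 + (2 * sb * KD1 + sb ^+ 2).

(** Moving from angle 0 to the model costs a third moment of [devsum], and restoring site i costs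
    1/N times a first moment; both are of order w^3. *)
Lemma dev_xx_close i (c d l l' : 'I_10) : (c < 6)%N -> (d < 6)%N -> (l < 6)%N -> (l' < 6)%N ->
  `|cav i 0 (fun s => dev i s c d * dev i s l l') - nu_ (fun s => xx_ c d s * xx_ l l' s)| <=
  KV * w ^+ 3.
Proof.
move=> c6 d6 l6 l6'.
have L8 (z : 'I_10) : (z < 6)%N -> (z < 8)%N by move=> z6; exact: leq_trans z6 _.
have dle (z z' : 'I_10) s : (z < 6)%N -> (z' < 6)%N -> `|dev i s z z'| <= dsum i s.
  by move=> z6 z6'; apply: dev_le_devsum; exact: L8.
set f := fun s => dev i s c d * dev i s l l'.
have df : depends_on 6 f by apply: depends_onM; exact: depends_on_dev.
have pi0 : (0 : R) <= (pi / 2 : R) <= (pi / 2 : R) by rewrite divr_ge0 ?pi_ge0//=.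
have A := first_order h D N0 b0 b1 q0 qS pS i (isT : (0 < 6 <= 6)%N) df pi0.
rewrite !(cav_nuR _ _ _ N0) in A.
have A' : `|nu_ f - cav i 0 f| <= K1 * KD3 * w ^+ 3.
  apply: le_trans A _.
  have I0 : 0 <= nu_ (fun s => `|f s| * dsum i s).
    by apply: (nuR_ge0 _ _ _ N0) => s; rewrite mulr_ge0.
  apply: (@le_trans _ _ (1 * (K1 * nu_ (fun s => `|f s| * dsum i s)))).
    by apply: ler_wpM2r; [rewrite mulr_ge0 ?K1_ge0|rewrite exprn_ile1].
  rewrite mul1r -mulrA; apply: ler_wpM2l; first exact: K1_ge0.
  apply: le_trans (dsum3_bound N0 b0 b1 q0 qS pS fp small i).
  apply: (nuR_le _ _ _ N0) => s; rewrite exprSr; apply: ler_wpM2r => //.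
  by rewrite /f normrM expr2; apply: ler_pM => //; exact: dle.
have B : `|nu_ f - nu_ (fun s => xx_ c d s * xx_ l l' s)| <= (2 * sb * KD1 + sb ^+ 2) * w ^+ 3.
  rewrite -[X in _ - X]mul1r -mulNr -nuRZ// -nuRD//.
  apply: le_trans (nuR_abs _ _ _ N0 _) _.
  apply: (@le_trans _ _ (nu_ (fun s => 2 * (sb / n) * dsum i s + (sb / n) ^+ 2))).
    apply: (nuR_le _ _ _ N0) => s.
    have e1 := @correction_le R S N i s c d; have e2 := @correction_le R S N i s l l'.
    have u1 := dle c d s c6 d6; have u2 := dle l l' s l6 l6'.
    rewrite (xx_dev p q i s c d) (xx_dev p q i s l l') /f.
    move: e1 e2 u1 u2; set e := n^-1 * _; set e' := n^-1 * _.
    set u := dev i s c d; set u' := dev i s l l'; move=> e1 e2 u1 u2.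
    have -> : u * u' + - 1 * ((u + e) * (u' + e')) = - (u * e' + e * u' + e * e') by ring.
    have h1 : `|u * e'| <= dsum i s * (sb / n) by rewrite normrM; apply: ler_pM.
    have h2 : `|e * u'| <= (sb / n) * dsum i s by rewrite normrM; apply: ler_pM.
    have h3 : `|e * e'| <= (sb / n) * (sb / n) by rewrite normrM; apply: ler_pM.
    rewrite normrN [leRHS](_ : _ = dsum i s * (sb / n) + (sb / n) * dsum i s + (sb / n) * (sb / n)); last ring.
    by rewrite (le_trans (ler_normD _ _))// lerD// (le_trans (ler_normD _ _))// lerD.
  rewrite nuRD// nuR_cst// nuRZ// w_sqr.
  have D1 := dsum1_bound N0 b0 b1 q0 qS pS fp small i.
  apply: (@le_trans _ _ (2 * (sb * w ^+ 2) * (KD1 * w) + (sb * w ^+ 2) ^+ 2)).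
    by rewrite lerD2r; apply: ler_wpM2l => //; rewrite !mulr_ge0 ?exprn_ge0// ltW.
  rewrite [leRHS](_ : _ = 2 * (sb * w ^+ 2) * (KD1 * w) + sb ^+ 2 * w ^+ 3 * 1); last ring.
  rewrite lerD2l (_ : (sb * w ^+ 2) ^+ 2 = sb ^+ 2 * w ^+ 3 * w); last ring.
  by rewrite ler_wpM2l// mulr_ge0 ?exprn_ge0// ltW.
rewrite /KV mulrDl.
rewrite [X in `|X|](_ : _ = - (nu_ f - cav i 0 f) + (nu_ f - nu_ (fun s => xx_ c d s * xx_ l l' s))); last ring.
by rewrite (le_trans (ler_normD _ _))// normrN lerD.
Qed.

Definition KE a b : R := 2 * sb * (sb * (K1 * KD1)) + K2 * (2 * sb * KD3) +
  beta ^+ 2 / 2 * \sum_(l < 10) \sum_(l' < 10) `|rcoef 4 l * rcoef 5 l' * cmom a b l l'| * KV.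

(** The overlap of c and d is split into its part off site i, giving [f], and site i, giving [g]
    with a factor 1/N. At angle 0 the average of [g] is [cmom a b c d], that of [f] vanishes, and
    its second-order term factorizes into covariances at site i times products of deviations, which
    [dev_xx_close] turns back into overlaps of the model. *)
Lemma site_expansion i (a b c d : 'I_10) : (a < 4)%N -> (b < 4)%N -> (c < 4)%N -> (d < 4)%N ->
  `|nu_ (fun s => (spin (s a i) * spin (s b i) - rpq p q a b) * xx_ c d s)
    - (n^-1 * cmom a b c d + beta ^+ 2 / 2 * \sum_(l < 10) \sum_(l' < 10)
       rcoef 4 l * rcoef 5 l' * cmom a b l l' * nu_ (fun s => xx_ c d s * xx_ l l' s))| <=
  KE a b * w ^+ 3.
Proof.
move=> a4 b4 c4 d4.
have L8 (z : 'I_10) : (z < 4)%N -> (z < 8)%N by move=> z6; exact: leq_trans z6 _.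
have L6 (z : 'I_10) : (z < 4)%N -> (z < 6)%N by move=> z6; exact: leq_trans z6 _.
pose e a b (s : reps) : R := spin (s a i) * spin (s b i).
pose f s := (e a b s - rpq p q a b) * dev i s c d.
pose g s := (e a b s - rpq p q a b) * e c d s.
have de (u v : 'I_10) : (u < 4)%N -> (v < 4)%N -> depends_on 4 (e u v).
  by move=> u4 v4; apply: depends_onM; exact: depends_on_spin.
have dea : depends_on 4 (fun s => e a b s - rpq p q a b).
  exact: (depends_on_comp (fun z => z - rpq p q a b) (de _ _ a4 b4)).
have df : depends_on 4 f by apply: depends_onM => //; exact: depends_on_dev.
have dg : depends_on 4 g by apply: depends_onM => //; exact: de.
have split : nu_ (fun s => (spin (s a i) * spin (s b i) - rpq p q a b) * xx_ c d s) =
    nu_ f + n^-1 * nu_ g.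
  rewrite -nuRZ// -nuRD//; congr nuR; apply/funext => s.
  by rewrite (xx_dev p q i s c d) /f /g /e; ring.
have pi0 : (0 : R) <= (pi / 2 : R) <= (pi / 2 : R) by rewrite divr_ge0 ?pi_ge0//=.
have G1 : `|nu_ g - cmom a b c d| <= 2 * sb * (sb * (K1 * KD1)) * w.
  have A := first_order h D N0 b0 b1 q0 qS pS i (isT : (0 < 4 <= 6)%N) dg pi0.
  rewrite !(cav_nuR _ _ _ N0) in A.
  have E0 : cav i 0 g = cmom a b c d.
    rewrite -[RHS]mulr1 -(cavg_cst S 10 beta h D p q i 0 1) -cav0_cmom//.
    by congr cavg; apply/funext => s; rewrite mulr1.
  rewrite E0 in A; apply: le_trans A _.
  have I0 : 0 <= nu_ (fun s => `|g s| * dsum i s).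
    by apply: (nuR_ge0 _ _ _ N0) => s; rewrite mulr_ge0.
  apply: (@le_trans _ _ (1 * (K1 * nu_ (fun s => `|g s| * dsum i s)))).
    by apply: ler_wpM2r; [rewrite mulr_ge0 ?K1_ge0|rewrite exprn_ile1].
  rewrite mul1r [leRHS](_ : _ = K1 * (2 * sb * sb * (KD1 * w))); last ring.
  apply: ler_wpM2l; first exact: K1_ge0.
  apply: (@le_trans _ _ (nu_ (fun s => 2 * sb * sb * dsum i s))).
    apply: (nuR_le _ _ _ N0) => s; apply: ler_wpM2r => //.
    rewrite normrM; apply: ler_pM => //; [exact: (norm_center q0 qS pS)|exact: norm_spin2].
  rewrite nuRZ//; apply: ler_wpM2l; first by rewrite !mulr_ge0// exprn_ge0.
  exact: (dsum1_bound N0 b0 b1 q0 qS pS fp small i).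
have F1 : `|nu_ f - beta ^+ 2 / 2 * cav i 0 (fun s => f s * W i 4 s)| <= K2 * (2 * sb * KD3) * w ^+ 3.
  have A := second_order h D N0 b0 b1 q0 qS pS i df.
  have z0 : cav i 0 f = 0.
    by apply: cav0_centered => // s s' /=; rewrite offsite_dev.
  rewrite z0 subr0 !(cav_nuR _ _ _ N0) in A; apply: le_trans A _.
  rewrite -mulrA; apply: ler_wpM2l; first exact: K2_ge0.
  rewrite -mulrA; apply: (@le_trans _ _ (nu_ (fun s => 2 * sb * dsum i s ^+ 3))).
    apply: (nuR_le _ _ _ N0) => s; rewrite [leRHS](_ : _ = 2 * sb * dsum i s * dsum i s ^+ 2); last ring.
     apply: ler_wpM2r; first exact: exprn_ge0.
    rewrite normrM; apply: ler_pM => //; first exact: (norm_center q0 qS pS).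
    by apply: dev_le_devsum; exact: L8.
  rewrite nuRZ//; apply: ler_wpM2l; first by rewrite !mulr_ge0// exprn_ge0.
  exact: (dsum3_bound N0 b0 b1 q0 qS pS fp small i).
have FW : cav i 0 (fun s => f s * W i 4 s) = \sum_(l < 10) \sum_(l' < 10)
    rcoef 4 l * rcoef 5 l' * cmom a b l l' * cav i 0 (fun s => dev i s c d * dev i s l l').
  rewrite (_ : (fun s => _) = (fun s => \sum_(l < 10) \sum_(l' < 10) (rcoef 4 l * rcoef 5 l') *
    ((e a b s - rpq p q a b) * (spin (s l i) * spin (s l' i)) * (dev i s c d * dev i s l l')))); last first.
    apply/funext => s; rewrite /cW mulr_sumr; apply: eq_bigr => l _.
    by rewrite mulr_sumr; apply: eq_bigr => l' _; rewrite /f; ring.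
  rewrite cavg_sum; apply: eq_bigr => l _; rewrite cavg_sum; apply: eq_bigr => l' _.
  rewrite cavgZ -[RHS]mulrA; congr (_ * _); apply: cav0_cmom => s s'.
  by rewrite !offsite_dev.
rewrite split FW in F1 *.
set T1 := \sum_(l < 10) _ in F1; set T2 := \sum_(l < 10) \sum_(l' < 10) _ * nu_ _.
have T12 : `|T1 - T2| <= (\sum_(l < 10) \sum_(l' < 10) `|rcoef 4 l * rcoef 5 l' * cmom a b l l'| * KV) * w ^+ 3.
  rewrite /T1 /T2 -sumrB (le_trans (ler_norm_sum _ _ _))// mulr_suml ler_sum// => l _.
  rewrite -sumrB (le_trans (ler_norm_sum _ _ _))// mulr_suml ler_sum// => l' _.
  rewrite -mulrBr normrM -[leRHS]mulrA.
  have [l6|l6] := ltnP l 6; last by rewrite rcoef0 ?(leq_trans _ l6)// !mul0r normr0 !mul0r.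
  have [l6'|l6'] := ltnP l' 6; last first.
    by rewrite (@rcoef0 _ 5 l') ?(leq_trans _ l6')// mulr0 !mul0r normr0 !mul0r.
  by rewrite ler_wpM2l// dev_xx_close// L6.
have n0 : 0 <= n^-1 by rewrite invr_ge0.
rewrite [X in `|X|](_ : _ = n^-1 * (nu_ g - cmom a b c d) + ((nu_ f - beta ^+ 2 / 2 * T1)
   + beta ^+ 2 / 2 * (T1 - T2))); last ring.
rewrite (le_trans (ler_normD _ _))// /KE [leRHS]mulrDl [X in _ <= X + _]mulrDl -[leRHS]addrA lerD//.
  rewrite normrM ger0_norm// w_sqr [leRHS](_ : _ = w ^+ 2 * (2 * sb * (sb * (K1 * KD1)) * w)); last ring.
  by rewrite ler_wpM2l// exprn_ge0// ltW.
rewrite (le_trans (ler_normD _ _))// lerD// normrM ger0_norm ?divr_ge0 ?exprn_ge0//.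
by rewrite -mulrA ler_wpM2l// divr_ge0 ?exprn_ge0.
Qed.

Theorem cavity_equation (a b c d : 'I_10) : (a < 4)%N -> (b < 4)%N -> (c < 4)%N -> (d < 4)%N ->
  `|nu_ (fun s => xx_ a b s * xx_ c d s)
    - (n^-1 * cmom a b c d + beta ^+ 2 / 2 * \sum_(l < 10) \sum_(l' < 10)
       rcoef 4 l * rcoef 5 l' * cmom a b l l' * nu_ (fun s => xx_ c d s * xx_ l l' s))| <=
  KE a b * w ^+ 3.
Proof.
move=> a4 b4 c4 d4; rewrite (nu_xx_mul _ _ _ _ _ N0).
set T := n^-1 * cmom a b c d + _.
have -> x : n^-1 * \sum_(i < N) nu_ (fun s => (spin (s a i) * spin (s b i) - rpq p q a b) * xx_ c d s) - x =
   n^-1 * \sum_(i < N) (nu_ (fun s => (spin (s a i) * spin (s b i) - rpq p q a b) * xx_ c d s) - x).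
  by rewrite sumrB mulrBr sumr_const card_ord -[x *+ N]mulr_natl mulKf// gt_eqF// ltr0n.
rewrite normrM ger0_norm ?invr_ge0//.
apply: (@le_trans _ _ (n^-1 * \sum_(i < N) `|nu_ (fun s => (spin (s a i) * spin (s b i) - rpq p q a b) * xx_ c d s) - T|)).
  by rewrite ler_wpM2l ?invr_ge0// ler_norm_sum.
by apply: average_le => // i; exact: site_expansion.
Qed.

End CavityEquations.

Definition r2 : 'I_10 := Ordinal (isT : (2 < 10)%N).
Definition r3 : 'I_10 := Ordinal (isT : (3 < 10)%N).

Ltac simplify_neq :=
  repeat match goal with
  | H : is_true (?x != ?y) |- _ =>
    let E := fresh in have E : (x == y) = false := negbTE H;
    rewrite ?E ?[y == x]eq_sym ?E /=; clear E; move: H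
  end; intros; rewrite /=.

Section OverlapTypes.
Context {R : realType}.

(* The seven orbits of pairs of overlaps ((a,b),(c,d)) under permutations of the replicas. *)
Definition pair_type (u0 u1 u2 u3 u4 u5 u6 : R) (a b c d : nat) : R :=
  if a == b then
    if c == d then (if a == c then u3 else u4)
    else if a == c then u5 else if a == d then u5 else u6
  else if c == d then (if a == c then u5 else if b == c then u5 else u6)
  else if a == c then (if b == d then u0 else u1)
  else if a == d then (if b == c then u0 else u1)
  else if b == c then u1 else if b == d then u1 else u2.

(** The values are named after the block sizes of the partition of the four indices by equality.
    Indices are natural numbers so that the function computes on numerals. *)
Definition moment_type (e4 e13 e22 e112 e1111 : R) (a b c d : nat) : R :=
  if a == b then
    if a == c then (if a == d then e4 else e13)
    else if a == d then e13 else if c == d then e22 else e112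
  else if a == c then (if a == d then e13 else if b == d then e22 else e112)
  else if b == c then (if a == d then e22 else if b == d then e13 else e112)
  else if a == d then e112 else if b == d then e112 else if c == d then e112 else e1111.

Section Overlaps.
Variables (S N : nat) (beta h D p q : R).
Hypothesis N0 : (0 < N)%N.
Implicit Types (a b c d l : 'I_10).

Definition nuxx a b c d : R := @nuR R S N beta h D (fun s => xx p q a b s * xx p q c d s).

Lemma nuxx_perm (pi : {perm 'I_10}) a b c d :
  nuxx (pi a) (pi b) (pi c) (pi d) = nuxx a b c d.
Proof.
rewrite /nuxx -[RHS](nuR_perm _ _ _ N0 pi); congr nuR; apply/funext => s.
by rewrite !xx_perm.
Qed.

Lemma nuxxCl a b c d : nuxx a b c d = nuxx b a c d.
Proof. by congr nuR; apply/funext => s; rewrite xxC. Qed.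

Lemma nuxxCr a b c d : nuxx a b c d = nuxx a b d c.
Proof. by congr nuR; apply/funext => s; rewrite [xx p q c d s]xxC. Qed.

Lemma nuxxC a b c d : nuxx a b c d = nuxx c d a b.
Proof. by congr nuR; apply/funext => s; rewrite mulrC. Qed.

Lemma nuxx_diag a c d : nuxx a a c d =
  if c == d then (if a == c then nuxx r0 r0 r0 r0 else nuxx r0 r0 r1 r1)
  else if a == c then nuxx r0 r0 r0 r1 else if a == d then nuxx r0 r0 r0 r1 else nuxx r0 r0 r1 r2.
Proof.
have two x y : x != y -> exists pi : {perm 'I_10}, pi r0 = x /\ pi r1 = y.
  move=> xy; have [|||pi [<- <-]] := @exists_perm_map _ [:: r0; r1] [:: x; y] => //=.
    by rewrite inE xy.
  by exists pi.
case: (eqVneq c d) => [<-|cd].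
  case: (eqVneq a c) => [<-|ac].
    by rewrite -(nuxx_perm (tperm r0 a) r0) tpermL.
  have [pi [<- <-]] := two _ _ ac; exact: nuxx_perm.
case: (eqVneq a c) => [ac|ac].
  by have [pi [E1 E2]] := two _ _ cd; rewrite ac -E1 -E2 nuxx_perm.
case: (eqVneq a d) => [ad|ad].
  rewrite eq_sym in cd.
  by have [pi [E1 E2]] := two _ _ cd; rewrite ad -E1 -E2 nuxxCr nuxx_perm.
have [|||pi [<- <- <-]] := @exists_perm_map _ [:: r0; r1; r2] [:: a; c; d] => //=.
  by rewrite !inE negb_or ac ad cd.
exact: nuxx_perm.
Qed.

Lemma nuxx_type a b c d : nuxx a b c d = pair_type (nuxx r0 r1 r0 r1) (nuxx r0 r1 r0 r2)
  (nuxx r0 r1 r2 r3) (nuxx r0 r0 r0 r0) (nuxx r0 r0 r1 r1) (nuxx r0 r0 r0 r1) (nuxx r0 r0 r1 r2) a b c d.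
Proof.
rewrite /pair_type !val_eqE; case: (eqVneq a b) => [<-|ab]; first exact: nuxx_diag.
case: (eqVneq c d) => [<-|cd].
  by rewrite nuxxC nuxx_diag (negbTE ab) ![c == _]eq_sym.
have three x y z : x != y -> x != z -> y != z -> nuxx x y x z = nuxx r0 r1 r0 r2.
  move=> xy xz yz.
  have [|||pi [<- <- <-]] := @exists_perm_map _ [:: r0; r1; r2] [:: x; y; z] => //=.
    by rewrite !inE negb_or xy xz yz.
  exact: nuxx_perm.
have two x y : x != y -> nuxx x y x y = nuxx r0 r1 r0 r1.
  move=> xy; have [|||pi [<- <-]] := @exists_perm_map _ [:: r0; r1] [:: x; y] => //=.
    by rewrite inE xy.
  exact: nuxx_perm.
case: (eqVneq a c) => [ac|ac].
  case: (eqVneq b d) => [bd|bd]; rewrite -ac -?bd in cd *; [exact: two|exact: three].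
case: (eqVneq a d) => [ad|ad].
  rewrite -ad nuxxCr; case: (eqVneq b c) => [<-|bc]; [exact: two|exact: three].
case: (eqVneq b c) => [bc|bc].
  by rewrite -bc in cd *; rewrite nuxxCl; apply: three => //; rewrite eq_sym.
case: (eqVneq b d) => [bd|bd].
  by rewrite -bd nuxxCl nuxxCr three// eq_sym.
have [|||pi [<- <- <- <-]] := @exists_perm_map _ [:: r0; r1; r2; r3] [:: a; b; c; d] => //=.
  by rewrite !inE !negb_or ab ac ad bc bd cd.
exact: nuxx_perm.
Qed.

End Overlaps.

Section Moments.
Variables (S : nat) (beta h D p q : R).
Local Notation mj_ := (mj S beta h D p q).
Implicit Types (a b c d l : 'I_10).

Definition e4 : R := gaussE (fun x => mj_ 4 x).
Definition e13 : R := gaussE (fun x => mj_ 1 x * mj_ 3 x).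
Definition e22 : R := gaussE (fun x => mj_ 2 x ^+ 2).
Definition e112 : R := gaussE (fun x => mj_ 1 x ^+ 2 * mj_ 2 x).
Definition e1111 : R := gaussE (fun x => mj_ 1 x ^+ 4).

Lemma prod_count_undup (F : nat -> R) (r : seq 'I_10) : F 0%N = 1 ->
  \prod_(l < 10) F (count_mem l r) = \prod_(l <- undup r) F (count_mem l r).
Proof.
move=> F0; rewrite [RHS]big_uniq ?undup_uniq//= [LHS](bigID (mem r)) /=.
rewrite [X in _ * X]big1 ?mulr1 => [|l]; first by apply: eq_bigl => l; rewrite mem_undup.
by rewrite -has_pred1 has_count -leqNgt leqn0 => /eqP ->.
Qed.

Lemma mom_type a b c d : mom S beta h D p q [:: a; b; c; d] =
  moment_type e4 e13 e22 e112 e1111 a b c d.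
Proof.
rewrite /mom.
have -> : (fun eta => \prod_(l < 10) mj_ (count_mem l [:: a; b; c; d]) eta) =
    (fun eta => \prod_(l <- undup [:: a; b; c; d]) mj_ (count_mem l [:: a; b; c; d]) eta).
  by apply/funext => eta; apply: (@prod_count_undup (fun k => mj_ k eta)); exact: mj0.
rewrite /moment_type !val_eqE.
have E X Y : (forall eta, X eta = Y eta :> R) -> gaussE X = gaussE Y.
  by move=> XY; congr gaussE; apply/funext.
case: (eqVneq a b) => [<-|ab]; [case: (eqVneq a c) => [<-|ac]; [case: (eqVneq a d) => [<-|ad]|
  case: (eqVneq a d) => [<-|ad]; [|case: (eqVneq c d) => [<-|cd]]]|
  case: (eqVneq a c) => [<-|ac]; [case: (eqVneq a d) => [<-|ad]; [|case: (eqVneq b d) => [<-|bd]]|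
  case: (eqVneq b c) => [<-|bc]; [case: (eqVneq a d) => [<-|ad]; [|case: (eqVneq b d) => [<-|bd]]|
  case: (eqVneq a d) => [<-|ad]; [|case: (eqVneq b d) => [<-|bd]; [|case: (eqVneq c d) => [<-|cd]]]]]].
all: apply: E => eta; rewrite /= ?inE ?eqxx; simplify_neq; rewrite !big_cons big_nil ?eqxx; simplify_neq.
all: rewrite /addn /=; ring.
Qed.

End Moments.
End OverlapTypes.

(** * Exact solution and stability of the linear system *)

Section LinearSystem.
Context {R : realType}.

Lemma rcoef_sum (F : nat -> nat -> R) :
  \sum_(l < 10) \sum_(l' < 10) rcoef 4 l * rcoef 5 l' * F l l' =
  (F 0 0 + F 0 1 + F 0 2 + F 0 3 + F 0 4 - 5 * F 0 5) +
  (F 1 0 + F 1 1 + F 1 2 + F 1 3 + F 1 4 - 5 * F 1 5) +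
  (F 2 0 + F 2 1 + F 2 2 + F 2 3 + F 2 4 - 5 * F 2 5) +
  (F 3 0 + F 3 1 + F 3 2 + F 3 3 + F 3 4 - 5 * F 3 5) -
  4 * (F 4 0 + F 4 1 + F 4 2 + F 4 3 + F 4 4 - 5 * F 4 5) :> R.
Proof.
rewrite (eq_bigr (fun l : 'I_10 => rcoef 4 l * (F l 0 + F l 1 + F l 2 + F l 3 + F l 4 - 5 * F l 5))); last first.
  move=> l _; under eq_bigr do rewrite -mulrA; rewrite -mulr_sumr; congr (_ * _).
  by rewrite !big_ord_recl big_ord0 /rcoef /=; ring.
by rewrite !big_ord_recl big_ord0 /rcoef /=; ring.
Qed.

(** 80 = (4 * 1 + 4)(5 * 1 + 5). *)
Lemma rcoef_abs_sum : \sum_(l < 10) \sum_(l' < 10) `|rcoef 4 l * rcoef 5 l'| = 80 :> R.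
Proof.
under eq_bigr do (under eq_bigr do rewrite normrM); rewrite -big_distrlr /=.
rewrite !big_ord_recl !big_ord0 /rcoef /= !normrN !normr1 !normr0 !normr_nat.
by ring.
Qed.

Definition cmom_type (p q e4 e13 e22 e112 e1111 : R) (a b c d : nat) : R :=
  moment_type e4 e13 e22 e112 e1111 a b c d -
  (if a == b then p else q) * (if c == d then p else q).

Section Exact.
Variables (p q e4 e13 e22 e112 e1111 b2 v : R).
Let A := e22 - 2 * e112 + e1111.
Let D := e4 - e22.
Let F := e22 - e112.
Let G := e112 - e1111.
Let E := e13 - e112.
Let I3 := e1111 - q ^+ 2.
Let I5 := e112 - p * q.
Let K4 := e22 - p ^+ 2.
Let M1 := 1 - b2 * (F - 3 * G).
Let M2 := 1 - b2 / 2 * D.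
Let M3 := 1 - b2 * (F - G).
Let M := M1 * M2 + b2 ^+ 2 * E ^+ 2.
Hypotheses (M0 : M != 0) (M30 : M3 != 0) (A0 : 1 - b2 * A != 0).

(** With v = 1/N and b2 = beta^2, [T2], [T1], [S1], [X1] stand for A_2^2, A_1^2, B_1^2, C_1^2 and
    [T0], [S0], [X0] for A_0^2, B_0^2, C_0^2. *)
Let T2 := A * v / (1 - b2 * A).
Let T1 := (G * M2 + b2 / 2 * E ^+ 2) * v / (M * M3).
Let S1 := (D * M1 - 2 * b2 * E ^+ 2) * v / M.
Let X1 := E * v / M.
Let T0 := b2 / M * (b2 * E * K4 + M2 * I5) * X1
  + 2 * b2 / M * (b2 * E * (E - I5) + M2 * (2 * G - I3)) * T1
  + b2 / M * (b2 * E * I5 + M2 * I3) * T2 + v / M * (b2 * E * I5 + M2 * I3).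
Let S0 := b2 / (2 * M) * (M1 * K4 - b2 * E * I5) * S1
  + b2 / M * (M1 * (E - I5) - b2 * E * (2 * G - I3)) * X1
  + v / M * (M1 * K4 - b2 * E * I5).
Let X0 := b2 / (2 * M) * (M2 * I5 + b2 * E * K4) * S1
  + b2 / M * (M2 * (2 * G - I3) + b2 * E * (E - I5)) * X1
  + v / M * (M2 * I5 + b2 * E * K4).

Lemma relT2 : T2 = v * A + b2 * (A * T2).
Proof. by rewrite /T2; field. Qed.

Let A_FG : A = F - G. Proof. by rewrite /A /F /G; ring. Qed.
Let A_M3 : 1 - b2 * A = M3. Proof. by rewrite A_FG. Qed.

Let M20 : (1 - b2 * (F - 3 * G)) * (2 - b2 * D) + (b2 * E) ^+ 2 * 2 != 0.
Proof.
rewrite (_ : _ + _ = 2 * M); last by rewrite /M /M1 /M2; field.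
by rewrite mulf_neq0// pnatr_eq0.
Qed.

(** With relT1 this is a system of determinant M: M2 X1 + 2 b2 E T1 = E (v + b2 T2) and M1 T1 - b2 E
    X1 / 2 = G (v + b2 T2), where v + b2 T2 = v / M3. The simple form of X1 results from M3 = M1 - 2
    b2 G. *)
Lemma relX1 : X1 = v * E + b2 * (E * T2 - 2 * E * T1 + 2^-1 * D * X1).
Proof.
rewrite /X1 /T2 /T1 A_M3 A_FG; move: M20 M30; rewrite /M /M3 /M2 /M1 => m20 m30.
by field; rewrite m20 m30.
Qed.

Lemma relT1 : T1 = v * G + b2 * (G * T2 + (F - 3 * G) * T1 + 2^-1 * E * X1).
Proof.
rewrite /X1 /T2 /T1 A_M3 A_FG; move: M20 M30; rewrite /M /M3 /M2 /M1 => m20 m30.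
by field; rewrite m20 m30.
Qed.

Lemma relS1 : S1 = v * D + b2 * (2^-1 * D * S1 - 2 * E * X1).
Proof.
rewrite /X1 /S1; move: M20; rewrite /M /M2 /M1 => m20.
by field; rewrite m20.
Qed.

(** Right-hand sides of two systems of determinant M: M1 T0 - b2 E X0 = a with M2 X0 + b2 E T0 = c,
    and M1 X0 - b2 E S0 = a' with M2 S0 + b2 E X0 = s. *)
Let a := v * I3 + b2 * (I3 * T2 + 2 * (2 * G - I3) * T1 + I5 * X1).
Let c := v * I5 + b2 * (I5 * T2 + 2 * (E - I5) * T1 + K4 * X1).
Let a' := v * I5 + b2 * (2^-1 * I5 * S1 + (2 * G - I3) * X1).
Let s := v * K4 + b2 * (2^-1 * K4 * S1 + (E - I5) * X1).

Let T0M : M * T0 = M2 * a + b2 * E * c.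
Proof.
rewrite /T0 /a /c; move: T2 T1 X1 => t2 t1 x1.
by move: M0; move: M => m m0; field.
Qed.

Let S0M : M * S0 = M1 * s - b2 * E * a'.
Proof.
rewrite /S0 /s /a'; move: S1 X1 => s1 x1.
by move: M0; move: M => m m0; field.
Qed.

Let X0M' : M * X0 = M2 * a' + b2 * E * s.
Proof.
rewrite /X0 /s /a'; move: S1 X1 => s1 x1.
by move: M0; move: M => m m0; field.
Qed.

(* Cramer's rule gives two expressions of X0, according to which of the two
   overlaps is expanded first; they agree by the equations for T2, T1, S1, X1. *)
Let X0M : M * X0 = M1 * c - b2 * E * a.
Proof.
have h0 : M2 * X1 = E * (v + b2 * T2 - 2 * b2 * T1).
  by have := relX1; move: T2 T1 X1 => t2 t1 x1 h; rewrite /M2 mulrBl mul1r {1}h; field.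
have h1 : M1 * X1 = E * (v + 2^-1 * b2 * S1).
  by rewrite /X1 /S1; move: M20; rewrite /M /M2 /M1 => m20; field; rewrite m20.
have h2 : M2 * (v + 2^-1 * b2 * S1) = M1 * (v + b2 * T2 - 2 * b2 * T1).
  rewrite /S1 /T2 /T1 A_M3 A_FG; move: M20 M30; rewrite /M /M3 /M2 /M1 => m20 m30.
  by field; rewrite m20 m30.
have h3 : 2 * G * (M2 * X1) + b2 * E ^+ 2 * X1 = 2 * E * (M3 * T1).
  rewrite /X1 /T1; move: M20 M30; rewrite /M /M2 /M1 => m20 m30.
  by field; rewrite m20 m30.
rewrite X0M' /a' /s /a /c; apply/eqP; rewrite -subr_eq0; apply/eqP.
(* The difference of the two expressions, sorted by I3, I5, K4 and the rest, is a combination of the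
   differences that vanish by h0, h2, h1 and h3. *)
transitivity (- b2 * I3 * (M2 * X1 - E * (v + b2 * T2 - 2 * b2 * T1)) +
  I5 * (M2 * (v + 2^-1 * b2 * S1) - M1 * (v + b2 * T2 - 2 * b2 * T1)) -
  b2 * K4 * (M1 * X1 - E * (v + 2^-1 * b2 * S1)) +
  b2 * (2 * G * (M2 * X1) + b2 * E ^+ 2 * X1 - 2 * E * (M3 * T1))).
  rewrite (_ : M3 = M1 - 2 * b2 * G); last by rewrite /M3 /M1; ring.
  by move: M1 M2 T2 T1 X1 S1 I3 I5 K4 E => ? ? ? ? ? ? ? ? ? ?; ring.
have z (x y : R) : x = y -> x - y = 0 by move=> ->; rewrite subrr.
by rewrite (z _ _ h0) (z _ _ h1) (z _ _ h2) (z _ _ h3); ring.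
Qed.

Lemma relT0 : T0 = v * I3 + b2 * (I3 * T2 + 2 * (2 * G - I3) * T1 + (F - 3 * G) * T0
  + I5 * X1 + E * X0).
Proof.
apply: (mulfI M0).
transitivity (M * a + b2 * (F - 3 * G) * (M * T0) + b2 * E * (M * X0)); last by rewrite /a; ring.
rewrite T0M X0M; move: a c => a0 c0; rewrite /M /M1; ring.
Qed.

Lemma relX0 : X0 = v * I5 + b2 * (I5 * T2 + 2 * (E - I5) * T1 - E * T0 + K4 * X1 + 2^-1 * D * X0).
Proof.
apply: (mulfI M0).
transitivity (M * c - b2 * E * (M * T0) + b2 * (2^-1 * D) * (M * X0)); last by rewrite /c; ring.
by rewrite T0M X0M; move: a c => a0 c0; rewrite /M /M2; field.
Qed.

Lemma relS0 : S0 = v * K4 + b2 * (2^-1 * K4 * S1 + 2^-1 * D * S0 + (E - I5) * X1 - E * X0).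
Proof.
apply: (mulfI M0).
transitivity (M * s + b2 * (2^-1 * D) * (M * S0) - b2 * E * (M * X0)); last by rewrite /s; ring.
by rewrite S0M X0M'; move: a' s => a0 c0; rewrite /M /M2; field.
Qed.

(** These sums reflect the decomposition of R_12 - q as T_12 + T_1 + T_2 + T and of R_11 - p as S_1
    + S, obtained by centring in each replica given the disorder. The components are orthogonal, so
    the second moment of an overlap, or of two overlaps sharing replicas, adds those of the
    components in common. *)
Let y0 := T2 + 2 * T1 + T0.
Let y1 := T1 + T0.
Let y3 := S1 + S0.
Let y5 := X1 + X0.
Let yt := pair_type y0 y1 T0 y3 S0 y5 X0.
Let cmt := cmom_type p q e4 e13 e22 e112 e1111.
Let rhs (u : nat -> nat -> nat -> nat -> R) (a b c d : nat) := v * cmt a b c d + b2 / 2 *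
  \sum_(l < 10) \sum_(l' < 10) rcoef 4 l * rcoef 5 l' * (cmt a b l l' * u c d l l').

Ltac expand_rhs := rewrite /rhs (rcoef_sum (fun l l' => cmt _ _ l l' * yt _ _ l l'))
  /cmt /yt /cmom_type /moment_type /pair_type /= /y0 /y1 /y3 /y5;
  move: relT2 relT1 relT0 relX1 relX0 relS1 relS0;
  rewrite /A /D /F /G /E /I3 /I5 /K4;
  move: T2 T1 T0 X1 X0 S1 S0 => t2 t1 t0 x1 x0 s1 s0 r2 r1 r0 rx1 rx0 rs1 rs0.

(** The equation of each orbit is the matching sum of component relations: [relT2], twice [relT1]
    and [relT0] here, fewer when fewer replicas are shared. *)
Lemma exact0101 : yt 0 1 0 1 = rhs yt 0 1 0 1.
Proof. by expand_rhs; rewrite {1}r2 {1}r1 {1}r0; field. Qed.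

Lemma exact0102 : yt 0 1 0 2 = rhs yt 0 1 0 2.
Proof. by expand_rhs; rewrite {1}r1 {1}r0; field. Qed.

Lemma exact0123 : yt 0 1 2 3 = rhs yt 0 1 2 3.
Proof. by expand_rhs; rewrite {1}r0; field. Qed.

Lemma exact0000 : yt 0 0 0 0 = rhs yt 0 0 0 0.
Proof. by expand_rhs; rewrite {1}rs1 {1}rs0; field. Qed.

Lemma exact0011 : yt 0 0 1 1 = rhs yt 0 0 1 1.
Proof. by expand_rhs; rewrite {1}rs0; field. Qed.

Lemma exact0001 : yt 0 0 0 1 = rhs yt 0 0 0 1.
Proof. by expand_rhs; rewrite {1}rx1 {1}rx0; field. Qed.

Lemma exact0012 : yt 0 0 1 2 = rhs yt 0 0 1 2.
Proof. by expand_rhs; rewrite {1}rx0; field. Qed.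

Variables (u0 u1 u2 u3 u4 u5 u6 eps Bd : R).
Let ut := pair_type u0 u1 u2 u3 u4 u5 u6.
Hypotheses (b20 : 0 <= b2) (cmt_le : forall a b c d, `|cmt a b c d| <= Bd)
  (contr : b2 * (280 * Bd) <= 2^-1).
Hypothesis approx : forall a b c d, (a < 4)%N -> (b < 4)%N -> (c < 4)%N -> (d < 4)%N ->
  `|ut a b c d - rhs ut a b c d| <= eps.

Let m := `|u0 - y0| + `|u1 - y1| + `|u2 - T0| + `|u3 - y3| + `|u4 - S0| + `|u5 - y5| + `|u6 - X0|.

Let type_dist k1 k2 k3 k4 : `|ut k1 k2 k3 k4 - yt k1 k2 k3 k4| <= m.
Proof.
have := normr_ge0 (u0 - y0); have := normr_ge0 (u1 - y1); have := normr_ge0 (u2 - T0).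
have := normr_ge0 (u3 - y3); have := normr_ge0 (u4 - S0); have := normr_ge0 (u5 - y5).
have := normr_ge0 (u6 - X0); rewrite /ut /yt /pair_type /m.
by do !case: ifP => _; lra.
Qed.

Let contract k1 k2 k3 k4 : (k1 < 4)%N -> (k2 < 4)%N -> (k3 < 4)%N -> (k4 < 4)%N ->
  yt k1 k2 k3 k4 = rhs yt k1 k2 k3 k4 -> `|ut k1 k2 k3 k4 - yt k1 k2 k3 k4| <= eps + b2 * (40 * Bd) * m.
Proof.
move=> a4 b4 c4 d4 ey.
have m0 : 0 <= m by rewrite !addr_ge0.
have -> : ut k1 k2 k3 k4 - yt k1 k2 k3 k4 = (ut k1 k2 k3 k4 - rhs ut k1 k2 k3 k4) + (rhs ut k1 k2 k3 k4 - rhs yt k1 k2 k3 k4).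
  by rewrite -ey; ring.
rewrite (le_trans (ler_normD _ _))// lerD ?approx//.
rewrite /rhs [X in `|X|](_ : _ = b2 / 2 * \sum_(l < 10) \sum_(l' < 10)
   rcoef 4 l * rcoef 5 l' * (cmt k1 k2 l l' * (ut k3 k4 l l' - yt k3 k4 l l'))); last first.
  rewrite opprD addrACA subrr add0r -mulrBr -sumrB; congr (_ * _); apply: eq_bigr => l _.
  by rewrite -sumrB; apply: eq_bigr => l' _; ring.
rewrite normrM ger0_norm ?divr_ge0//.
apply: (@le_trans _ _ (b2 / 2 * (80 * (Bd * m)))); last first.
  by rewrite le_eqVlt; apply/orP; left; apply/eqP; field.
rewrite ler_wpM2l ?divr_ge0// -rcoef_abs_sum mulr_suml.
rewrite (le_trans (ler_norm_sum _ _ _))// ler_sum// => l _.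
rewrite mulr_suml (le_trans (ler_norm_sum _ _ _))// ler_sum// => l' _.
by rewrite normrM ler_wpM2l// normrM ler_pM.
Qed.

(** Each of the seven distances is at most eps plus 40 b2 Bd m, with m their sum and 40 = 80 / 2.
    Summing gives m <= 7 eps + 280 b2 Bd m, and at most half of m is absorbed. *)
Lemma stable_solution : [/\ `|u2 - T0| <= 14 * eps, `|u4 - S0| <= 14 * eps & `|u6 - X0| <= 14 * eps].
Proof.
have m0 : 0 <= m by rewrite !addr_ge0.
have c1 := contract (isT : (0 < 4)%N) (isT : (1 < 4)%N) (isT : (0 < 4)%N) (isT : (1 < 4)%N) exact0101.
have c2 := contract (isT : (0 < 4)%N) (isT : (1 < 4)%N) (isT : (0 < 4)%N) (isT : (2 < 4)%N) exact0102.
have c3 := contract (isT : (0 < 4)%N) (isT : (1 < 4)%N) (isT : (2 < 4)%N) (isT : (3 < 4)%N) exact0123.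
have c4 := contract (isT : (0 < 4)%N) (isT : (0 < 4)%N) (isT : (0 < 4)%N) (isT : (0 < 4)%N) exact0000.
have c5 := contract (isT : (0 < 4)%N) (isT : (0 < 4)%N) (isT : (1 < 4)%N) (isT : (1 < 4)%N) exact0011.
have c6 := contract (isT : (0 < 4)%N) (isT : (0 < 4)%N) (isT : (0 < 4)%N) (isT : (1 < 4)%N) exact0001.
have c7 := contract (isT : (0 < 4)%N) (isT : (0 < 4)%N) (isT : (1 < 4)%N) (isT : (2 < 4)%N) exact0012.
move: c1 c2 c3 c4 c5 c6 c7; rewrite /ut /yt /pair_type /= => c1 c2 c3 c4 c5 c6 c7.
have bm : b2 * (280 * Bd) * m <= 2^-1 * m by rewrite ler_wpM2r.
have E40 : b2 * (280 * Bd) * m = 7 * (b2 * (40 * Bd) * m) by ring.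
have mE : m = `|u0 - y0| + `|u1 - y1| + `|u2 - T0| + `|u3 - y3| + `|u4 - S0| + `|u5 - y5| + `|u6 - X0| by [].
have m14 : m <= 14 * eps by rewrite E40 in bm; lra.
have := normr_ge0 (u0 - y0); have := normr_ge0 (u1 - y1); have := normr_ge0 (u2 - T0).
have := normr_ge0 (u3 - y3); have := normr_ge0 (u4 - S0); have := normr_ge0 (u5 - y5).
have := normr_ge0 (u6 - X0) => z1 z2 z3 z4 z5 z6 z7.
by split; lra.
Qed.

End Exact.
End LinearSystem.

(** * Bounds on the one-spin constants *)

Section Constants.
Context {R : realType}.

(** Every abbreviation is now a variable tied by an equation, so that the concrete constants enter
    together with proofs of their formulas. *)
Lemma linear_system_stable
  (p q e4 e13 e22 e112 e1111 b2 v A D F G E I3 I5 K4 M1 M2 M3 M T2 T1 S1 X1 T0 S0 X0 : R)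
  (u0 u1 u2 u3 u4 u5 u6 eps Bd : R) :
  A = e22 - 2 * e112 + e1111 -> D = e4 - e22 -> F = e22 - e112 -> G = e112 - e1111 ->
  E = e13 - e112 -> I3 = e1111 - q ^+ 2 -> I5 = e112 - p * q -> K4 = e22 - p ^+ 2 ->
  M1 = 1 - b2 * (F - 3 * G) -> M2 = 1 - b2 / 2 * D -> M3 = 1 - b2 * (F - G) ->
  M = M1 * M2 + b2 ^+ 2 * E ^+ 2 -> M != 0 -> M3 != 0 -> 1 - b2 * A != 0 ->
  T2 = A * v / (1 - b2 * A) -> T1 = (G * M2 + b2 / 2 * E ^+ 2) * v / (M * M3) ->
  S1 = (D * M1 - 2 * b2 * E ^+ 2) * v / M -> X1 = E * v / M ->
  T0 = b2 / M * (b2 * E * K4 + M2 * I5) * X1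
    + 2 * b2 / M * (b2 * E * (E - I5) + M2 * (2 * G - I3)) * T1
    + b2 / M * (b2 * E * I5 + M2 * I3) * T2 + v / M * (b2 * E * I5 + M2 * I3) ->
  S0 = b2 / (2 * M) * (M1 * K4 - b2 * E * I5) * S1
    + b2 / M * (M1 * (E - I5) - b2 * E * (2 * G - I3)) * X1
    + v / M * (M1 * K4 - b2 * E * I5) ->
  X0 = b2 / (2 * M) * (M2 * I5 + b2 * E * K4) * S1
    + b2 / M * (M2 * (2 * G - I3) + b2 * E * (E - I5)) * X1
    + v / M * (M2 * I5 + b2 * E * K4) ->
  0 <= b2 -> (forall a b c d, `|cmom_type p q e4 e13 e22 e112 e1111 a b c d| <= Bd) ->
  b2 * (280 * Bd) <= 2^-1 ->
  (forall a b c d, (a < 4)%N -> (b < 4)%N -> (c < 4)%N -> (d < 4)%N ->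
    `|pair_type u0 u1 u2 u3 u4 u5 u6 a b c d -
      (v * cmom_type p q e4 e13 e22 e112 e1111 a b c d + b2 / 2 *
       \sum_(l < 10) \sum_(l' < 10) rcoef 4 l * rcoef 5 l' *
         (cmom_type p q e4 e13 e22 e112 e1111 a b l l' *
          pair_type u0 u1 u2 u3 u4 u5 u6 c d l l'))| <= eps) ->
  [/\ `|u2 - T0| <= 14 * eps, `|u4 - S0| <= 14 * eps & `|u6 - X0| <= 14 * eps].
Proof.
do 12!move=> ->; move=> m m3 a0; do 7!move=> ->; exact: stable_solution.
Qed.

Lemma gaussED (f g : R -> R) : tame1 f -> tame1 g -> gaussE (fun x => f x + g x) = gaussE f + gaussE g.
Proof.
move=> tf tg; rewrite -[gaussE f in RHS]mul1r -gaussE_linear//.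
by congr gaussE; apply/funext => x; rewrite mul1r.
Qed.

Lemma gaussEZ (c : R) (f : R -> R) : tame1 f -> gaussE (fun x => c * f x) = c * gaussE f.
Proof.
move=> tf; rewrite -[RHS]addr0 -[X in _ = _ + X]gaussE_cst -gaussE_linear//; last exact: tame1_cst.
by congr gaussE; apply/funext => x; rewrite addr0.
Qed.

Lemma tame1X (f : R -> R) (k : nat) : tame1 f -> tame1 (fun x => f x ^+ k).
Proof.
move=> tf; elim: k => [|k IH]; first by under eq_fun do rewrite expr0; exact: tame1_cst.
by under eq_fun do rewrite exprS; exact: tame1M.
Qed.

Lemma tame1Z (c : R) (f : R -> R) : tame1 f -> tame1 (fun x => c * f x).
Proof. by move=> tf; apply: tame1M => //; exact: tame1_cst. Qed.

Lemma tame1D (f g : R -> R) : tame1 f -> tame1 g -> tame1 (fun x => f x + g x).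
Proof. by move=> /tame1_tame_id tf /tame1_tame_id tg; apply/tame1_tame_id; exact: tameD. Qed.

Lemma gaussE_norm_le (f : R -> R) (C : R) : tame1 f -> (forall x, `|f x| <= C) -> `|gaussE f| <= C.
Proof.
move=> tf fC; rewrite ler_norml; apply/andP; split.
  rewrite -[leLHS]gaussE_cst; apply: gaussE_le => [||x]; [exact: tame1_cst|by []|].
  by have := fC x; rewrite ler_norml => /andP[].
rewrite -[leRHS]gaussE_cst; apply: gaussE_le => [||x]; [by []|exact: tame1_cst|].
by have := fC x; rewrite ler_norml => /andP[].
Qed.

Variables (S : nat) (beta h D p q : R).
Local Notation mj_ := (mj S beta h D p q).
Local Notation sb := (S%:R ^+ 2 : R).

Lemma norm_mj j x : `|mj_ j x| <= S%:R ^+ j.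
Proof.
rewrite -savg_mj /savg (le_trans (ler_norm_sum _ _ _))//.
have E := sum_wgt (ord0 : 'I_(S.*2.+1)) (senergy beta h D p q x).
rewrite -[leRHS]mulr1 -[X in _ <= _ * X]E mulr_sumr ler_sum// => k _.
rewrite normrM [`|wgt _ _|]ger0_norm ?(wgt_ge0 ord0)// ler_wpM2r ?(wgt_ge0 ord0)//.
by rewrite normrX lerXn2r ?nnegrE// norm_spin.
Qed.

Let t_ j : tame1 (mj_ j) := tame1_mj S beta h D p q j.
Local Notation e4_ := (e4 S beta h D p q).
Local Notation e13_ := (e13 S beta h D p q).
Local Notation e22_ := (e22 S beta h D p q).
Local Notation e112_ := (e112 S beta h D p q).
Local Notation e1111_ := (e1111 S beta h D p q).

Let sb2 : S%:R ^+ 4 = sb ^+ 2 :> R. Proof. by rewrite -exprM. Qed.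

Lemma norm_e4 : `|e4_| <= sb ^+ 2.
Proof. by rewrite -sb2; apply: gaussE_norm_le => // x; exact: norm_mj. Qed.

Lemma norm_e13 : `|e13_| <= sb ^+ 2.
Proof.
apply: gaussE_norm_le => [|x]; first exact: tame1M.
rewrite -sb2 (_ : S%:R ^+ 4 = S%:R ^+ 1 * S%:R ^+ 3); last by rewrite -exprD.
by rewrite normrM ler_pM ?norm_mj.
Qed.

Lemma norm_e22 : `|e22_| <= sb ^+ 2.
Proof.
apply: gaussE_norm_le => [|x]; first exact: tame1X.
by rewrite normrX lerXn2r ?nnegrE ?norm_mj.
Qed.

Lemma norm_e112 : `|e112_| <= sb ^+ 2.
Proof.
apply: gaussE_norm_le => [|x]; first by apply: tame1M => //; exact: tame1X.
rewrite -sb2 (_ : S%:R ^+ 4 = (S%:R ^+ 1) ^+ 2 * S%:R ^+ 2); last by rewrite -exprM -exprD.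
by rewrite normrM normrX ler_pM ?exprn_ge0 ?norm_mj// lerXn2r ?nnegrE ?norm_mj.
Qed.

Lemma norm_e1111 : `|e1111_| <= sb ^+ 2.
Proof.
apply: gaussE_norm_le => [|x]; first exact: tame1X.
by rewrite -sb2 normrX lerXn2r ?nnegrE//; exact: norm_mj 1 x.
Qed.

Lemma cAE : cA S beta h D p q = e22_ - 2 * e112_ + e1111_.
Proof.
have t1 : tame1 (fun x => mj_ 1 x ^+ 2 * mj_ 2 x) by apply: tame1M => //; exact: tame1X.
have t2 : tame1 (fun x => mj_ 2 x ^+ 2) by exact: tame1X.
have t3 : tame1 (fun x => - 2 * (mj_ 1 x ^+ 2 * mj_ 2 x)) by exact: tame1Z.
have t4 : tame1 (fun x => mj_ 1 x ^+ 4) by exact: tame1X.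
rewrite /cA /e22 /e112 /e1111 -mulNr -gaussEZ// -gaussED// -gaussED//; last exact: tame1D.
by congr gaussE; apply/funext => x; ring.
Qed.

Let gaussEB (f g : R -> R) : tame1 f -> tame1 g -> gaussE (fun x => f x - g x) = gaussE f - gaussE g.
Proof.
move=> tf tg; rewrite -mulN1r -gaussEZ// -gaussED//; last exact: tame1Z.
by congr gaussE; apply/funext => x; rewrite mulN1r.
Qed.

Lemma cDE : cD S beta h D p q = e4_ - e22_.
Proof. by rewrite /cD /e4 /e22 -gaussEB//; exact: tame1X. Qed.

Lemma cFE : cF S beta h D p q = e22_ - e112_.
Proof.
by rewrite /cF /e22 /e112 -gaussEB//; [exact: tame1X|apply: tame1M => //; exact: tame1X].
Qed.

Lemma cGE : cG S beta h D p q = e112_ - e1111_.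
Proof.
rewrite /cG /e112 /e1111 -gaussEB//; [|by apply: tame1M => //; exact: tame1X|exact: tame1X].
by congr gaussE; apply/funext => x; ring.
Qed.

Lemma cEE : cE S beta h D p q = e13_ - e112_.
Proof.
rewrite /cE /e13 /e112 -gaussEB//; [|exact: tame1M|by apply: tame1M => //; exact: tame1X].
by congr gaussE; apply/funext => x; ring.
Qed.

(** Any solution is a Gaussian mean of quantities bounded by S^2; this keeps the conditions on beta
    independent of p and q. *)
Lemma fixed_point_bounds : fixed_point S beta h D p q -> [/\ 0 <= q, q <= sb & `|p| <= sb].
Proof.
case=> hq hp; have tq : tame1 (fun x => mj_ 1 x ^+ 2) by exact: tame1X.
split.
- rewrite hq -[leLHS]gaussE_cst; apply: gaussE_le => // [|x]; first exact: tame1_cst.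
  exact: sqr_ge0.
- rewrite hq (le_trans (ler_norm _))//; apply: gaussE_norm_le => // x.
  by rewrite normrX lerXn2r ?nnegrE//; exact: norm_mj 1 x.
- by rewrite [in leLHS]hp; apply: gaussE_norm_le => // x; exact: norm_mj.
Qed.

Lemma norm_cmom_type a b c d : fixed_point S beta h D p q ->
  `|cmom_type p q e4_ e13_ e22_ e112_ e1111_ a b c d| <= 2 * sb ^+ 2.
Proof.
move=> /fixed_point_bounds[q0 qS pS].
have qS' : `|q| <= sb by rewrite ger0_norm.
rewrite /cmom_type (le_trans (ler_normB _ _))// mulrDl mul1r lerD//.
  rewrite /moment_type; do !case: ifP => _;
  by rewrite ?norm_e4 ?norm_e13 ?norm_e22 ?norm_e112 ?norm_e1111.
by rewrite normrM [leRHS]expr2; apply: ler_pM => //; case: ifP.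
Qed.

End Constants.

(** * From replicas back to S and T, and conclusion *)

Section GibbsObservables.
Context {R : realType}.
Variables (S N : nat) (beta h D p q : R) (y : nat -> R).
Local Notation cfg := (config S N).
Local Notation reps := {ffun 'I_10 -> cfg}.
Local Notation H := (@hamil R S N beta h D y).
Local Notation avg_ := (@avg R cfg 10 H).

Lemma gibbs_savg (g : cfg -> R) : gibbs beta h D y g = savg H g.
Proof. by rewrite /gibbs mulr_suml; apply: eq_bigr => s _; rewrite -mulrA. Qed.

(** Given the disorder, replicas l and l' are independent of each other and of [f]; averaging over
    them turns the overlap into T. *)
Lemma avg_xx_off (f : reps -> R) (l l' : 'I_10) : l != l' ->
  (forall s t, f (fupd s l t) = f s) -> (forall s t, f (fupd s l' t) = f s) ->
  avg_ (fun s => f s * xx p q l l' s) = avg_ f * Tq S N beta h D q y.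
Proof.
move=> ll' fl fl'.
rewrite (_ : (fun s => _) = (fun s => N%:R^-1 * (\sum_(j < N) (f s * spin (s l j)) * spin (s l' j)) + - q * f s)); last first.
  apply/funext => s; rewrite /xx /rpq (negbTE ll') mulrBr mulrCA; congr (_ * _ + _); last ring.
  by rewrite mulr_sumr; apply: eq_bigr => j _; rewrite mulrA.
rewrite avgD !avgZ avg_sum /Tq mulrBr mulrCA; congr (_ * _ + _); last ring.
rewrite mulr_sumr; apply: eq_bigr => j _.
rewrite (avg_indep (cfg0 S N) H (l := l') (fun o : cfg => spin (o j))); last first.
  by move=> s t; rewrite fl' fupd_neq.
rewrite (avg_indep (cfg0 S N) H (l := l) (fun o : cfg => spin (o j)))//.
by rewrite !gibbs_savg expr2 mulrA.
Qed.

Lemma avg_xx_diag (f : reps -> R) (l : 'I_10) : (forall s t, f (fupd s l t) = f s) ->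
  avg_ (fun s => f s * xx p q l l s) = avg_ f * Sp S N beta h D p y.
Proof.
move=> fl.
rewrite (_ : (fun s => _) = (fun s => N%:R^-1 * (\sum_(j < N) f s * spin (s l j) ^+ 2) + - p * f s)); last first.
  apply/funext => s; rewrite /xx /rpq eqxx mulrBr mulrCA; congr (_ * _ + _); last ring.
  by rewrite mulr_sumr.
rewrite avgD !avgZ avg_sum /Sp mulrBr mulrCA; congr (_ * _ + _); last ring.
rewrite mulr_sumr; apply: eq_bigr => j _.
rewrite (avg_indep (cfg0 S N) H (l := l) (fun o : cfg => spin (o j) ^+ 2))//.
by rewrite gibbs_savg.
Qed.

End GibbsObservables.

Section Assembly.
Context {R : realType}.
Variables (S N : nat) (beta h D p q : R).
Local Notation sb := (S%:R ^+ 2 : R).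

Lemma xx_fupd (a b l : 'I_10) (s : {ffun 'I_10 -> config S N}) t : a != l -> b != l ->
  xx p q a b (fupd s l t) = xx p q a b s :> R.
Proof.
move=> al bl; rewrite /xx; congr (_ * _ - _); apply: eq_bigr => j _.
by rewrite !fupd_neq.
Qed.

(** The square is a product of two averages, realized on two disjoint pairs of replicas; this is why
    the linear system needs four replicas. *)
Lemma nuxx_TT : nuxx S N beta h D p q r0 r1 r2 r3 = nu N (fun y => Tq S N beta h D q y ^+ 2).
Proof.
congr gaussEn; apply/funext => y.
rewrite avg_xx_off//; last 2 first; try by move=> s t; exact: xx_fupd.
rewrite (_ : xx p q r0 r1 = fun s => 1 * xx p q r0 r1 s); last by apply/funext => s; rewrite mul1r.
by rewrite avg_xx_off// avg_cst ?mul1r//; exact: cfg0.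
Qed.

Lemma nuxx_SS : nuxx S N beta h D p q r0 r0 r1 r1 = nu N (fun y => Sp S N beta h D p y ^+ 2).
Proof.
congr gaussEn; apply/funext => y.
rewrite avg_xx_diag//; last by move=> s t; exact: xx_fupd.
rewrite (_ : xx p q r0 r0 = fun s => 1 * xx p q r0 r0 s); last by apply/funext => s; rewrite mul1r.
by rewrite avg_xx_diag// avg_cst ?mul1r//; exact: cfg0.
Qed.

Lemma nuxx_ST : nuxx S N beta h D p q r0 r0 r1 r2 =
  nu N (fun y => Sp S N beta h D p y * Tq S N beta h D q y).
Proof.
congr gaussEn; apply/funext => y.
rewrite avg_xx_off//; last 2 first; try by move=> s t; exact: xx_fupd.
rewrite (_ : xx p q r0 r0 = fun s => 1 * xx p q r0 r0 s); last by apply/funext => s; rewrite mul1r.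
by rewrite avg_xx_diag// avg_cst ?mul1r//; exact: cfg0.
Qed.

(** The first term is for concentration, the second, with 560 = 280 * 2 and covariances at most 2
    S^4, for the contraction of the system; adding 1 also gives beta <= 1. *)
Definition smallness : R := K1 S * (2 * sb) * (16 * c4) + 560 * sb ^+ 2 + 1.

Let s4 : 0 <= sb ^+ 2 := exprn_ge0 2 (sqr_ge0 (S%:R : R)).

Lemma smallness_parts : 0 <= K1 S * (2 * sb) * (16 * c4) :> R.
Proof.
apply: mulr_ge0; last by rewrite mulr_ge0// (le_trans _ (@c2_le_c4 R))// (le_trans _ (@c2_ge1 R)).
by apply: mulr_ge0; [exact: K1_ge0|rewrite mulr_ge0// sqr_ge0].
Qed.

Let smallness_part2 : 0 <= 560 * sb ^+ 2 :> R.
Proof. by apply: mulr_ge0; [exact: ler0n|]. Qed.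

Lemma smallness_ge1 : 1 <= smallness.
Proof.
rewrite /smallness lerDr; apply: addr_ge0; first exact: smallness_parts.
exact: smallness_part2.
Qed.

Hypotheses (N0 : (0 < N)%N) (b0 : 0 <= beta) (bs : beta * (2 * smallness) <= 1).
Hypothesis fp : fixed_point S beta h D p q.

Let b1 : beta <= 1.
Proof.
apply: le_trans bs; rewrite ler_peMr// (le_trans smallness_ge1)// mulr_natl mulr2n lerDl.
exact: le_trans smallness_ge1.
Qed.

Let b2s : beta ^+ 2 * smallness <= 2^-1.
Proof.
have s1 := smallness_ge1.
apply: (@le_trans _ _ (beta * smallness)); last by move: smallness bs => k bs'; lra.
by rewrite ler_wpM2r ?(le_trans _ s1)// expr2 ler_piMr.
Qed.

Let b20 : 0 <= beta ^+ 2 := sqr_ge0 beta.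

Lemma small_kap : kap S beta * (16 * c4) <= 2^-1.
Proof.
rewrite /kap -mulrA; apply: le_trans b2s; apply: ler_wpM2l => //.
by rewrite /smallness -addrA lerDl; apply: addr_ge0; [exact: smallness_part2|exact: ler01].
Qed.

Lemma small_moments : beta ^+ 2 * (280 * (2 * sb ^+ 2)) <= 2^-1.
Proof.
apply: le_trans b2s; apply: ler_wpM2l => //.
rewrite (_ : 280 * (2 * sb ^+ 2) = 560 * sb ^+ 2); last by ring.
by rewrite /smallness addrAC lerDr; apply: addr_ge0; [exact: smallness_parts|exact: ler01].
Qed.

(** The contraction condition keeps beta^2 times each combination of moments below 1/4, so M1, M2
    and M3 are positive, and M is a positive product plus a square. *)
Lemma nondegenerate : [/\ cM S beta h D p q != 0, cM3 S beta h D p q != 0 &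
  1 - beta ^+ 2 * cA S beta h D p q != 0].
Proof.
have := small_moments.
have /ler_normlP[n1 n1'] := norm_e4 S beta h D p q; have /ler_normlP[n2 n2'] := norm_e13 S beta h D p q.
have /ler_normlP[n3 n3'] := norm_e22 S beta h D p q; have /ler_normlP[n4 n4'] := norm_e112 S beta h D p q.
have /ler_normlP[n5 n5'] := norm_e1111 S beta h D p q.
rewrite /cM /cM1 /cM2 /cM3 cAE cDE cFE cGE cEE.
move: n1 n1' n2 n2' n3 n3' n4 n4' n5 n5'.
move: (e4 _ _ _ _ _ _) (e13 _ _ _ _ _ _) (e22 _ _ _ _ _ _) (e112 _ _ _ _ _ _) (e1111 _ _ _ _ _ _) => x4 x13 x22 x112 x1111.
have := b20; move: s4; move: (beta ^+ 2) (sb ^+ 2) => t B B0 t0 n1 n1' n2 n2' n3 n3' n4 n4' n5 n5' sm.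
have bnd (z : R) : z <= 280 * B -> t * z <= 4^-1.
  by move=> zB; have := ler_wpM2l t0 zB; lra.
have M1 : 0 < 1 - t * (x22 - x112 - 3 * (x112 - x1111)) by have := @bnd (x22 - x112 - 3 * (x112 - x1111)); lra.
have M2 : 0 < 1 - t / 2 * (x4 - x22) by have := @bnd (x4 - x22); lra.
split.
- by rewrite gt_eqF// ltr_pwDl ?mulr_gt0// mulr_ge0 ?sqr_ge0// exprn_even_ge0.
- by rewrite gt_eqF//; have := @bnd (x22 - x112 - (x112 - x1111)); lra.
- by rewrite gt_eqF//; have := @bnd (x22 - 2 * x112 + x1111); lra.
Qed.

Definition KEtot : R := \sum_(a < 10) \sum_(b < 10) `|KE S beta h D p q a b|.

Lemma KE_le a b : KE S beta h D p q a b <= KEtot.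
Proof.
rewrite (le_trans (ler_norm _))// /KEtot (bigD1 a)//= (bigD1 b)//= -addrA lerDl.
by rewrite addr_ge0 ?sumr_ge0// => j _; rewrite sumr_ge0.
Qed.

Theorem overlap_moments :
  [/\ `|nuxx S N beta h D p q r0 r1 r2 r3 - A0sq S beta h D p q N| <= 14 * (KEtot * w N ^+ 3),
      `|nuxx S N beta h D p q r0 r0 r1 r1 - B0sq S beta h D p q N| <= 14 * (KEtot * w N ^+ 3) &
      `|nuxx S N beta h D p q r0 r0 r1 r2 - C0sq S beta h D p q N| <= 14 * (KEtot * w N ^+ 3)].
Proof.
have [Mn M3n An] := nondegenerate.
have [q0 qS pS] := fixed_point_bounds fp.
apply: (@linear_system_stable R p q (e4 S beta h D p q) (e13 S beta h D p q) (e22 S beta h D p q)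
  (e112 S beta h D p q) (e1111 S beta h D p q) (beta ^+ 2) N%:R^-1
  (cA S beta h D p q) (cD S beta h D p q) (cF S beta h D p q) (cG S beta h D p q) (cE S beta h D p q)
  (cI3 S beta h D p q) (cI5 S beta h D p q) (cK4 S beta h D p q)
  (cM1 S beta h D p q) (cM2 S beta h D p q) (cM3 S beta h D p q) (cM S beta h D p q)
  (A2sq S beta h D p q N) (A1sq S beta h D p q N) (B1sq S beta h D p q N) (C1sq S beta h D p q N)
  (A0sq S beta h D p q N) (B0sq S beta h D p q N) (C0sq S beta h D p q N)
  (nuxx S N beta h D p q r0 r1 r0 r1) (nuxx S N beta h D p q r0 r1 r0 r2) _
  (nuxx S N beta h D p q r0 r0 r0 r0) _ (nuxx S N beta h D p q r0 r0 r0 r1) _ _ (2 * sb ^+ 2)) => //.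
- exact: cAE.
- exact: cDE.
- exact: cFE.
- exact: cGE.
- exact: cEE.
- by rewrite /cM -exprM.
- by rewrite /A2sq invfM mulrA.
- by rewrite /A1sq -(mulrA N%:R) invfM mulrA.
- by rewrite /B1sq invfM mulrA.
- by rewrite /C1sq invfM mulrA.
- by rewrite /A0sq /= (invfM _ N%:R); congr (_ + _ * _); rewrite mulrC.
- by rewrite /B0sq /= (invfM _ N%:R); congr (_ + _ * _); rewrite mulrC.
- by rewrite /C0sq /= (invfM _ N%:R); congr (_ + _ * _); rewrite mulrC.
- by move=> a b c d; exact: norm_cmom_type.
- exact: small_moments.
move=> a b c d a4 b4 c4_ d4.
have L (k : nat) (k4 : (k < 4)%N) : (k < 10)%N by exact: leq_trans k4 _.
pose a' := Ordinal (L a a4); pose b' := Ordinal (L b b4); pose c' := Ordinal (L c c4_); pose d' := Ordinal (L d d4).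
have := @cavity_equation R S N beta h D p q N0 b0 b1 q0 qS pS fp small_kap a' b' c' d' a4 b4 c4_ d4.
have cmE (k1 k2 k3 k4 : 'I_10) : cmom S beta h D p q k1 k2 k3 k4 =
    cmom_type p q (e4 S beta h D p q) (e13 S beta h D p q) (e22 S beta h D p q)
      (e112 S beta h D p q) (e1111 S beta h D p q) k1 k2 k3 k4.
  by rewrite /cmom mom_type mom2// /rpq /cmom_type !val_eqE.
have nuE k1 k2 k3 k4 := nuxx_type S beta h D p q N0 k1 k2 k3 k4.
rewrite -[nuR _ _ _ _]/(nuxx S N beta h D p q a' b' c' d') nuE cmE.
under eq_bigr => l _ do under eq_bigr => l' _ do
  rewrite -[nuR _ _ _ _]/(nuxx S N beta h D p q c' d' l l') nuE cmE -mulrA.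
move=> /le_trans; apply; rewrite ler_wpM2r ?KE_le// exprn_ge0// ltW//.
exact: w_gt0.
Qed.

End Assembly.

Theorem theorem4p17 (R : realType) (S : nat) (h D : R) :
  (1 <= S)%N -> 0 <= h ->
  exists beta' : R, 0 < beta' /\
  forall beta : R, 0 < beta -> beta < beta' ->
  forall p q : R, fixed_point S beta h D p q ->
  exists C : R, forall N : nat, (2 <= N)%N ->
    `| nu N (fun y => Tq S N beta h D q y ^+ 2) - A0sq S beta h D p q N |
      <= C / (N%:R * Num.sqrt N%:R) /\
    `| nu N (fun y => Sp S N beta h D p y ^+ 2) - B0sq S beta h D p q N |
      <= C / (N%:R * Num.sqrt N%:R) /\
    `| nu N (fun y => Sp S N beta h D p y * Tq S N beta h D q y) - C0sq S beta h D p q N |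
      <= C / (N%:R * Num.sqrt N%:R).
Proof.
move=> S1 _; have s0 : 0 < 2 * smallness S :> R.
  by rewrite mulr_gt0// (lt_le_trans _ (smallness_ge1 S)).
(* Then beta <= 1 and beta^2 times [smallness] is at most 1/2, which is the form used by both
   smallness conditions. *)
exists (2 * smallness S)^-1; split; first by rewrite invr_gt0.
move=> beta b0 bs p q fp; exists (14 * KEtot S beta h D p q) => N N2.
have N0 : (0 < N)%N by exact: leq_trans N2.
have bs' : beta * (2 * smallness S) <= 1 by rewrite -ler_pdivlMr// div1r ltW.
have [E1 E2 E3] := overlap_moments N0 (ltW b0) bs' fp.
have <- : 14 * (KEtot S beta h D p q * w N ^+ 3) = 14 * KEtot S beta h D p q / (N%:R * Num.sqrt N%:R).
  by rewrite mulrA invfM w_sqr /w -exprSr.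
by rewrite -(nuxx_TT _ _ _ _ _ p) -(nuxx_SS _ _ _ _ _ _ q) -nuxx_ST.
Qed.
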